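(* Let $(X,g)$ be a closed Riemannian manifold, $E,F\to X$ real vector bundles with metrics, $D:\Gamma(E)\to\Gamma(F)$ a first order elliptic differential operator with symbol $\sigma$, and $\mathcal{A}:E\to F$ a real bundle map such that $(\sigma,\mathcal{A})$ is a concentrating pair. For $s\in\mathbb{R}$ set $D_s=D+s\mathcal{A}$. Then for each $\delta>0$ and $C\ge 0$ there is a constant $C'=C'(\delta,\mathcal{A},C)>0$ such that, for every real $s\neq 0$, if $\xi\in C^\infty(E)$ has $L^2$ norm $\|\xi\|_2=1$ and satisfies $\|D_s\xi\|_2^2\le C|s|$, then $$\int_{\Omega(\delta)}|\xi|^2\,dv_g<\frac{C'}{|s|}.$$
   Context: The symbol of $D$ is the bundle map $\sigma:T^*X\to \mathrm{Hom}(E,F)$ defined by $D(f\xi)=\sigma(df)\xi+fD\xi$ for $f\in C^\infty(X)$, $\xi\in\Gamma(E)$. The pair $(\sigma,\mathcal{A})$ is called a concentrating pair if $\mathcal{A}^*\circ\sigma(u)=\sigma(u)^*\circ\mathcal{A}$ for every $u\in T^*X$, where $*$ denotes the fiberwise adjoint with respect to the bundle metrics. The singular set is $Z_{\mathcal{A}}=\{x\in X\mid \ker\mathcal{A}(x)\neq 0\}$; $Z(\delta)$ denotes the $\delta$-neighborhood of $Z_{\mathcal{A}}$ and $\Omega(\delta)=X\setminus Z(\delta)$. The constant $C'$ does not depend on $s$ or $\xi$ (the data $X,g,E,F,D$ are fixed). *)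

(* Defs.v *)
From HB Require Import structures.
From mathcomp Require Import all_boot all_order all_algebra.
From mathcomp Require Import all_classical all_reals all_analysis.

Set Implicit Arguments.
Unset Strict Implicit.
Unset Printing Implicit Defensive.

Import Order.TTheory GRing.Theory Num.Theory.
Import numFieldNormedType.Exports.

Local Open Scope classical_set_scope.
Local Open Scope ring_scope.

(* 'D_v1 ('D_v2 (... f)) for s = [:: v1; v2; ...] *)
Definition iter_derive (R : realType) (V W : normedModType R) (s : seq V)
    (f : V -> W) : V -> W :=
  foldr (fun v h x => 'D_v h x) f s.

(* f is C^oo on the open set U of the finite-dimensional space V: all iterated
   directional derivatives exist and are continuous on U. *)
Definition smooth_on (R : realType) (V W : normedModType R) (U : set V)
    (f : V -> W) : Prop :=
  forall (s : seq V) (x : V), U x ->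
    {for x, continuous (iter_derive s f)} /\
    (forall v, derivable (iter_derive s f) x v).

(* Lebesgue integral over R^n of a nonnegative Borel function, written as an
   iterated integral (Tonelli). *)
Fixpoint lebesgue_int_rV (R : realType) (n : nat) :
    ('rV[R]_n -> \bar R) -> \bar R :=
  match n with
  | 0 => fun f => f 0
  | m.+1 => fun f =>
      (\int[@lebesgue_measure R]_(t in setT)
         lebesgue_int_rV (fun v : 'rV[R]_m =>
           f (row_mx (const_mx t : 'rV[R]_1) v)))%E
  end.

Definition is_inner_product (R : realType) (V : lmodType R)
    (h : V -> V -> R) : Prop :=
  [/\ forall v k w w', h v (k *: w + w') = k * h v w + h v w',
      forall v w, h v w = h w v &
      forall v, v != 0 -> 0 < h v v].

(* The values of chart_fun outside chart_dom, and of chart_inv outside the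
   image of chart_dom, are irrelevant. *)
Record chart (R : realType) (n : nat) (X : topologicalType) := Chart {
  chart_dom : set X;
  chart_fun :> X -> 'rV[R]_n;
  chart_inv : 'rV[R]_n -> X;
  chart_dom_open : open chart_dom;
  chart_img_open : open (chart_fun @` chart_dom);
  chart_funK : forall x, chart_dom x -> chart_inv (chart_fun x) = x;
  chart_fun_continuous :
    forall x, chart_dom x -> {for x, continuous chart_fun};
  chart_inv_continuous :
    forall y, (chart_fun @` chart_dom) y -> {for y, continuous chart_inv} }.

(* Second countability is automatic, since the carrier is compact.  The
   preferred chart chart_at x serves to realize T_x X and T_x^* X as 'rV_n:
   a tangent vector (resp. a covector) at x is represented by its components
   in the basis of coordinate vectors (resp. differentials of coordinates) of
   chart_at x. *)
Record closed_manifold (R : realType) (n : nat) := ClosedManifold {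
  mcarrier :> ptopologicalType;
  mcompact : compact [set: mcarrier];
  mhausdorff : hausdorff_space mcarrier;
  charts : set (chart R n mcarrier);
  charts_compatible : forall c c', charts c -> charts c' ->
    smooth_on (c @` (chart_dom c `&` chart_dom c')) (c' \o chart_inv c);
  chart_at : mcarrier -> chart R n mcarrier;
  chart_at_charts : forall x, charts (chart_at x);
  chart_at_dom : forall x, chart_dom (chart_at x) x }.

Section Manifold.
Variables (R : realType) (n : nat) (X : closed_manifold R n).
Implicit Types (c : chart R n X) (x y z : X).

Definition smooth_map (W : normedModType R) (U : set X) (f : X -> W) : Prop :=
  forall c, charts c ->
    smooth_on (c @` (chart_dom c `&` U)) (f \o chart_inv c).

(* The i-th coordinate vector of c at x, as an element of T_x X. *)
Definition coord_vector c (i : 'I_n) x : 'rV[R]_n :=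
  'D_('e_i) (chart_at x \o chart_inv c) (c x).

(* df(x), as an element of T_x^* X. *)
Definition differential_at (f : X -> R) x : 'rV[R]_n :=
  \row_i 'D_('e_i) ((f : X -> R^o) \o chart_inv (chart_at x)) (chart_at x x).

Record riemannian_metric := RiemannianMetric {
  rmetric :> X -> 'rV[R]_n -> 'rV[R]_n -> R;
  rmetric_inner : forall x, is_inner_product (rmetric x);
  rmetric_smooth : forall c i j, charts c ->
    @smooth_map R^o (chart_dom c)
      (fun x => rmetric x (coord_vector c i x) (coord_vector c j x)) }.

Implicit Types g : riemannian_metric.

Definition gram g c x : 'M[R]_n :=
  \matrix_(i, j) g x (coord_vector c i x) (coord_vector c j x).

(* mu is the Riemannian volume dv_g: in each chart it has density
   sqrt(det(g_ij)) with respect to Lebesgue measure. *)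
Definition is_riemannian_volume g
    (mu : {measure set (g_sigma_algebraType (@open X)) -> \bar R}) : Prop :=
  forall c (B : set (g_sigma_algebraType (@open X))), charts c ->
    measurable B -> B `<=` chart_dom c ->
    mu B = lebesgue_int_rV
      ((fun v => (Num.sqrt (\det (gram g c (chart_inv c v))))%:E)
         \_ (c @` B)).

Definition smooth_curve (U : set R) (eta : R -> X) : Prop :=
  (forall t, U t -> {for t, continuous eta}) /\
  (forall c, charts c ->
     @smooth_on R R^o _ (U `&` eta @^-1` chart_dom c) (c \o eta)).

(* Smoothness on [a, b] means smooth extendability to an open neighborhood. *)
Inductive piecewise_smooth (gamma : R -> X) : R -> R -> Prop :=
| piecewise_smooth_arc (a b : R) (U : set R) (eta : R -> X) :
    a < b -> open U -> `[a, b] `<=` U -> smooth_curve U eta ->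
    (forall t, a <= t <= b -> gamma t = eta t) -> piecewise_smooth gamma a b
| piecewise_smooth_cat (a b c : R) :
    piecewise_smooth gamma a b -> piecewise_smooth gamma b c ->
    piecewise_smooth gamma a c.

(* The junk values at the finitely many break points are Lebesgue-negligible in
   the length. *)
Definition velocity (gamma : R -> X) (t : R) : 'rV[R]_n :=
  derive1 (chart_at (gamma t) \o gamma) t.

Definition curve_length g (gamma : R -> X) (a b : R) : \bar R :=
  (\int[@lebesgue_measure R]_(t in `[a, b])
     (Num.sqrt (g (gamma t) (velocity gamma t) (velocity gamma t)))%:E)%E.

(* +oo between distinct connected components *)
Definition riemannian_dist g x y : \bar R :=
  ereal_inf [set l | exists gamma a b,
    [/\ piecewise_smooth gamma a b, gamma a = x, gamma b = y &
        l = curve_length g gamma a b]].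

Definition dist_nbhd g (Z : set X) (delta : R) : set X :=
  [set x | exists2 z, Z z & (riemannian_dist g z x < delta%:E)%E].

(* triv_fun and triv_inv are irrelevant outside triv_dom. *)
Record trivialization (E : X -> lmodType R) := Trivialization {
  triv_dom : set X;
  triv_rank : nat;
  triv_fun :> forall x, {linear E x -> 'rV[R]_triv_rank};
  triv_inv : forall x, 'rV[R]_triv_rank -> E x;
  triv_dom_open : open triv_dom;
  triv_funK : forall x, triv_dom x -> cancel (triv_fun x) (triv_inv x);
  triv_invK : forall x, triv_dom x -> cancel (triv_inv x) (triv_fun x) }.
Arguments triv_inv {E} t x v : rename.

(* A real vector bundle, as its family of fibers together with an atlas of
   local trivializations with smooth transition functions; the rank is locally
   constant. *)
Record vector_bundle := VectorBundle {
  fiber :> X -> lmodType R;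
  trivs : set (trivialization fiber);
  trivs_cover : forall x, exists2 t, trivs t & triv_dom t x;
  trivs_compatible : forall t t', trivs t -> trivs t' -> forall v,
    smooth_map (triv_dom t `&` triv_dom t')
      (fun x => t' x (triv_inv t x v)) }.

Definition section (E : vector_bundle) := forall x, E x.

Definition smooth_section (E : vector_bundle) (xi : section E) : Prop :=
  forall t, trivs t -> smooth_map (triv_dom t) (fun x => t x (xi x)).

Record bundle_metric (E : vector_bundle) := BundleMetric {
  bmetric :> forall x, E x -> E x -> R;
  bmetric_inner : forall x, is_inner_product (@bmetric x);
  bmetric_smooth : forall t, trivs t -> forall v w,
    @smooth_map R^o (triv_dom t)
      (fun x => bmetric (triv_inv t x v) (triv_inv t x w)) }.

Section TwoBundles.
Variables E F : vector_bundle.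
Implicit Types (D : section E -> section F) (xi : section E).

(* A smooth bundle map E -> F over the identity. *)
Definition smooth_bundle_map (A : forall x, {linear E x -> F x}) : Prop :=
  forall t t', trivs t -> trivs t' -> forall v,
    smooth_map (triv_dom t `&` triv_dom t')
      (fun x => t' x (A x (triv_inv t x v))).

(* D : Gamma(E) -> Gamma(F) is linear and, in local coordinates and
   trivializations, of the form \sum_k a_k d/dx_k + b with smooth
   matrix coefficients.  The values of D at non-smooth sections are
   irrelevant. *)
Definition first_order_operator D : Prop :=
  [/\ forall xi, smooth_section xi -> smooth_section (D xi),
      forall (k : R) xi eta, smooth_section xi -> smooth_section eta ->
        D (fun x => k *: xi x + eta x) = (fun x => k *: D xi x + D eta x) &
      forall c (t : trivialization E) (t' : trivialization F),
        charts c -> trivs t -> trivs t' ->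
        let U := chart_dom c `&` triv_dom t `&` triv_dom t' in
        exists (a : 'I_n -> X -> 'M[R]_(triv_rank t, triv_rank t'))
          (b : X -> 'M[R]_(triv_rank t, triv_rank t')),
          [/\ forall k, smooth_map U (a k), smooth_map U b &
              forall xi, smooth_section xi -> forall x, U x ->
                t' x (D xi x) =
                  \sum_(k < n) 'D_('e_k) (fun v : 'rV[R]_n =>
                     t (chart_inv c v) (xi (chart_inv c v))) (c x) *m a k x
                  + t x (xi x) *m b x]].

(* The smoothness of x |-> sigma x follows from that of the coefficients
   of D. *)
Definition is_symbol D
    (sigma : forall x, 'rV[R]_n -> {linear E x -> F x}) : Prop :=
  (forall x e k u u',
     sigma x (k *: u + u') e = k *: sigma x u e + sigma x u' e) /\
  (forall (f : X -> R) xi, @smooth_map R^o setT f -> smooth_section xi ->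
     D (fun x => f x *: xi x) =
     (fun x => sigma x (differential_at f x) (xi x) + f x *: D xi x)).

Definition elliptic_symbol
    (sigma : forall x, 'rV[R]_n -> {linear E x -> F x}) : Prop :=
  forall x u, u != 0 -> bijective (sigma x u).

(* The adjoint is unique since hV and hW are definite, and it exists in finite
   dimension. *)
Definition adjoint (V W : lmodType R) (hV : V -> V -> R) (hW : W -> W -> R)
    (T : V -> W) : W -> V :=
  xget (fun=> 0) [set S : W -> V | forall v w, hW (T v) w = hV v (S w)].

Definition concentrating_pair (hE : bundle_metric E) (hF : bundle_metric F)
    (sigma : forall x, 'rV[R]_n -> {linear E x -> F x})
    (A : forall x, {linear E x -> F x}) : Prop :=
  forall x u,
    adjoint (@hE x) (@hF x) (A x) \o sigma x u =
    adjoint (@hE x) (@hF x) (sigma x u) \o A x.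

Definition singular_set (A : forall x, {linear E x -> F x}) : set X :=
  [set x | exists2 e : E x, e != 0 & A x e = 0].

Definition deformation D (A : forall x, {linear E x -> F x}) (s : R) :
    section E -> section F :=
  fun xi x => D xi x + s *: A x (xi x).

End TwoBundles.

Definition L2norm (mu : {measure set (g_sigma_algebraType (@open X)) -> \bar R})
    (E : vector_bundle) (h : bundle_metric E) (xi : section E) : \bar R :=
  'N[mu]_2%:E[(fun x => (Num.sqrt (h x (xi x) (xi x)))%:E)]%E.

End Manifold.

(* Main.v *)
Require Import Defs.
From HB Require Import structures.
From mathcomp Require Import all_boot all_order all_algebra.
From mathcomp Require Import all_classical all_reals all_analysis.
From mathcomp Require Import ring lra.
From mathcomp Require Import measurable_realfun.

Set Implicit Arguments.
Unset Strict Implicit.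
Unset Printing Implicit Defensive.

Import Order.TTheory GRing.Theory Num.Theory.
Import numFieldNormedType.Exports.

Local Open Scope classical_set_scope.
Local Open Scope ring_scope.

(** Pointwise,
[|D_s xi|^2 = |D xi|^2 + s^2 |A xi|^2 + 2 s <D xi, A xi>].
The cross term looks as large as the others, but its integral is not: for a
concentrating pair there is a constant [beta], depending on neither [s] nor [xi],
with [|\int <D xi, A xi>| <= beta * \int |xi|^2] ([pairing_bound]). Dropping the
first term and using the hypotheses [\int |D_s xi|^2 <= C |s|] and
[\int |xi|^2 = 1], one gets [s^2 \int |A xi|^2 <= (C + 2 beta) |s|], that is,
[\int |A xi|^2 <= (C + 2 beta) / |s|].

Away from the singular set [A] is injective, so [|A e|^2] is bounded below there
by a multiple of [|e|^2]; by compactness the multiple is uniform on the complement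
of an open neighbourhood of the singular set ([bundle_map_coercive]). Inside the
delta-neighbourhood there is such an open one, because points that are close in
a chart are joined by short curves ([dist_nbhd_nbhs]). The two bounds combine to the
claim.

The bound on the cross term is an integration by parts. Locally
[D = \sum_k a_k d_k + b], where [a_k] is the value of the symbol at some covector
([symbol_coefficient]). The condition on a concentrating pair says that
[<sigma(u) e, A e'>] is symmetric in [e] and [e'] ([concentrating_sym]), so
[<a_k d_k xi, A xi>] is half the derivative of [<a_k xi, A xi>], up to terms
that are quadratic in [xi] and contain none of its derivatives. After cutting off by a
partition of unity, the integral of the derivative vanishes ([integral_partial0])
and the remaining terms are dominated by [|xi|^2] ([local_bound]).

The calculus behind this starts from iterated directional derivatives and
iterated integrals. Functions of class C^k are treated by induction on [k]; the
iterated integral is shown to be the integral for a translation-invariant measure,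
for which partial derivatives of compactly supported functions have integral
zero; and the Riemannian volume is a density times this measure in every chart. *)

(** * Functions of class C^k *)

Section Cn.
Variables (R : realType).

(** Counting the order of differentiability explicitly, and recursing on the
first derivative taken, gives the stability of smoothness under the algebraic
operations by induction on [k]; for [smooth_on], whose derivatives are taken
in an arbitrary list of directions, there is nothing to induct on. *)
Fixpoint Cn_on (V W : normedModType R) (k : nat) (U : set V) (f : V -> W) :
    Prop :=
  (forall x, U x -> {for x, continuous f}) /\
  if k is k'.+1 then
    forall v, (forall x, U x -> derivable f x v) /\ Cn_on k' U ('D_v f)
  else True.

Section basic.
Variables (V W : normedModType R).
Implicit Types (U : set V) (f g : V -> W) (k : nat).

Lemma Cn_cont k U f : Cn_on k U f -> forall x, U x -> {for x, continuous f}.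
Proof. by case: k => [|k] []. Qed.

Lemma Cn_derivable k U f : Cn_on k.+1 U f ->
  forall x v, U x -> derivable f x v.
Proof. by move=> [_ h] x v; have [+ _] := h v; exact. Qed.

Lemma Cn_derive k U f v : Cn_on k.+1 U f -> Cn_on k U ('D_v f).
Proof. by move=> [_ h]; have [] := h v. Qed.

Lemma Cn_leS k U f : Cn_on k.+1 U f -> Cn_on k U f.
Proof.
elim: k f => [|k ih] f [cf h]; split => // v.
by have [hv /ih hk] := h v; split.
Qed.

Lemma Cn_local k U f :
  (forall x, U x -> exists2 U', U' x & Cn_on k U' f) -> Cn_on k U f.
Proof.
elim: k f => [|k ih] f h; split=> //.
- by move=> x /h[U' U'x /Cn_cont]; exact.
- by move=> x /h[U' U'x /Cn_cont]; exact.
- move=> v; split; first by move=> x /h[U' U'x /Cn_derivable]; exact.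
  apply: ih => x /h[U' U'x hU']; exists U' => //; exact: Cn_derive hU'.
Qed.

Lemma Cn_sub k U U' f : U' `<=` U -> Cn_on k U f -> Cn_on k U' f.
Proof. by move=> UU' h; apply: Cn_local => x /UU' Ux; exists U. Qed.

Lemma Cn_eq k U f g : open U -> (forall x, U x -> f x = g x) ->
  Cn_on k U f -> Cn_on k U g.
Proof.
move=> oU; elim: k f g => [|k ih] f g fg.
  move=> [cf _]; split => // x Ux.
  have fgx : {near x, f =1 g} by apply: filterS (open_nbhs_nbhs (conj oU Ux)).
  rewrite /prop_for /continuous_at -(fg _ Ux).
  by apply: cvg_trans (cf x Ux); apply: near_eq_cvg.
have fgx x : U x -> {near x, f =1 g}.
  by move=> Ux; apply: filterS (open_nbhs_nbhs (conj oU Ux)).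
move=> [cf hf]; split.
  move=> x Ux; rewrite /prop_for /continuous_at -(fg _ Ux).
  by apply: cvg_trans (cf x Ux); apply: near_eq_cvg; exact: fgx.
move=> v; have [df ck] := hf v; split.
  by move=> x Ux; apply: near_eq_derivable (df x Ux); exact: fgx.
by apply: ih ck => x Ux; apply: near_eq_derive; exact: fgx.
Qed.

Lemma Cn_cst k U (a : W) : Cn_on k U (cst a).
Proof.
elim: k a => [|k ih] a; split => //; try by move=> x _; exact: cvg_cst.
move=> v; split; first by move=> x _; exact: derivable_cst.
rewrite (_ : 'D_v _ = cst 0); first exact: ih.
by apply/funext => x; rewrite derive_cst.
Qed.

Lemma CnD k U f g : open U ->
  Cn_on k U f -> Cn_on k U g -> Cn_on k U (fun x => f x + g x).
Proof.
move=> oU; elim: k f g => [|k ih] f g hf hg.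
  split=> // x Ux; apply: continuousD; [exact: (Cn_cont hf)|exact: (Cn_cont hg)].
split.
  move=> x Ux; apply: continuousD; [exact: (Cn_cont hf)|exact: (Cn_cont hg)].
move=> v; split.
  move=> x Ux; apply: derivableD;
    [exact: (Cn_derivable hf)|exact: (Cn_derivable hg)].
apply: (@Cn_eq _ _ (fun x => 'D_v f x + 'D_v g x)) => //.
  move=> x Ux; rewrite -deriveD//;
    [exact: (Cn_derivable hf)|exact: (Cn_derivable hg)].
by apply: ih; exact: Cn_derive.
Qed.

Lemma Cn_sum k U (I : Type) (r : seq I) (P : pred I) (F : I -> V -> W) :
  open U -> (forall i, P i -> Cn_on k U (F i)) ->
  Cn_on k U (fun x => \sum_(i <- r | P i) F i x).
Proof.
move=> oU h; elim: r => [|i r ih].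
  rewrite (_ : (fun _ => _) = cst 0); first exact: Cn_cst.
  by apply/funext => x; rewrite big_nil.
rewrite (_ : (fun _ => _) =
  fun x => if P i then F i x + \sum_(j <- r | P j) F j x
           else \sum_(j <- r | P j) F j x); last first.
  by apply/funext => x; rewrite big_cons.
case: (boolP (P i)) => Pi //; by apply: CnD => //; exact: h.
Qed.

Lemma smooth_onP U f : smooth_on U f <-> forall k, Cn_on k U f.
Proof.
split.
  move=> + k; elim: k f => [|k ih] f hf.
    by split=> // x Ux; have [] := hf [::] x Ux.
  split; first by move=> x Ux; have [] := hf [::] x Ux.
  move=> v; split; first by move=> x Ux; have [_] := hf [::] x Ux; exact.
  apply: ih => s x Ux; have := hf (rcons s v) x Ux.
  by rewrite /iter_derive foldr_rcons.
move=> + s; elim/last_ind: s f => [|s v ih] f hf x Ux.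
  split; first exact: (Cn_cont (hf 0)).
  by move=> v; exact: (Cn_derivable (hf 1)).
rewrite /iter_derive foldr_rcons; apply: ih => // k.
exact: Cn_derive (hf k.+1).
Qed.

Lemma smooth_Cn k U f : smooth_on U f -> Cn_on k U f.
Proof. by move=> /smooth_onP. Qed.

End basic.

Section scalar.
Variables (V : normedModType R).
Implicit Types (U : set V) (f g : V -> R^o) (k : nat).

Lemma CnM k U f g : open U ->
  Cn_on k U f -> Cn_on k U g -> Cn_on k U (fun x => f x * g x : R^o).
Proof.
move=> oU; elim: k f g => [|k ih] f g hf hg.
  split=> // x Ux; apply: continuousM; [exact: (Cn_cont hf)|exact: (Cn_cont hg)].
split.
  move=> x Ux; apply: continuousM; [exact: (Cn_cont hf)|exact: (Cn_cont hg)].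
move=> v; split.
  move=> x Ux; apply: derivableM;
    [exact: (Cn_derivable hf)|exact: (Cn_derivable hg)].
apply: (@Cn_eq _ _ _ _ (fun x => f x * 'D_v g x + g x * 'D_v f x)) => //.
  move=> x Ux; rewrite -deriveM//;
    [exact: (Cn_derivable hf)|exact: (Cn_derivable hg)].
apply: CnD => //; apply: ih.
- exact: Cn_leS.
- exact: Cn_derive.
- exact: Cn_leS.
- exact: Cn_derive.
Qed.

Lemma Cn_prod k U (I : Type) (r : seq I) (P : pred I) (F : I -> V -> R^o) :
  open U -> (forall i, P i -> Cn_on k U (F i)) ->
  Cn_on k U (fun x => \prod_(i <- r | P i) F i x : R^o).
Proof.
move=> oU h; elim: r => [|i r ih].
  rewrite (_ : (fun _ => _) = cst 1); first exact: Cn_cst.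
  by apply/funext => x; rewrite big_nil.
rewrite (_ : (fun _ => _) =
  fun x => if P i then F i x * \prod_(j <- r | P j) F j x
           else \prod_(j <- r | P j) F j x); last first.
  by apply/funext => x; rewrite big_cons.
case: (boolP (P i)) => Pi //; by apply: CnM => //; exact: h.
Qed.

Lemma CnN k U f : open U -> Cn_on k U f -> Cn_on k U (fun x => - f x : R^o).
Proof.
move=> oU hf; rewrite (_ : (fun _ => _) = fun x => (cst (-1) x : R^o) * f x).
  by apply: CnM => //; exact: Cn_cst.
by apply/funext => x; rewrite /cst mulN1r.
Qed.

(** The derivative of a linear map is constant, so continuity is all that
smoothness asks of it. *)
Lemma Cn_lin k U f : (forall x, U x -> {for x, continuous f}) ->
  linear f -> Cn_on k U f.
Proof.
move=> cf lf; case: k => [//|k]; split=> // v.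
have df x : is_derive x v (f : V -> R^o) (f v).
  have e : (fun h : R => h^-1 *: ((f \o shift x) (h *: v) - f x)) @ 0^' --> f v.
    apply: (cvg_trans _ (@cvg_cst _ (f v) _ 0^' _)).
    apply: near_eq_cvg; near=> h.
    rewrite /= lf addrK scalerA mulVf ?scale1r//.
    by near: h; exact: nbhs_dnbhs_neq.
  apply: DeriveDef; first by apply/cvg_ex; exists (f v).
  exact: cvg_lim.
split; first by move=> x _; have [] := df x.
rewrite (_ : 'D_v f = cst (f v)); first exact: Cn_cst.
by apply/funext => x; have [_ ->] := df x.
Unshelve. all: by end_near. Qed.

End scalar.
End Cn.

(** * Functions of class C^1 on R^m and the chain rule *)

Section Frechet.
Variable (R : realType).

Let line_quotient (V W : normedModType R) (f : V -> W) x v (t : R) :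
  (fun h : R => h^-1 *: (((fun h : R => f (h *: v + x)) \o shift t) (h *: 1)
     - f (t *: v + x))) =
  (fun h : R => h^-1 *: ((f \o shift (t *: v + x)) (h *: v) - f (t *: v + x))).
Proof.
by apply/funext => h /=; rewrite [h%:A]mulr1 scalerDl addrA.
Qed.

Lemma derive_line (V W : normedModType R) (f : V -> W) x v (t : R) :
  'D_1 (fun h : R => f (h *: v + x)) t = 'D_v f (t *: v + x).
Proof. by rewrite /derive line_quotient. Qed.

Lemma derivable_line (V W : normedModType R) (f : V -> W) x v (t : R) :
  derivable (fun h : R => f (h *: v + x)) t 1 <-> derivable f (t *: v + x) v.
Proof. by rewrite /derivable line_quotient. Qed.

(** The mean value theorem on the line through [x] in the direction [v], for either
sign of [s]; the intermediate point may lie on either side of [x]. *)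
Lemma MVT_line (V : normedModType R) (f : V -> R^o) (x v : V) (s : R) :
  (forall t : R, `|t| <= `|s| -> derivable f (t *: v + x) v) ->
  exists2 t : R, `|t| <= `|s| & f (s *: v + x) - f x = s * 'D_v f (t *: v + x).
Proof.
move=> df; pose g (h : R) : R := f (h *: v + x).
have dg (t : R) : `|t| <= `|s| -> is_derive t 1 (g : R -> R) ('D_v f (t *: v + x)).
  move=> /df dft; apply: DeriveDef; last exact: derive_line.
  exact/derivable_line.
have cg a b : (forall t, t \in `[a, b] -> `|t| <= `|s|) ->
    {within `[a, b], continuous g}.
  move=> ab; apply: derivable_within_continuous => t /ab ts.
  by have [] := dg _ ts.
have [s0|s0] := leP 0 s.
  have ab t : t \in `[0, s]%R -> `|t| <= `|s|.
    by rewrite in_itv/= => /andP[t0 ts]; rewrite !ger0_norm.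
  have dg0 t : t \in `]0, s[%R -> is_derive t 1 (g : R -> R) ('D_v f (t *: v + x)).
    by move=> /subset_itv_oo_cc /ab /dg.
  have [t tab] := MVT_segment s0 dg0 (cg _ _ ab).
  rewrite /g scale0r add0r subr0 mulrC => ->.
  by exists t => //; exact: ab.
have ab t : t \in `[s, 0]%R -> `|t| <= `|s|.
  by rewrite in_itv/= => /andP[ts t0]; rewrite !ler0_norm ?lerN2 // ltW.
have dg0 t : t \in `]s, 0[%R -> is_derive t 1 (g : R -> R) ('D_v f (t *: v + x)).
  by move=> /subset_itv_oo_cc /ab /dg.
have [t tab] := MVT_segment (ltW s0) dg0 (cg _ _ ab).
rewrite /g scale0r add0r sub0r mulrN => /eqP.
rewrite -opprB eqr_opp mulrC => /eqP ->.
by exists t => //; exact: ab.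
Qed.

Lemma mx_coord_le m n (A : 'M[R]_(m, n)) i j : `|A i j| <= `|A|.
Proof.
rewrite [leRHS]/Num.Def.normr/= mx_normrE.
exact: (le_bigmax _ (fun ij : 'I_m * 'I_n => `|A ij.1 ij.2|) (i, j)).
Qed.

Lemma mx_norm_le m n (A : 'M[R]_(m, n)) (e : R) : 0 <= e ->
  (forall i j, `|A i j| <= e) -> `|A| <= e.
Proof.
move=> e0 h; rewrite [leLHS]/Num.Def.normr/= mx_normrE.
by apply: bigmax_le => // -[i j] _; exact: h.
Qed.

Lemma cvg_mxP (T : Type) (F : set_system T) (FF : Filter F) m n
    (f : T -> 'M[R]_(m, n)) (A : 'M[R]_(m, n)) :
  f @ F --> A <-> forall i j, (f x i j : R) @[x --> F] --> A i j.
Proof.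
split=> [h i j|h].
  exact: (cvg_comp f (fun M : 'M[R]_(m, n) => M i j) h
    (@coord_continuous _ _ _ i j A)).
apply/cvgrPdist_le => /= e e0; near=> x.
apply: mx_norm_le; first exact: ltW.
near: x; apply: filter_forall => i; apply: filter_forall => j.
have /cvgrPdist_le /(_ _ e0) := h i j.
by apply: filterS => x; rewrite !mxE.
Unshelve. all: by end_near. Qed.

Lemma continuous_mxP (T : topologicalType) m n (f : T -> 'M[R]_(m, n)) x :
  {for x, continuous f} <->
  forall i j, {for x, continuous (fun y => f y i j : R^o)}.
Proof. exact: cvg_mxP. Qed.

Lemma Cn_mxP (V : normedModType R) m n k U (f : V -> 'M[R]_(m, n)) : open U ->
  Cn_on k U f <-> forall i j, Cn_on k U (fun x => f x i j : R^o).
Proof.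
move=> oU; split.
  move=> + i j; elim: k f => [|k ih] f hf.
    by split=> // x Ux; exact: (continuous_mxP _ _).1 (Cn_cont hf Ux) _ _.
  split; first by move=> x Ux; exact: (continuous_mxP _ _).1 (Cn_cont hf Ux) _ _.
  move=> v; split.
    by move=> x Ux; apply: (derivable_mxP _ _ _).1; exact: (Cn_derivable hf).
  apply: (Cn_eq oU _ (ih _ (Cn_derive v hf))) => x Ux.
  by rewrite derive_mx ?mxE//; exact: (Cn_derivable hf).
elim: k f => [|k ih] f hf.
  by split=> // x Ux; apply/continuous_mxP => i j; exact: (Cn_cont (hf i j)).
split.
  by move=> x Ux; apply/continuous_mxP => i j; exact: (Cn_cont (hf i j)).
have df x v : U x -> derivable f x v.
  by move=> Ux; apply/derivable_mxP => i j; exact: (Cn_derivable (hf i j)).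
move=> v; split; first by move=> x Ux; exact: df.
apply: ih => i j.
apply: (Cn_eq oU _ (Cn_derive v (hf i j))) => x Ux.
by rewrite derive_mx ?mxE//; exact: df.
Qed.

Lemma lin_rV_continuous m (L : {linear 'rV[R]_m -> R^o}) : continuous L.
Proof.
apply/linear_bounded_continuous; apply/linear_boundedP; exists (\sum_i `|L 'e_i|); split.
  by rewrite realE; apply/orP; left; apply: sumr_ge0.
move=> M; move=> hM x.
rewrite {1}(row_sum_delta x) linear_sum (le_trans (ler_norm_sum _ _ _))//.
apply: (@le_trans _ _ ((\sum_i `|L 'e_i|) * `|x|)); last first.
  by apply: ler_wpM2r => //; exact: ltW.
rewrite mulr_suml; apply: ler_sum => i _.
by rewrite linearZ normrM mulrC ler_wpM2l//; exact: mx_coord_le.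
Qed.

Lemma differentiable_estimate (V W : normedModType R) (f : V -> W)
    (df : {linear V -> W}) a : continuous df ->
  (forall e : R, 0 < e ->
    \forall h \near (0 : V), `|f (h + a) - f a - df h| <= e * `|h|) ->
  differentiable f a /\ 'd f a = df :> (V -> W).
Proof.
move=> cdf h; have fE : f \o shift a = cst (f a) + df +o_ 0 id.
  apply/eqaddoP => e e0; apply: filterS (h e e0) => y /=.
  by rewrite -addrA -opprD.
have dfE := diff_unique cdf fE.
by split=> //; apply/diff_locallyP; rewrite dfE.
Qed.

Section partials.
Variables (m : nat) (f : 'rV[R]_m -> R^o) (U : set 'rV[R]_m) (a : 'rV[R]_m).
Hypotheses (oU : open U) (Ua : U a) (C1f : Cn_on 1 U f).

Let L (h : 'rV[R]_m) : R^o := \sum_i h 0 i * 'D_('e_i) f a.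

Let L_linear : linear L.
Proof.
move=> k u v; rewrite /L scaler_sumr -big_split/=; apply: eq_bigr => i _.
by rewrite !mxE mulrDl [_ *: (_ * _)]mulrA.
Qed.

HB.instance Definition _ := GRing.isLinear.Build _ _ _ _ L L_linear.

(** The vector [h] truncated to its first [j] coordinates. *)
Let head (h : 'rV[R]_m) (j : nat) : 'rV[R]_m :=
  \row_i (if (i < j)%N then h 0 i else 0).

(** Move from [a] to [h + a] by changing one coordinate at a time. The mean
value theorem writes each increment as [h 0 i] times a partial derivative at an
intermediate point, which is close to the partial derivative at [a]. *)
Lemma C1_estimate (e : R) : 0 < e ->
  \forall h \near (0 : 'rV[R]_m), `|f (h + a) - f a - L h| <= e * `|h|.
Proof.
move=> e0.
pose e' := e / m.+1%:R.
have e'0 : 0 < e' by rewrite divr_gt0.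
have : \forall y \near a, U y /\ forall i : 'I_m, `|'D_('e_i) f a - 'D_('e_i) f y| <= e'.
  apply: filterI; first exact: open_nbhs_nbhs.
  have ci (i : 'I_m) : \forall y \near a, `|'D_('e_i) f a - 'D_('e_i) f y| <= e'.
    have /cvgrPdist_le/(_ _ e'0) := Cn_cont (Cn_derive 'e_i C1f) Ua; exact.
  exact: filter_forall ci.
move=> /nbhs_normP[r /= r0 hr].
near=> h.
have hlt : `|h| < r.
  by near: h; exact: (@nbhs0_lt R 'rV[R]_m).
have hball (p : 'rV[R]_m) : `|p| <= `|h| -> U (p + a) /\
    forall i : 'I_m, `|'D_('e_i) f a - 'D_('e_i) f (p + a)| <= e'.
  move=> ph; apply: hr => /=; rewrite opprD addrCA subrr addr0 normrN.
  exact: le_lt_trans hlt.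
have key j : (j <= m)%N ->
  `|f (head h j + a) - f a - \sum_(i < m | (i < j)%N) h 0 i * 'D_('e_i) f a|
     <= j%:R * e' * `|h|.
  elim: j => [_|j ih jm].
    rewrite big1// subr0 mul0r mul0r (_ : head h 0 = 0) ?add0r ?subrr ?normr0//.
    by apply/rowP => i; rewrite !mxE.
  have ihj := ih (ltnW jm); pose i0 := Ordinal jm.
  have -> : head h j.+1 = h 0 i0 *: 'e_i0 + head h j.
    apply/rowP => i; rewrite !mxE/= ltnS leq_eqVlt.
    have [ij|ij] := eqVneq i i0.
      by rewrite ij/= eqxx/= ltnn addr0 mulr1.
    have -> : (nat_of_ord i == j) = false.
      by apply/negbTE; apply: contra ij => /eqP ij; apply/eqP/val_inj.
    by rewrite mulr0 add0r.
  rewrite (bigD1 i0)//= [X in _ - (_ + X)](_ : _ =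
      \sum_(i < m | (i < j)%N) h 0 i * 'D_('e_i) f a); last first.
    apply: eq_bigl => i; rewrite ltnS leq_eqVlt.
    have [->|ij] := eqVneq i i0; first by rewrite /= andbF ltnn.
    have -> : (nat_of_ord i == j) = false.
      by apply/negbTE; apply: contra ij => /eqP ij; apply/eqP/val_inj.
    by rewrite andbT.
  set S := \sum_(i < m | _) _.
  have headt t : `|t| <= `|h 0 i0| -> `|t *: 'e_i0 + head h j| <= `|h|.
    move=> th; apply: mx_norm_le => // i k; rewrite !mxE/=.
    have [ij|ij] := eqVneq k i0.
      rewrite ij/= andbT ltnn addr0 (ord1 i) eqxx mulr1.
      by rewrite (le_trans th)// mx_coord_le.
    rewrite andbF mulr0 add0r; case: ifP => _; last by rewrite normr0.
    exact: mx_coord_le.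
  have [|t th] := @MVT_line _ f (head h j + a) 'e_i0 (h 0 i0).
    move=> t th; apply: (Cn_derivable C1f); rewrite addrA.
    by have [] := hball _ (headt _ th).
  rewrite addrA => fE.
  rewrite -(subrK (f (head h j + a)) (f _)) fE.
  set Dt := 'D__ f _; set D0 := 'D__ f a.
  have DD : `|D0 - Dt| <= e'.
    by rewrite /Dt addrA; have [_] := hball _ (headt _ th); exact.
  rewrite (_ : _ - f a - _ =
     (f (head h j + a) - f a - S) - h 0 i0 * (D0 - Dt)); last by ring.
  rewrite (le_trans (ler_normB _ _))// -natr1 mulrDl mul1r mulrDl lerD//.
  by rewrite normrM mulrC ler_pM// mx_coord_le.
have := key m (leqnn m).
have -> : head h m = h by apply/rowP => i; rewrite mxE ltn_ord.
rewrite (eq_bigl predT) => [|i]; last by rewrite ltn_ord.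
move=> hk; apply: (le_trans hk).
rewrite ler_wpM2r// /e' mulrCA ger_pMr// ler_pdivrMr// mul1r ler_nat//.
Unshelve. all: by end_near. Qed.

Lemma C1_differentiable : differentiable f a.
Proof.
by have [] := differentiable_estimate (@lin_rV_continuous _ L) C1_estimate.
Qed.

Lemma C1_diffE h : 'd f a h = \sum_i h 0 i * 'D_('e_i) f a.
Proof.
by have [_ ->] := differentiable_estimate (@lin_rV_continuous _ L) C1_estimate.
Qed.

End partials.

(** This is where mere directional derivatives do not suffice: the chain rule
needs the Frechet differentiability of [f], which its class C^1 provides. *)
Lemma is_derive_comp_rV (V : normedModType R) m (U : set 'rV[R]_m)
    (f : 'rV[R]_m -> R^o) (tau : V -> 'rV[R]_m) x v :
  open U -> U (tau x) -> Cn_on 1 U f -> derivable tau x v ->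
  is_derive x v (f \o tau : V -> R^o)
    (\sum_i 'D_v tau x 0 i * 'D_('e_i) f (tau x)).
Proof.
move=> oU Ux C1f dtau.
pose gam h := tau (h *: v + x).
have dgam : differentiable gam 0.
  by apply/derivable1_diffP; exact: (derivable1P _ _ _).1.
have gam0 : gam 0 = tau x by rewrite /gam scale0r add0r.
have df : differentiable f (gam 0).
  by rewrite gam0; exact: (C1_differentiable oU Ux C1f).
have dfg : differentiable (f \o gam) 0 by exact: differentiable_comp.
apply: DeriveDef; first by apply/derivable1P; exact: (derivable1_diffP _ _).2.
have := derive_line (f \o tau : V -> R^o) x v 0.
rewrite scale0r add0r => <-.
have -> : 'D_1 (fun h : R => (f \o tau) (h *: v + x)) (0 : R) =
    'd (f \o gam) (0 : R) (1 : R) by rewrite -deriveE.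
have dgamE : 'd gam (0 : R) (1 : R) = 'D_v tau x.
  by rewrite -deriveE// derive_line scale0r add0r.
rewrite diff_comp//= dgamE gam0.
by rewrite (C1_diffE oU Ux C1f).
Qed.

Lemma Cn_comp (V : normedModType R) m k (U : set V) (U' : set 'rV[R]_m)
    (f : 'rV[R]_m -> R^o) (tau : V -> 'rV[R]_m) : open U -> open U' ->
  (forall x, U x -> U' (tau x)) -> Cn_on k U tau -> Cn_on k U' f ->
  Cn_on k U (f \o tau : V -> R^o).
Proof.
move=> oU oU' UU'; elim: k f => [|k ih] f htau hf.
  split=> // x Ux; apply: continuous_comp; first exact: (Cn_cont htau).
  by apply: (Cn_cont hf); exact: UU'.
have C1f : Cn_on 1 U' f.
  by clear -hf; elim: k hf => // k ih /Cn_leS.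
split.
  move=> x Ux; apply: continuous_comp; first exact: (Cn_cont htau).
  by apply: (Cn_cont hf); exact: UU'.
have D x v : U x -> is_derive x v (f \o tau : V -> R^o)
    (\sum_i 'D_v tau x 0 i * 'D_('e_i) f (tau x)).
  move=> Ux; apply: (is_derive_comp_rV oU') => //; first exact: UU'.
  exact: (Cn_derivable htau).
move=> v; split; first by move=> x Ux; have [] := D x v Ux.
apply: (@Cn_eq _ _ _ _ _
  (fun x => \sum_i 'D_v tau x 0 i * ('D_('e_i) f \o tau) x : R^o)) => //.
  by move=> x Ux; have [_ ->] := D x v Ux.
apply: Cn_sum => // i _; apply: CnM => //.
  by have /Cn_mxP := Cn_derive v htau; exact.
by apply: ih; [exact: Cn_leS|exact: Cn_derive].
Qed.

End Frechet.

(** * Composition with functions of one variable, and bump functions *)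

Section one_variable.
Variable (R : realType).

Lemma is_derive_comp_R (V : normedModType R) (h : R -> R) (f : V -> R^o) x v d :
  is_derive (f x : R) (1 : R) h d -> derivable f x v ->
  is_derive x v (h \o f : V -> R^o) (d * 'D_v f x).
Proof.
move=> [dh <-] df; pose gam (t : R) : R := f (t *: v + x).
have gam0 : gam 0 = f x by rewrite /gam scale0r add0r.
have dgam : derivable gam (0 : R) (1 : R) by exact: (derivable1P _ _ _).1.
have dh' : derivable h (gam 0) 1 by rewrite gam0.
have dhg : differentiable (h \o gam) (0 : R).
  by apply: differentiable_comp; apply/derivable1_diffP.
apply: DeriveDef.
  by apply/derivable1P; exact: (derivable1_diffP _ _).2.
have := derive_line (h \o f : V -> R^o) x v 0.
rewrite scale0r add0r => <-.
have -> : 'D_1 (fun t : R => (h \o f) (t *: v + x)) (0 : R) =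
    derive1 (h \o gam) 0 by rewrite derive1E.
rewrite derive1_comp// gam0 !derive1E; congr (_ * _).
by rewrite derive_line scale0r add0r.
Qed.

Lemma CnV (V : normedModType R) k U (f : V -> R^o) : open U ->
  (forall x, U x -> f x != 0) -> Cn_on k U f ->
  Cn_on k U (fun x => (f x)^-1 : R^o).
Proof.
move=> oU f0; elim: k => [|k ih] hf.
  by split=> // x Ux; apply: cvgV; [exact: f0|exact: (Cn_cont hf)].
split; first by move=> x Ux; apply: cvgV; [exact: f0|exact: (Cn_cont hf)].
move=> v; split.
  by move=> x Ux; apply: derivableV; [exact: f0|exact: (Cn_derivable hf)].
have hk := ih (Cn_leS hf).
apply: (@Cn_eq _ _ _ _ _ (fun x => - ((f x)^-1 * (f x)^-1 * 'D_v f x) : R^o)) => //.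
  move=> x Ux; rewrite deriveV; [|exact: f0|exact: (Cn_derivable hf)].
  by rewrite -invfM -expr2 -mulNr.
by apply: CnN => //; apply: CnM => //; [exact: CnM|exact: Cn_derive].
Qed.

Lemma Cn_sqrt (V : normedModType R) k U (f : V -> R^o) : open U ->
  (forall x, U x -> 0 < f x) -> Cn_on k U f ->
  Cn_on k U (fun x => Num.sqrt (f x) : R^o).
Proof.
move=> oU f0; have s0 x : U x -> Num.sqrt (f x) != 0.
  by move=> /f0 fx; rewrite gt_eqF// sqrtr_gt0.
have cs x : U x -> Cn_on 0 U f -> {for x, continuous (fun x => Num.sqrt (f x) : R^o)}.
  move=> Ux c; apply: (@continuous_comp _ _ _ f (@Num.sqrt R)).
    exact: (Cn_cont c).
  exact: sqrt_continuous.
have D x v : U x -> derivable f x v ->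
    is_derive x v (fun x => Num.sqrt (f x) : R^o) ((2 * Num.sqrt (f x))^-1 * 'D_v f x).
  move=> Ux df; apply: (@is_derive_comp_R _ (@Num.sqrt R)) => //.
  exact: is_derive1_sqrt (f0 _ Ux).
elim: k => [|k ih] hf; first by split => // x Ux; exact: cs.
have hk := ih (Cn_leS hf).
split; first by move=> x Ux; exact: (Cn_cont hk).
move=> v; split.
  by move=> x Ux; have [] := D x v Ux (Cn_derivable hf Ux).
apply: (@Cn_eq _ _ _ _ _
    (fun x => (2 * Num.sqrt (f x))^-1 * 'D_v f x : R^o)) => //.
  by move=> x Ux; have [_ ->] := D x v Ux (Cn_derivable hf Ux).
apply: CnM => //; last exact: Cn_derive.
apply: CnV => //; last by apply: CnM => //; exact: (@Cn_cst _ _ _ _ _ (2 : R^o)).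
by move=> x Ux; rewrite mulf_neq0 ?s0.
Qed.

(** The classical flat function together with the factors [x^-1 ^+ m] that its
successive derivatives produce: the family is closed under differentiation up
to linear combinations. *)
Definition flat m (x : R) : R :=
  if 0 < x then x^-1 ^+ m * expR (- x^-1) else 0.

(** The exponential at [x^-1] exceeds its Taylor term of order [m.+2]; this is
what beats the pole and makes every [flat m] vanish to second order at 0. *)
Lemma flat_le m x : `|flat m x| <= (m.+2)`!%:R * x ^+ 2.
Proof.
rewrite /flat; case: ifPn => x0; last first.
  by rewrite normr0 mulr_ge0// sqr_ge0.
have y0 : 0 < x^-1 by rewrite invr_gt0.
rewrite ger0_norm ?mulr_ge0 ?exprn_ge0 ?expR_ge0 ?(ltW y0)//.
rewrite expRN ler_pdivrMr ?expR_gt0//.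
have := expR_ge1Dxn m.+1 (ltW y0).
have F0 : 0 < (m.+2)`!%:R :> R by rewrite ltr0n fact_gt0.
move=> h.
have {}h : x^-1 ^+ m.+2 / (m.+2)`!%:R <= expR x^-1.
  by apply: le_trans h; rewrite lerDr.
rewrite ler_pdivrMr// in h.
apply: (@le_trans _ _ (x ^+ 2 * x^-1 ^+ m.+2)).
  by rewrite -(addn2 m) exprD mulrCA -exprMn divff ?gt_eqF// expr1n mulr1.
rewrite (_ : _ * _ * expR _ = x ^+ 2 * (expR x^-1 * (m.+2)`!%:R)); last by ring.
by rewrite ler_pM2l ?exprn_gt0.
Qed.

Lemma is_derive_flat_origin (f : R -> R) (M : R) :
  (forall x, `|f x| <= M * x ^+ 2) -> is_derive (0 : R) (1 : R) f 0.
Proof.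
move=> h; have f0 : f 0 = 0.
  by have := h 0; rewrite expr0n/= mulr0 normr_le0 => /eqP.
have M0 : 0 <= M by have := h 1; rewrite expr1n mulr1; apply: le_trans.
have e : (fun t : R => t^-1 *: ((f \o shift 0) (t *: 1) - f 0)) @ 0^' --> (0 : R).
  apply/cvgrPdist_le => /= e e0; near=> t.
  have t0 : t != 0 by near: t; exact: nbhs_dnbhs_neq.
  rewrite sub0r normrN f0 subr0 addr0 [t%:A]mulr1 normrM normfV.
  rewrite mulrC ler_pdivrMr ?normr_gt0// (le_trans (h t))//.
  rewrite -(ger0_norm (sqr_ge0 t)) normrX expr2 mulrA ler_wpM2r//.
  have : `|t| <= e / (M + 1).
    by near: t; apply: dnbhs0_le; rewrite divr_gt0// ltr_wpDl.
  rewrite ler_pdivlMr ?ltr_wpDl// => he; apply: le_trans he.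
  by rewrite mulrC ler_wpM2l// lerDl.
apply: DeriveDef; first by apply/cvg_ex; exists 0.
exact: cvg_lim.
Unshelve. all: by end_near. Qed.

Lemma is_derive_flat m (x : R) :
  is_derive x (1 : R) (flat m) (flat m.+2 x - m%:R * flat m.+1 x).
Proof.
have [x0|x0|->] := ltgtP x 0.
- have -> : flat m.+2 x - m%:R * flat m.+1 x = 0.
    by rewrite /flat ltNge (ltW x0) mulr0 subr0.
  apply: (@near_eq_is_derive _ _ _ (cst 0)).
  near=> y; rewrite /flat ltNge (_ : y <= 0)// ltW//.
  by near: y; exact: lt_nbhsl.
- have -> : flat m.+2 x - m%:R * flat m.+1 x =
     x^-1 ^+ m * expR (- x^-1) * x ^- 2 + expR (- x^-1) *
       (m%:R * x^-1 ^+ m.-1 * - x ^- 2).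
    rewrite /flat x0 -exprVn; case: m => [|m].
      by rewrite !mul0r subr0 mulr0 addr0 expr0; ring.
    by rewrite /= !exprS; ring.
  apply: (@near_eq_is_derive _ _ _
    (fun y : R => y^-1 ^+ m * expR (- y^-1))).
    near=> y; rewrite /flat ifT//.
    by near: y; exact: lt_nbhsr.
  have xn0 : x != 0 by rewrite gt_eqF.
  have dV : is_derive x (1 : R) (fun y : R => y^-1) (- x ^- 2).
    apply: is_derive_eq; first exact: is_deriveV.
    by rewrite [_%:A]mulr1.
  have dE : is_derive x (1 : R) (fun y : R => expR (- y^-1)) (expR (- x^-1) * x ^- 2).
    have dN : is_derive x (1 : R) (fun y : R => - y^-1) (x ^- 2).
      by have h := is_deriveN dV; rewrite opprK in h; exact: h.
    have := @is_derive_comp_R R^o expR (fun y : R => - y^-1) x 1 _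
       (is_derive_expR _) (@ex_derive _ _ _ _ _ _ _ dN).
    by rewrite (@derive_val _ _ _ _ _ _ _ dN).
  have dX : is_derive x (1 : R) (fun y : R => y^-1 ^+ m) (m%:R * x^-1 ^+ m.-1 * - x ^- 2).
    by have h := is_deriveX m dV; rewrite exprfctE in h; exact: h.
  apply: (is_derive_eq (is_deriveM dX dE)).
  by congr (_ + _); exact: mulrA.
- have -> : flat m.+2 0 - m%:R * flat m.+1 0 = 0.
    by rewrite /flat ltxx mulr0 subr0.
  exact: is_derive_flat_origin (flat_le m).
Unshelve. all: by end_near. Qed.

Lemma is_derive_scale (f : R -> R) (x v d : R) :
  is_derive x 1 f d -> is_derive x v f (v * d).
Proof.
move=> [df <-]; have df' : differentiable f x by apply/derivable1_diffP.
apply: DeriveDef; first exact: diff_derivable.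
by rewrite deriveE// deriveE// -[in LHS](mulr1 v) -[v * 1]/(v *: (1 : R)) linearZ.
Qed.

Lemma Cn_flat k m : Cn_on k [set: R^o] (flat m : R^o -> R^o).
Proof.
have c m' x : {for x, continuous (flat m' : R^o -> R^o)}.
  by apply: differentiable_continuous; apply/derivable1_diffP;
     have [] := is_derive_flat m' x.
elim: k m => [|k ih] m; first by split.
split => // v; split.
  by move=> x _; have [] := is_derive_scale v (is_derive_flat m x).
rewrite (_ : 'D_v _ = fun x : R^o =>
  cst (v : R^o) x * (flat m.+2 x + cst (- m%:R : R^o) x * flat m.+1 x)); last first.
  apply/funext => x; have [_ ->] := is_derive_scale v (is_derive_flat m x).
  by rewrite /cst mulNr.
apply: CnM; [exact: openT|exact: Cn_cst|].
apply: CnD; [exact: openT|exact: ih|].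
by apply: CnM; [exact: openT|exact: Cn_cst|exact: ih].
Qed.

Lemma Cn_comp_R (V : normedModType R) k U (U' : set R^o) (h : R^o -> R^o) (f : V -> R^o) :
  open U -> open U' -> (forall x, U x -> U' (f x)) ->
  Cn_on k U' h -> Cn_on k U f -> Cn_on k U (h \o f : V -> R^o).
Proof.
move=> oU oU' UU'; elim: k h => [|k ih] h hh hf.
  split=> // x Ux; apply: continuous_comp; first exact: (Cn_cont hf).
  by apply: (Cn_cont hh); exact: UU'.
split.
  move=> x Ux; apply: continuous_comp; first exact: (Cn_cont hf).
  by apply: (Cn_cont hh); exact: UU'.
have D x v : U x -> is_derive x v (h \o f : V -> R^o)
    ('D_1 h (f x) * 'D_v f x).
  move=> Ux; apply: is_derive_comp_R; last exact: (Cn_derivable hf).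
  by apply: DeriveDef => //; apply: (Cn_derivable hh); exact: UU'.
move=> v; split; first by move=> x Ux; have [] := D x v Ux.
apply: (@Cn_eq _ _ _ _ _ (fun x => ('D_1 h \o f) x * 'D_v f x : R^o)) => //.
  by move=> x Ux; have [_ ->] := D x v Ux.
apply: CnM => //; last exact: Cn_derive.
by apply: ih; [exact: Cn_derive|exact: Cn_leS].
Qed.

(** For positive [r] this is positive exactly on the Euclidean ball of radius [r]
around [a]; the sum of squares is smooth, which the sup norm of ['rV] is not. *)
Definition bump_rV m (a : 'rV[R]_m) (r : R) (v : 'rV[R]_m) : R :=
  flat 0 (r ^+ 2 - \sum_i (v 0 i - a 0 i) ^+ 2).

Lemma Cn_coord m k (U : set 'rV[R]_m) i : Cn_on k U (fun v : 'rV[R]_m => v 0 i : R^o).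
Proof.
apply: Cn_lin; first by move=> x _; exact: coord_continuous.
by move=> c u v; rewrite !mxE.
Qed.

Lemma Cn_bump_rV m a r k : Cn_on k setT (bump_rV a r : 'rV[R]_m -> R^o).
Proof.
pose q (v : 'rV[R]_m) : R^o := r ^+ 2 - \sum_i (v 0 i - a 0 i) ^+ 2.
rewrite -[bump_rV a r]/(flat 0 \o q).
apply: (@Cn_comp_R _ _ setT setT) => //.
- exact: openT.
- exact: openT.
- exact: Cn_flat.
apply: CnD; [exact: openT|exact: Cn_cst|].
apply: CnN; first exact: openT.
apply: Cn_sum; first exact: openT.
move=> i _; have h : Cn_on k setT (fun v : 'rV[R]_m => v 0 i - a 0 i : R^o).
  by apply: CnD; [exact: openT|exact: Cn_coord|exact: Cn_cst].
by under eq_fun do rewrite expr2; apply: CnM => //; exact: openT.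
Qed.

Lemma bump_rV_ge0 m (a : 'rV[R]_m) r v : 0 <= bump_rV a r v.
Proof.
by rewrite /bump_rV /flat; case: ifP => // _; rewrite mulr_ge0 ?expR_ge0.
Qed.

Lemma bump_rV_gt0 m (a : 'rV[R]_m) r : 0 < r -> 0 < bump_rV a r a.
Proof.
move=> r0; rewrite /bump_rV /flat big1 ?subr0 => [|i _]; last first.
  by rewrite subrr expr0n.
by rewrite exprn_gt0// mulr_gt0 ?expR_gt0.
Qed.

Lemma bump_rV_out m (a : 'rV[R]_m) r v : 0 < r -> r <= `|v - a| -> bump_rV a r v = 0.
Proof.
move=> r0 h; rewrite /bump_rV /flat ifF//; apply/negbTE; rewrite -leNgt subr_le0.
have [i hi] : exists i, r <= `|v 0 i - a 0 i|.
  apply: contrapT => /forallNP hn; move: h; apply/negP; rewrite -ltNge.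
  rewrite [ltLHS]/Num.Def.normr/= mx_normrE; apply: bigmax_lt => // -[i j] _ /=.
  by rewrite !mxE (ord1 i) ltNge; apply/negP; exact: hn.
rewrite (bigD1 i)//= ler_wpDr ?sumr_ge0// => [j _|]; first exact: sqr_ge0.
by rewrite -(ger0_norm (sqr_ge0 (_ - _))) normrX lerXn2r ?nnegrE// ltW.
Qed.

End one_variable.

(** * Borel sets of R^n and Lebesgue measure *)

Notation borel T := (g_sigma_algebraType (@open T)).

Section borel.
Variable R : realType.

Lemma open_borel (T : ptopologicalType) (U : set T) : open U ->
  measurable (U : set (borel T)).
Proof. by move=> oU; exact: sub_sigma_algebra. Qed.

Lemma openI_preimage (T S : topologicalType) (D : set T) (U : set S) (f : T -> S) :
  open D -> (forall x, D x -> {for x, continuous f}) -> open U ->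
  open (D `&` f @^-1` U).
Proof.
move=> oD cf oU; rewrite openE => x [Dx Ufx].
apply: filterI; first exact: open_nbhs_nbhs.
by apply: (cf x Dx); exact: open_nbhs_nbhs.
Qed.

Lemma continuous_borelR (T : ptopologicalType) (D : set T) (f : T -> R) :
  open D -> (forall x, D x -> {for x, continuous f}) ->
  measurable_fun (D : set (borel T)) (f : borel T -> R).
Proof.
move=> oD cf; apply: (measurability _ (RGenOpens.measurableE R)) => //.
move=> _ [_ [a [b ->]] <-]; apply: open_borel.
by apply: openI_preimage => //; exact: interval_open.
Qed.

Lemma continuous_borel (T S : ptopologicalType) (D : set T) (f : T -> S) :
  open D -> (forall x, D x -> {for x, continuous f}) ->
  measurable_fun (D : set (borel T)) (f : borel T -> borel S).
Proof.
move=> oD cf; apply: (@measurability _ _ (borel T) (borel S) _ _ (@open S)) => //.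
move=> _ [U oU <-]; apply: open_borel.
exact: openI_preimage.
Qed.

Lemma mx_norm_lt m n (A : 'M[R]_(m, n)) (e : R) : 0 < e ->
  `|A| < e <-> forall i j, `|A i j| < e.
Proof.
move=> e0; split=> [h i j|h]; first exact: le_lt_trans (mx_coord_le _ _ _) h.
rewrite [ltLHS]/Num.Def.normr/= mx_normrE.
by apply: bigmax_lt => // -[i j] _; exact: h.
Qed.

(** The decomposition of [R^(m+1)] along which [lebesgue_int_rV] iterates. *)
Definition cons_rV m (t : R) (v : 'rV[R]_m) : 'rV[R]_m.+1 :=
  row_mx (const_mx t : 'rV[R]_1) v.

Lemma cons_rVB m t u (v w : 'rV[R]_m) :
  cons_rV t v - cons_rV u w = cons_rV (t - u) (v - w).
Proof.
rewrite /cons_rV (@opp_row_mx _ 1 1 m) (@add_row_mx _ 1 1 m).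
by congr (@row_mx _ 1 1 m _ _); apply/rowP => i; rewrite !mxE.
Qed.

Lemma cons_rVD m t u (v w : 'rV[R]_m) :
  cons_rV t v + cons_rV u w = cons_rV (t + u) (v + w).
Proof.
rewrite /cons_rV (@add_row_mx _ 1 1 m).
by congr (@row_mx _ 1 1 m _ _); apply/rowP => i; rewrite !mxE.
Qed.

Lemma cons_rVE m (v : 'rV[R]_m.+1) :
  v = cons_rV (v 0 0) (rsubmx (v : 'rV[R]_(1 + m))).
Proof.
rewrite -[LHS](@hsubmxK _ 1 1 m); congr (@row_mx _ 1 1 m _ _).
apply/rowP => i; rewrite !mxE (ord1 i); congr (v _ _).
exact/val_inj.
Qed.

Lemma cons_rV_norm_lt m t (v : 'rV[R]_m) (e : R) : 0 < e ->
  `|cons_rV t v| < e <-> `|t| < e /\ `|v| < e.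
Proof.
move=> e0; rewrite !mx_norm_lt//; split=> [h|[h1 h2] i j].
  split.
    have := h 0 (lshift m 0 : 'I_(1 + m)).
    by rewrite /cons_rV (@row_mxEl _ 1 1 m) mxE.
  move=> i j; have := h i (rshift 1 j).
  by rewrite /cons_rV (@row_mxEr _ 1 1 m).
rewrite /cons_rV; case: (@splitP 1 m j) => k jk.
  have -> : j = lshift m k by exact/val_inj.
  by rewrite (@row_mxEl _ 1 1 m) mxE.
have -> : j = rshift 1 k by exact/val_inj.
by rewrite (@row_mxEr _ 1 1 m).
Qed.

(** The Borel sigma-algebra of [R^(m+1)] is contained in the product
sigma-algebra of [R] and [R^m]: every open set is a union of cubes with rational
centres and radii [1/(k+1)], of which there are countably many, and a cube is a
product. *)
Lemma measurable_cons_rV m : measurable_fun setT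
  (fun z : R * borel 'rV[R]_m => cons_rV z.1 z.2 : borel 'rV[R]_m.+1).
Proof.
apply: (@measurability _ _ _ (borel 'rV[R]_m.+1) _ _ (@open 'rV[R]_m.+1)) => //.
move=> _ [U oU <-]; rewrite setTI.
pose I := ('rV[rat]_m.+1 * nat)%type.
pose q (i : I) : 'rV[R]_m.+1 := map_mx ratr i.1.
pose d (i : I) : R := i.2.+1%:R^-1.
pose B (i : I) : set (R * borel 'rV[R]_m) :=
  [set t : R | `|q i 0 0 - t| < d i] `*`
  [set v : 'rV[R]_m | `|rsubmx (q i : 'rV[R]_(1 + m)) - v| < d i].
have d0 i : 0 < d i by rewrite invr_gt0.
have BE i z : B i z <-> `|q i - cons_rV z.1 z.2| < d i.
  by rewrite [in X in _ <-> X](cons_rVE (q i)) cons_rVB cons_rV_norm_lt.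
pose V (i : I) : set (R * borel 'rV[R]_m) :=
  if pselect (ball (q i) (d i) `<=` U) then B i else set0.
have -> : (fun z : R * borel 'rV[R]_m => cons_rV z.1 z.2) @^-1` U = \bigcup_i V i.
  apply/seteqP; split=> [z /= Uz|z [i _]]; last first.
    rewrite /V; case: pselect => // sub /BE zi; apply: sub.
    by rewrite -ball_normE.
  have := open_nbhs_nbhs (conj oU Uz) => /nbhs_ballP[e /= e0 eU].
  have [k ke] : exists k : nat, k.+1%:R^-1 < e / 2.
    have e20 : 0 < e / 2 by rewrite divr_gt0.
    have := @near_infty_natSinv_lt R (PosNum e20) => -[N _ /(_ N (leqnn N)) h].
    by exists N.
  have k0 : (0 : R) < k.+1%:R^-1 by rewrite invr_gt0.
  have rat_near (x : R) : exists y : rat, `|ratr y - x| < k.+1%:R^-1.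
    have xk : x - k.+1%:R^-1 < x + k.+1%:R^-1.
      by rewrite ltrBlDr -addrA ltrDl addr_gt0.
    have [y] := rat_in_itvoo xk.
    rewrite in_itv/= => /andP[y1 y2]; exists y.
    by rewrite ltr_distl y1.
  pose qz : 'rV[rat]_m.+1 := \row_j xget 0 [set y : rat | `|ratr y - cons_rV z.1 z.2 0 j| < k.+1%:R^-1].
  have qzP : `|q (qz, k) - cons_rV z.1 z.2| < k.+1%:R^-1.
    apply/mx_norm_lt => // i j; rewrite (ord1 i) !mxE.
    case: xgetP => [y _ //|/= /forallNP h].
    by exfalso; apply: h; exact: rat_near.
  have VB : V (qz, k) = B (qz, k); last by exists (qz, k) => //; rewrite VB; exact/BE.
  rewrite /V; destruct (pselect _) as [|nsub] => //; exfalso; apply: nsub => y.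
  rewrite -ball_normE/= => hy; apply: eU.
  rewrite -ball_normE/= (splitr e).
  rewrite -(subrK (q (qz, k)) (cons_rV _ _)) -addrA.
  rewrite (le_lt_trans (ler_normD _ _))// ltrD//.
    by rewrite distrC (lt_trans qzP).
  exact: lt_trans ke.
have mB i : measurable (B i).
  rewrite /B; apply: measurableX.
    rewrite (_ : [set _ | _] = ball (q i 0 0) (d i)); first exact: measurable_ball.
    by rewrite -ball_normE.
  apply: open_borel.
  rewrite (_ : [set _ | _] = ball (rsubmx (q i : 'rV[R]_(1 + m))) (d i)).
    exact: ball_open.
  by rewrite -ball_normE.
have mV i : measurable (V i).
  by rewrite /V; destruct (pselect _) as [sub|nsub]; [exact: mB|exact: measurable0].
rewrite (_ : \bigcup_i V i =
    \bigcup_(k : nat) if unpickle k is Some i then V i else set0).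
  by apply: bigcupT_measurable => k; case: unpickle.
apply/seteqP; split=> [z [i _ Viz]|z [k _]].
  by exists (pickle i) => //; rewrite pickleK.
by case: unpickle => // i Viz; exists i.
Qed.

End borel.

Section lebesgue_rV.
Variable R : realType.
Local Notation leb := (@lebesgue_measure R).

Lemma ball0_lt (V : normedModType R) (r : R) : [set v : V | `|v| < r] = ball 0 r.
Proof. by rewrite -ball_normE; apply/seteqP; split=> v /=; rewrite sub0r normrN. Qed.

Lemma sigma_finite_balls m (nu : {measure set (borel 'rV[R]_m) -> \bar R}) :
  (forall r : R, 0 < r -> (nu [set v : 'rV[R]_m | `|v| < r]%R < +oo)%E) ->
  sigma_finite setT nu.
Proof.
move=> h; exists (fun k : nat => [set v : 'rV[R]_m | `|v| < k.+1%:R]%R).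
  apply/esym/seteqP; split => // v _.
  exists (Num.truncn `|v|) => //=; exact: truncnS_gt.
move=> k; split; last exact: h.
by rewrite ball0_lt; apply: open_borel; exact: ball_open.
Qed.

(** The iterated integral [lebesgue_int_rV] comes without a measure; this
characterizes the measure that it integrates against, so that the convergence
theorems become available. *)
Definition is_lebesgue_rV n
    (nu : {sigma_finite_measure set (borel 'rV[R]_n) -> \bar R}) :=
  (forall r : R, 0 < r -> (nu [set v : 'rV[R]_n | `|v| < r]%R < +oo)%E) /\
  (forall f : borel 'rV[R]_n -> \bar R, measurable_fun setT f ->
    (forall v, 0 <= f v)%E -> (\int[nu]_v f v = lebesgue_int_rV f)%E).

(** Push the product of Lebesgue measure on the line and the measure obtained in
dimension [m] forward along [cons_rV], and use Tonelli. *)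
Lemma lebesgue_rV_exists n :
  exists nu : {sigma_finite_measure set (borel 'rV[R]_n) -> \bar R}, is_lebesgue_rV nu.
Proof.
elim: n => [|m [nu [nufin nuE]]].
  exists [the {sigma_finite_measure set (borel 'rV[R]_0) -> \bar R} of \d_ (0 : borel 'rV[R]_0)].
  split=> [r r0|f mf f0].
    by rewrite [X in (X < _)%E]diracE ltry.
  by rewrite integral_dirac// diracE in_setT mul1e.
have mcons := @measurable_cons_rV R m.
pose P := measure_function_pushforward__canonical__measure_function_Measure
  [the measure _ _ of (leb \x nu)%E] mcons.
have Pfin r : 0 < r -> (P [set v : 'rV[R]_m.+1 | `|v| < r]%R < +oo)%E.
  move=> r0; rewrite /P /= /pushforward.
  rewrite (_ : _ @^-1` _ = [set t : R | `|t| < r] `*` [set v : 'rV[R]_m | `|v| < r]).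
    rewrite product_measure1E.
    - apply: lte_mul_pinfty => //.
        rewrite ball0_lt.
        change (leb (ball (0 : R) r) \is a fin_num).
        by rewrite lebesgue_measure_ball// ltW.
      exact: nufin.
    - by rewrite ball0_lt; exact: measurable_ball.
    - by rewrite ball0_lt; apply: open_borel; exact: ball_open.
  by apply/seteqP; split=> z /= /cons_rV_norm_lt; exact.
pose Psf := Measure_isSigmaFinite.Build _ _ _ (P : set (borel 'rV[R]_m.+1) -> \bar R) (sigma_finite_balls Pfin).
pose nu' : {sigma_finite_measure set (borel 'rV[R]_m.+1) -> \bar R} :=
  HB.pack (P : set (borel 'rV[R]_m.+1) -> \bar R) (Measure.class P) Psf.
exists nu'; split => // f mf f0.
have mfc : measurable_fun setT (fun z : R * borel 'rV[R]_m => f (cons_rV z.1 z.2)).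
  exact: measurableT_comp mf mcons.
rewrite [LHS]ge0_integral_pushforward//= preimage_setT.
rewrite (@fubini_tonelli1 _ _ (measurableTypeR R) (borel 'rV[R]_m) R leb nu
  (fun z => f (cons_rV z.1 z.2)) mfc (fun z => f0 _)).
apply: eq_integral => t _; rewrite /fubini_F.
apply: (nuE (fun v => f (cons_rV t v))) => //; exact: (measurableT_comp mfc (measurable_pair1 t)).
Qed.

(** The image of Lebesgue measure under a translation gives intervals their
length, hence is Lebesgue measure. *)
Lemma lebesgue_translate (a : R) (f : R -> \bar R) :
  measurable_fun setT f -> (forall t, 0 <= f t)%E ->
  (\int[leb]_t f (t + a)%R = \int[leb]_t f t)%E.
Proof.
move=> mf f0.
have ma : @measurable_fun _ _ (measurableTypeR R) (measurableTypeR R) setT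
    (fun t : R => t + a).
  by apply: continuous_measurable_fun => t; apply: cvgD; [exact: cvg_id|exact: cvg_cst].
pose P := measure_function_pushforward__canonical__measure_function_Measure
  [the measure _ _ of leb] ma.
have := @ge0_integral_pushforward _ _ _ _ _ _ ma leb setT f measurableT mf (fun t _ => f0 t).
rewrite preimage_setT /= => <-.
apply: eq_measure_integral => A mA _.
suff <- : leb A = P A by [].
apply: lebesgue_measure_unique => // _ [[x y] _ <-].
rewrite /P /= /pushforward (_ : _ @^-1` _ = `]x - a, y - a]%classic).
  have e : y - a - (x - a) = y - x by ring.
  by rewrite !lebesgue_measure_itv/= !lte_fin ltrD2r -!EFinB e.
by apply/seteqP; split=> t /=; rewrite !in_itv/= ltrBlDr lerBrDr.
Qed.

Lemma lebesgue_int_translate n (f : 'rV[R]_n -> \bar R) (w : 'rV[R]_n) :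
  measurable_fun setT (f : borel 'rV[R]_n -> _) -> (forall v, 0 <= f v)%E ->
  lebesgue_int_rV (fun v => f (v + w)) = lebesgue_int_rV f.
Proof.
elim: n f w => [|m ih] f w mf f0 /=; first by rewrite (thinmx0 w) addr0.
have mfc : measurable_fun setT (fun z : R * borel 'rV[R]_m => f (cons_rV z.1 z.2)).
  exact: measurableT_comp mf (@measurable_cons_rV R m).
have mft t : measurable_fun setT (fun v : borel 'rV[R]_m => f (cons_rV t v)).
  exact: (measurableT_comp mfc (measurable_pair1 t)).
pose G t := lebesgue_int_rV (fun v : 'rV[R]_m => f (cons_rV t v)).
have mG : measurable_fun setT G.
  have [nu [_ nuE]] := lebesgue_rV_exists m.
  have := measurable_fun_fubini_tonelli_F (m2 := nu) _ mfc (fun z => f0 _).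
  apply: eq_measurable_fun => t _.
  exact: (nuE (fun v => f (cons_rV t v)) (mft t) (fun v => f0 _)).
have G0 t : (0 <= G t)%E.
  have [nu [_ nuE]] := lebesgue_rV_exists m.
  by rewrite /G -nuE//; exact: integral_ge0.
transitivity (\int[leb]_t G (t + w 0 0)%R)%E; last exact: lebesgue_translate.
apply: eq_integral => t _.
rewrite -[RHS](ih _ (rsubmx (w : 'rV[R]_(1 + m))))//.
congr lebesgue_int_rV; apply/funext => v.
by rewrite [in LHS](cons_rVE w) -/(cons_rV t v) cons_rVD.
Qed.

End lebesgue_rV.

(** * Integration against a density *)

Section density.
Local Open Scope ereal_scope.
Context d1 d2 (T1 : measurableType d1) (T2 : measurableType d2) (R : realType).
Variables (mu : {measure set T1 -> \bar R}) (nu : {measure set T2 -> \bar R}).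
Variables (D : set T1) (O : set T2) (phi : T2 -> T1) (rho : T2 -> R).
Hypotheses (mD : measurable D) (mO : measurable O).
Hypotheses (mphi : measurable_fun O phi) (mrho : measurable_fun O rho).
Hypothesis phiD : forall v, O v -> D (phi v).
Hypothesis rho0 : forall v, O v -> (0 <= rho v)%R.
Hypothesis mu_density : forall B, measurable B -> B `<=` D ->
  mu B = \int[nu]_(v in O) (rho v * \1_B (phi v))%:E.

Import HBNNSimple.

Let mcomp d (T : measurableType d) (h : T1 -> T) :
  measurable_fun D h -> measurable_fun O (h \o phi).
Proof.
move=> mh; apply: (measurable_comp mD) => //.
by move=> _ [v Ov <-]; exact: phiD.
Qed.

(** The formula is assumed for indicator functions; it passes to simple
functions by linearity and to nonnegative measurable ones by monotone
convergence. *)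
Lemma ge0_integral_density (f : T1 -> \bar R) : measurable_fun D f ->
  (forall x, D x -> 0 <= f x) ->
  \int[mu]_(x in D) f x = \int[nu]_(v in O) (f (phi v) * (rho v)%:E).
Proof.
move=> mf f0; pose f_ := nnsfun_approx mD mf.
transitivity (limn (fun n => \int[mu]_(x in D) (f_ n x)%:E)).
  rewrite -monotone_convergence//.
  - apply: eq_integral => y /[!inE] yD; apply/esym/cvg_lim => //.
    exact: cvg_nnsfun_approx.
  - by move=> n; apply/measurable_EFinP; exact: measurable_funTS.
  - by move=> n y _; rewrite lee_fin.
  - by move=> y _ m n mn; rewrite lee_fin; exact/lefP/nd_nnsfun_approx.
have mfn n : measurable_fun O (fun v => (f_ n (phi v) * rho v)%:E).
  apply/measurable_EFinP; apply: measurable_funM => //.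
  by apply: (mcomp (h := f_ n)); exact: measurable_funTS.
transitivity (limn (fun n => \int[nu]_(v in O) (f_ n (phi v) * rho v)%:E)); last first.
  rewrite -monotone_convergence//.
  - apply: eq_integral => v /[!inE] Ov; apply/cvg_lim => //.
    under eq_fun do rewrite EFinM.
    apply: cvgeZr => //; apply: cvg_nnsfun_approx => //; exact: phiD.
  - by move=> n v Ov; rewrite lee_fin mulr_ge0// rho0.
  - move=> v Ov m n mn; rewrite lee_fin ler_wpM2r ?rho0//.
    exact/lefP/nd_nnsfun_approx.
congr (limn _); apply/funext => n.
have mk (k : R) : measurable (f_ n @^-1` [set k]) by [].
transitivity (\sum_(k \in range (f_ n))
    \int[mu]_(x in D) (k * \1_(f_ n @^-1` [set k]) x)%:E).
  under eq_integral do rewrite fimfunE -fsumEFin//.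
  rewrite ge0_integral_fsum//.
  - by move=> y; apply/measurable_EFinP/measurable_funM => //; exact: measurable_funTS.
  - by move=> y x _; rewrite nnfun_muleindic_ge0.
transitivity (\sum_(k \in range (f_ n))
    \int[nu]_(v in O) (k * \1_(f_ n @^-1` [set k]) (phi v) * rho v)%:E); last first.
  rewrite -ge0_integral_fsum//.
  - apply: eq_integral => v _; rewrite fimfunE fsumEFin//; congr EFin.
    by rewrite -mulr_fsuml.
  - move=> k; apply/measurable_EFinP/measurable_funM => //.
    apply: measurable_funM => //; apply: (mcomp (h := (\1_(f_ n @^-1` [set k]) : T1 -> R))).
    exact: measurable_funTS.
  - move=> k v Ov; rewrite EFinM mule_ge0 ?lee_fin ?rho0//.
    exact: nnfun_muleindic_ge0.
apply: eq_fsbigr => k; rewrite inE => -[x0 _ kE].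
have k0 : (0 <= k)%R by rewrite -kE.
under eq_integral do rewrite EFinM.
rewrite ge0_integralZl_EFin//; last first.
  by apply/measurable_EFinP; exact: measurable_funTS.
under [RHS]eq_integral do rewrite -mulrA EFinM.
rewrite [RHS]ge0_integralZl_EFin//; last 2 first.
- by move=> v Ov; rewrite lee_fin mulr_ge0// rho0.
- apply/measurable_EFinP/measurable_funM => //; apply: (mcomp (h := (\1_(f_ n @^-1` [set k]) : T1 -> R))).
  exact: measurable_funTS.
congr (_ * _); rewrite integral_indic// mu_density//; last first.
  exact: measurableI.
apply: eq_integral => v /[!inE] Ov; congr EFin; rewrite mulrC; congr (_ * _)%R.
by rewrite !indicE in_setI (mem_set (phiD Ov)) andbT.
Qed.

Lemma integral_density (f : T1 -> R) : measurable_fun D f ->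
  \int[mu]_(x in D) (f x)%:E = \int[nu]_(v in O) (f (phi v) * rho v)%:E.
Proof.
move=> mf; have mfE : measurable_fun D (EFin \o f) by exact/measurable_EFinP.
rewrite integralE [RHS]integralE; congr (_ - _).
  rewrite ge0_integral_density//; last exact: measurable_funepos.
  apply: eq_integral => v /[!inE] Ov; rewrite !funeposE/=.
  by rewrite -!EFin_max -EFinM maxr_pMl ?rho0// mul0r.
rewrite ge0_integral_density//; last exact: measurable_funeneg.
apply: eq_integral => v /[!inE] Ov; rewrite !funenegE/=.
by rewrite -!EFin_max -EFinM maxr_pMl ?rho0// mul0r mulNr.
Qed.

End density.

Section bounded_support.
Local Open Scope ereal_scope.
Context d (T : measurableType d) (R : realType) (mu : {measure set T -> \bar R}).

Lemma bounded_support_integrable (f : T -> R) (A : set T) (M : R) :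
  measurable A -> mu A < +oo -> measurable_fun setT f ->
  (forall x, `|f x| <= M * \1_A x)%R -> mu.-integrable setT (EFin \o f).
Proof.
move=> mA Afin mf fM.
apply: (@le_integrable _ _ _ _ _ _ _ (EFin \o (fun x => `|M| * \1_A x)%R)) => //.
- exact/measurable_EFinP.
- move=> x _ /=; rewrite lee_fin (le_trans (fM x))// ger0_norm ?mulr_ge0//.
  by apply: ler_wpM2r => //; exact: ler_norm.
apply/integrableP; split.
  by apply/measurable_EFinP; exact: measurable_funM.
rewrite (eq_integral (fun x => `|M|%:E * (\1_A x)%:E)); last first.
  by move=> x _; rewrite /= ger0_norm ?mulr_ge0.
rewrite ge0_integralZl_EFin//; last exact/measurable_EFinP.
by rewrite integral_indic// setIT lte_mul_pinfty// lee_fin.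
Qed.

End bounded_support.

(** The integral of a nonnegative function is a supremum over the simple functions
below it, hence monotone for arbitrary functions and sets. This serves for the
complement of a distance neighbourhood, of which it is unclear whether it is a Borel
set. *)
Lemma ge0_le_integral_any d (T : measurableType d) (R : realType)
    (mu : {measure set T -> \bar R}) (D D' : set T) (f f' : T -> \bar R) :
  D `<=` D' -> (forall x, D x -> 0 <= f x)%E -> (forall x, D' x -> 0 <= f' x)%E ->
  (forall x, D x -> f x <= f' x)%E ->
  (\int[mu]_(x in D) f x <= \int[mu]_(x in D') f' x)%E.
Proof.
move=> DD' f0 f'0 ff'; rewrite !ge0_integralE//.
apply: le_ereal_sup => _ [h hf <-]; exists h => // x.
apply: le_trans (hf x) _; rewrite !patchE.
case: ifPn => [/[!inE] Dx|_]; first by rewrite mem_set ?ff'//; exact: DD'.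
by case: ifPn => // /[!inE] /f'0.
Qed.

(** The functions [phi i] have vanishing total integral, so only [q] contributes,
and [q] is bounded pointwise. In the application the [phi i] are the partial
derivatives that an integration by parts discards. *)
Lemma abse_integral_null_part d (T : measurableType d) (R : realType)
    (nu : {measure set T -> \bar R}) (O : set T) (I : finType)
    (phi : I -> T -> R) (q h : T -> R) : measurable O ->
  (forall i, nu.-integrable setT (EFin \o phi i) /\ (\int[nu]_x (phi i x)%:E = 0)%E) ->
  (forall i x, ~ O x -> phi i x = 0) ->
  measurable_fun O q -> measurable_fun O h ->
  (forall x, O x -> `|q x| <= h x) ->
  (\int[nu]_(x in O) (h x)%:E < +oo)%E ->
  (`| \int[nu]_(x in O) (2^-1 * (\sum_i phi i x) + q x)%:E | <=
     \int[nu]_(x in O) (h x)%:E)%E.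
Proof.
move=> mO phi0 phi_out mq mh qh hfin.
have h0 x : O x -> 0 <= h x by move=> Ox; exact: le_trans (qh x Ox).
have hint : nu.-integrable O (EFin \o h).
  apply/integrableP; split; first exact/measurable_EFinP.
  by under eq_integral => x /[!inE] Ox do rewrite /= ger0_norm ?h0//.
have qint : nu.-integrable O (EFin \o q).
  apply: le_integrable hint => //; first exact/measurable_EFinP.
  by move=> x Ox /=; rewrite lee_fin (ger0_norm (h0 x Ox)) qh.
have phiO i : nu.-integrable O (EFin \o phi i).
  by apply: integrableS (phi0 i).1.
have phiO0 i : (\int[nu]_(x in O) (phi i x)%:E = 0)%E.
  rewrite -(phi0 i).2 integral_mkcond; apply: eq_integral => x _.
  by rewrite patchE; case: ifPn => //; rewrite notin_setE => /phi_out ->.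
have sint : nu.-integrable O (fun x => (\sum_i (phi i x)%:E)%E).
  apply: (@integrable_sum _ _ _ nu O mO I (index_enum I) xpredT (fun i x => (phi i x)%:E)) => i _.
  exact: phiO.
rewrite (_ : (\int[nu]_(x in O) _ = \int[nu]_(x in O) (q x)%:E)%E).
  apply: le_trans (le_abse_integral _ mO _) _; first exact/measurable_EFinP.
  apply: ge0_le_integral => //.
  - by apply/measurableT_comp => //; exact/measurable_EFinP.
  - exact/measurable_EFinP.
under eq_integral do rewrite EFinD EFinM -sumEFin.
rewrite integralD//; last exact: integrableZl.
rewrite integralZl// (integral_sum mO phiO).
rewrite big1; first by rewrite mule0 add0e.
by move=> i _; exact: phiO0.
Qed.

Lemma compact_bound (R : realType) (T : topologicalType) (f : T -> R) (A : set T) :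
  compact A -> (forall x, A x -> {for x, continuous f}) ->
  exists2 M, 0 < M & forall x, A x -> `|f x| <= M.
Proof.
move=> cA cf.
have cfA : {within A, continuous f}.
  by apply: continuous_in_subspaceT => x /[!inE] /cf.
have /compact_bounded[M [_ hM]] := continuous_compact cfA cA.
exists (`|M| + 1); first by rewrite ltr_wpDl.
move=> x Ax; apply: (hM (`|M| + 1)); last by exists x.
by rewrite (le_lt_trans (ler_norm _))// ltrDl.
Qed.

(** * The integral of a partial derivative *)

Section integration_by_parts.
Variables (R : realType) (n : nat).
Variable nu : {sigma_finite_measure set (borel 'rV[R]_n) -> \bar R}.
Hypothesis nuP : is_lebesgue_rV nu.

Lemma integral_translate (f : 'rV[R]_n -> R) (w : 'rV[R]_n) :
  measurable_fun setT (f : borel 'rV[R]_n -> R) ->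
  (\int[nu]_v (f (v + w)%R)%:E = \int[nu]_v (f v)%:E)%E.
Proof.
move=> mf; have mfE : measurable_fun setT (EFin \o f : borel 'rV[R]_n -> _).
  exact/measurable_EFinP.
have mw : measurable_fun setT (fun v : borel 'rV[R]_n => (v : 'rV[R]_n) + w : borel 'rV[R]_n).
  apply: continuous_borel; first exact: openT.
  by move=> x _; apply: (@continuousD _ _ _ (fun v => v) (cst w)); [exact: cvg_id|exact: cst_continuous].
rewrite integralE [RHS]integralE; congr (_ - _)%E.
  rewrite !nuP.2//; last 2 first.
  - exact: measurable_funepos.
  - by apply: measurable_funepos; exact: measurableT_comp mfE mw.
  rewrite -[RHS](@lebesgue_int_translate R n ((EFin \o f)^\+)%E w)//.
    by congr lebesgue_int_rV; apply/funext => v; rewrite !funeposE.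
  exact: measurable_funepos.
rewrite !nuP.2//; last 2 first.
- exact: measurable_funeneg.
- by apply: measurable_funeneg; exact: measurableT_comp mfE mw.
rewrite -[RHS](@lebesgue_int_translate R n ((EFin \o f)^\-)%E w)//.
  by congr lebesgue_int_rV; apply/funext => v; rewrite !funenegE.
exact: measurable_funeneg.
Qed.

Lemma compact_closed_ball_rV (r : R) : compact [set v : 'rV[R]_n | `|v| <= r].
Proof.
apply: bounded_closed_compact.
  by exists r; split; [exact: num_real|move=> M rM v /= vr; exact: le_trans (ltW rM)].
apply: (@closed_comp _ _ (fun v : 'rV[R]_n => `|v|) [set x | x <= r]) => //.
  by move=> v _; exact: norm_continuous.
Qed.

(** The difference quotients of [phi] in the direction [e] have integral zero by
translation invariance; by the mean value theorem they are dominated by a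
multiple of the indicator of a ball, so their limit has integral zero too. *)
Lemma integral_partial0 (phi : 'rV[R]_n -> R^o) (r : R) (e : 'rV[R]_n) :
  0 < r -> Cn_on 1 setT phi -> (forall v, r <= `|v| -> phi v = 0) ->
  nu.-integrable setT (EFin \o ('D_e phi : 'rV[R]_n -> R)) /\
  (\int[nu]_v ('D_e phi v : R)%:E = 0)%E.
Proof.
move=> r0 C1 out.
have D0 v : r < `|v| -> 'D_e phi v = 0.
  move=> rv; rewrite -(derive_cst (0 : R^o) v e); apply: near_eq_derive.
  near=> y; rewrite /cst out//.
  near: y; apply: (@cvgr_ge _ _ _ _ (fun y : 'rV[R]_n => `|y|) `|v|) => //.
  exact: norm_continuous.
have [M M0 hM] : exists2 M, 0 < M & forall v, `|'D_e phi v : R| <= M.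
  have [|M M0 hM] := @compact_bound R _ ('D_e phi : 'rV[R]_n -> R) _ (@compact_closed_ball_rV r).
    by move=> x _; exact: (Cn_cont (Cn_derive e C1)).
  exists M => // v; have [|/D0 ->] := leP `|v| r; first exact: hM.
  by rewrite normr0 ltW.
(* All the translates of phi by h j *: e, with h j <= 1, vanish off this ball. *)
pose r' := r + `|e| + 1.
have r'0 : 0 < r' by rewrite ltr_wpDl// addr_ge0// ltW.
pose B : set (borel 'rV[R]_n) := [set v : 'rV[R]_n | `|v| < r'].
have mB : measurable B.
  by rewrite /B ball0_lt; apply: open_borel; exact: ball_open.
pose h (j : nat) : R := j.+1%:R^-1.
have h0 j : 0 < h j by rewrite invr_gt0.
have h1 j : h j <= 1 by rewrite invf_le1// ler1n.
have mphi : measurable_fun setT (phi : borel 'rV[R]_n -> R).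
  apply: continuous_borelR; [exact: openT|move=> x _; exact: (Cn_cont C1)].
have mshift w : measurable_fun setT (fun v : borel 'rV[R]_n => phi ((v : 'rV[R]_n) + w) : R).
  apply: continuous_borelR; first exact: openT.
  move=> x _; apply: continuous_comp; last exact: (Cn_cont C1).
  by apply: (@continuousD _ _ _ (fun v => v) (cst w)); [exact: cvg_id|exact: cst_continuous].
have mD : measurable_fun setT ('D_e phi : borel 'rV[R]_n -> R).
  apply: continuous_borelR; [exact: openT|move=> x _].
  exact: (Cn_cont (Cn_derive e C1)).
pose F j (v : borel 'rV[R]_n) : R := (h j)^-1 * (phi ((v : 'rV[R]_n) + h j *: e) - phi v).
have F_le j v : `|F j v| <= M * \1_B v.
  rewrite indicE; have [vB|vB] := boolP (v \in B).
    rewrite mulr1 /F [v + _]addrC.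
    have [|t _ ->] := @MVT_line _ _ phi v e (h j).
      by move=> t _; exact: (Cn_derivable C1).
    by rewrite mulKf ?gt_eqF.
  have rv : r' <= `|v : 'rV[R]_n|.
    by rewrite leNgt; apply: contra vB => vr; rewrite inE.
  rewrite mulr0 /F !out ?subrr ?mulr0 ?normr0//.
    by apply: le_trans rv; rewrite /r' -addrA lerDl addr_ge0.
  have := ler_normB ((v : 'rV[R]_n) + h j *: e) (h j *: e).
  rewrite addrK normrZ gtr0_norm// => vle.
  have : h j * `|e| <= `|e| by rewrite ler_piMl.
  by move: rv vle; rewrite /r'; lra.
have phi_int : nu.-integrable setT (EFin \o (phi : 'rV[R]_n -> R)).
  have [|M' M'0 hM'] := @compact_bound R _ (phi : 'rV[R]_n -> R) _ (@compact_closed_ball_rV r).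
    by move=> x _; exact: (Cn_cont C1).
  apply: (@bounded_support_integrable _ _ _ nu _ B M') => //; first exact: nuP.1.
  move=> v; have [vr|rv] := leP r `|v : 'rV[R]_n|.
    by rewrite out// normr0 mulr_ge0// ltW.
  rewrite indicE mem_set ?mulr1; first by apply: hM'; exact: ltW.
  by apply: (lt_trans rv); rewrite /r' -addrA ltrDl ltr_wpDl.
have F0 j : (\int[nu]_v (F j v)%:E = 0)%E.
  have sh_int : nu.-integrable setT (fun v => (phi ((v : 'rV[R]_n) + h j *: e) : R)%:E).
    apply/integrableP; split; first exact/measurable_EFinP.
    have /integrableP[_] := phi_int.
    have mn : measurable_fun setT (fun v : borel 'rV[R]_n => `|phi v| : R).
      exact: measurableT_comp.
    by rewrite -[X in (X < _)%E -> _](integral_translate (h j *: e) mn).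
  rewrite (eq_integral (fun v : borel 'rV[R]_n => (h j)^-1%:E *
     ((phi ((v : 'rV[R]_n) + h j *: e) : R)%:E - (phi v : R)%:E))%E); last first.
    by move=> v _; rewrite -EFinB -EFinM.
  rewrite integralZl//; last exact: integrableB.
  rewrite integralB// (integral_translate _ mphi) subee ?mule0//.
  exact: integrable_fin_num.
have g_int : nu.-integrable setT (fun v => (M * \1_B v)%:E).
  apply: (@bounded_support_integrable _ _ _ nu _ B M) => //; first exact: nuP.1.
    exact: measurable_funM.
  by move=> v; rewrite ger0_norm// mulr_ge0// ltW.
have [] := @dominated_convergence _ _ _ nu setT measurableT
   (fun j v => (F j v)%:E) (fun v => ('D_e phi v : R)%:E) (fun v => (M * \1_B v)%:E) _ _ _ g_int.
- by move=> j; apply/measurable_EFinP; apply: measurable_funM => //; exact: measurable_funB.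
- exact/measurable_EFinP.
- apply: aeW => v _; apply: cvg_EFin; first by near=> j.
  have dv : derivable phi (v : 'rV[R]_n) e by exact: (Cn_derivable C1).
  have hcvg : h @ \oo --> (0 : R)^'.
    move=> S; rewrite /dnbhs /within /= => hS.
    have hS' : nbhs (0 : R) [set x : R | x != 0 -> S x] by exact: hS.
    have := @cvg_harmonic R _ hS'; rewrite /= /nbhs/=.
    apply: filterS => j /= hj; apply: hj.
    by rewrite /harmonic/= gt_eqF// invr_gt0.
  apply: (cvg_trans _ (cvg_comp _ _ hcvg dv)).
  by apply: near_eq_cvg; near=> j; rewrite /F /= [_ *: e + _]addrC.
- by apply: aeW => v j _; rewrite lee_fin.
move=> iD _ lD; split => //.
have : (\int[nu]_x (F j x)%:E)%E @[j --> \oo] --> 0%E.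
  by under eq_fun do rewrite F0; exact: cvg_cst.
by move/cvg_lim => <- //; apply/esym/cvg_lim.
Unshelve. all: by end_near. Qed.

End integration_by_parts.

(** * Quadratic forms and inner products *)

Section quadratic_forms.
Variable R : realType.

Definition quad r (M : 'M[R]_r) (u : 'rV[R]_r) : R := (u *m M *m u^T) 0 0.

Lemma quadE r (M : 'M[R]_r) u : quad M u = \sum_i \sum_j u 0 i * u 0 j * M i j.
Proof.
rewrite /quad !mxE exchange_big/=; apply: eq_bigr => j _; rewrite !mxE mulr_suml.
by apply: eq_bigr => i _; rewrite mulrAC.
Qed.

Lemma mx_entryE m p (M : 'M[R]_(m, p)) i j :
  M i j = (('e_i : 'rV[R]_m) *m M *m ('e_j : 'rV[R]_p)^T) 0 0.
Proof. by rewrite -rowE trmx_delta -colE !mxE. Qed.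

Lemma quadZ r (M : 'M[R]_r) a u : quad M (a *: u) = a ^+ 2 * quad M u.
Proof.
rewrite !quadE mulr_sumr; apply: eq_bigr => i _; rewrite mulr_sumr.
by apply: eq_bigr => j _; rewrite !mxE; ring.
Qed.

Lemma quad_sub r (M N : 'M[R]_r) u : quad (M - N) u = quad M u - quad N u.
Proof. by rewrite /quad mulmxBr mulmxBl !mxE. Qed.

Lemma quadZl r (M : 'M[R]_r) a u : quad (a *: M) u = a * quad M u.
Proof. by rewrite /quad -scalemxAr -scalemxAl mxE. Qed.

Lemma quad_suml r (I : finType) (M : I -> 'M[R]_r) u :
  quad (\sum_i M i) u = \sum_i quad (M i) u.
Proof. by rewrite /quad mulmx_sumr mulmx_suml summxE. Qed.

Lemma quad_le r (M : 'M[R]_r) u :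
  `|quad M u| <= r%:R ^+ 2 * `|M| * `|u| ^+ 2.
Proof.
rewrite quadE; apply: le_trans (ler_norm_sum _ _ _) _.
apply: (@le_trans _ _ (\sum_(i < r) \sum_(j < r) (`|u| ^+ 2 * `|M|))).
  apply: ler_sum => i _; apply: le_trans (ler_norm_sum _ _ _) _.
  apply: ler_sum => j _; rewrite !normrM expr2.
  by rewrite !ler_pM ?mulr_ge0 ?mx_coord_le.
rewrite sumr_const card_ord sumr_const card_ord -[_ *+ r *+ r]mulr_natr.
rewrite -[_ * _ *+ r]mulr_natr.
by rewrite le_eqVlt; apply/orP; left; apply/eqP; ring.
Qed.

Lemma Cn_quad (V : normedModType R) k (U : set V) r
    (M : V -> 'M[R]_r) (x : V -> 'rV[R]_r) : open U ->
  Cn_on k U M -> Cn_on k U x ->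
  Cn_on k U ((fun v => quad (M v) (x v)) : V -> R^o).
Proof.
move=> oU /(Cn_mxP _ _ oU) MC /(Cn_mxP _ _ oU) xC.
apply: (@Cn_eq R V R^o k U
  (fun v => \sum_i \sum_j x v 0 i * x v 0 j * M v i j : R^o) _ oU).
  by move=> v _; rewrite quadE.
apply: (@Cn_sum R V R^o k U _ _ _ (fun i v => \sum_j x v 0 i * x v 0 j * M v i j : R^o) oU) => i _.
apply: (@Cn_sum R V R^o k U _ _ _ (fun j v => x v 0 i * x v 0 j * M v i j : R^o) oU) => j _.
by apply: (CnM oU (CnM oU (xC 0 i) (xC 0 j)) (MC i j)).
Qed.

Definition posdef r (M : 'M[R]_r) := forall u : 'rV[R]_r, u != 0 -> 0 < quad M u.

Lemma quad_continuous r (M : 'M[R]_r) : continuous (quad M).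
Proof.
move=> u; have idC : Cn_on 0 setT (id : 'rV[R]_r -> 'rV[R]_r) by split=> // v _; exact: cvg_id.
exact: (Cn_cont (Cn_quad openT (Cn_cst 0 setT M) idC)).
Qed.

(** The constant is the minimum of the form over the unit sphere, which is compact,
and empty in dimension 0. *)
Lemma posdef_lower r (M : 'M[R]_r) : posdef M ->
  exists2 q : R, 0 < q & forall u, q * `|u| ^+ 2 <= quad M u.
Proof.
move=> Mpos; pose S : set 'rV[R]_r := [set u | `|u| = 1].
have cS : compact S.
  apply: bounded_closed_compact.
    by exists 1; split; [exact: num_real|move=> x x1 u /= ->; exact: ltW].
  apply: (@closed_comp _ _ (fun v : 'rV[R]_r => `|v|) [set x | x = 1]) => //.
    by move=> v _; exact: norm_continuous.
have [S0|/set0P/negP/negPn/eqP S0] := pselect (S !=set0).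
  have cq : {within S, continuous (quad M)}.
    by apply: continuous_subspaceT; exact: quad_continuous.
  have [c /[!inE] cS1 cmin] := compact_EVT_min S0 cS cq.
  have c0 : c != 0 by rewrite -normr_eq0 cS1 oner_eq0.
  exists (quad M c); first exact: Mpos.
  move=> u; have [->|u0] := eqVneq u 0.
    by rewrite normr0 expr0n mulr0 /quad mul0mx mul0mx mxE.
  have un0 : `|u| != 0 by rewrite normr_eq0.
  have uS : `|u|^-1 *: u \in S.
    by rewrite inE /S/= normrZ normfV normr_id mulVf.
  have := cmin _ uS; rewrite quadZ exprVn mulrC ler_pdivlMr//.
  by rewrite exprn_gt0// normr_gt0.
exists 1 => // u; have [->|u0] := eqVneq u 0.
  by rewrite normr0 expr0n mulr0 /quad mul0mx mul0mx mxE.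
suff : S (`|u|^-1 *: u) by rewrite S0.
by rewrite /S/= normrZ normfV normr_id mulVf// normr_eq0.
Qed.

(** Positive definiteness is an open condition with locally uniform constants, so
a continuous family of definite forms dominates every continuous family of forms
locally. *)
Lemma quad_dominated (T : topologicalType) r (B Q : T -> 'M[R]_r) x :
  {for x, continuous B} -> {for x, continuous Q} -> posdef (Q x) ->
  exists2 b : R, 0 < b &
    \forall y \near x, forall u, `|quad (B y) u| <= b * quad (Q y) u.
Proof.
move=> cB cQ /posdef_lower[q q0 qP].
pose s : R := r%:R ^+ 2 + 1.
have s0 : 0 < s by rewrite ltr_wpDl// sqr_ge0.
have rs : r%:R ^+ 2 <= s by rewrite lerDl.
have e0 : 0 < q / 2 / s by rewrite !divr_gt0.
exists (s * (`|B x| + 1) / (q / 2)).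
  by rewrite divr_gt0 ?mulr_gt0 ?ltr_wpDl// divr_gt0.
near=> y => u.
have nB : `|B y| <= `|B x| + 1.
  rewrite -(subrK (B x) (B y)) (le_trans (ler_normD _ _))// addrC lerD2l distrC.
  by near: y; have /cvgrPdist_le/(_ 1 ltr01) := cB.
have nQ : `|Q y - Q x| <= q / 2 / s.
  by rewrite distrC; near: y; have /cvgrPdist_le/(_ _ e0) := cQ.
have u2 : 0 <= `|u| ^+ 2 by rewrite sqr_ge0.
have h1 : `|quad (B y) u| <= s * (`|B x| + 1) * `|u| ^+ 2.
  rewrite (le_trans (quad_le _ _))// ler_wpM2r// ler_pM// sqr_ge0//.
have h2 : q / 2 * `|u| ^+ 2 <= quad (Q y) u.
  have e : `|quad (Q y - Q x) u| <= q / 2 * `|u| ^+ 2.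
    rewrite (le_trans (quad_le _ _))// ler_wpM2r//.
    rewrite (@le_trans _ _ (s * (q / 2 / s)))//.
      by rewrite ler_pM// sqr_ge0.
    by rewrite mulrC divfK// gt_eqF.
  have := qP u; move: e; rewrite quad_sub ler_norml => /andP[e _].
  by move: e; lra.
apply: (le_trans h1); rewrite -[leRHS]mulrA; apply: ler_wpM2l.
  by rewrite mulr_ge0// ?ltW// ltr_wpDl.
by rewrite ler_pdivlMl// divr_gt0.
Unshelve. all: by end_near. Qed.

(** An estimate that holds locally, and whose constant may be enlarged, holds on
a compact set with one constant. *)
Lemma compact_uniform (T : topologicalType) (K : set T) (P : R -> T -> Prop) :
  compact K -> (forall a b x, a <= b -> P a x -> P b x) ->
  (forall x, K x -> exists a, \forall y \near x, P a y) ->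
  exists2 a, 0 < a & forall x, K x -> P a x.
Proof.
move=> cK mono loc.
have /compact_near_coveringP/(_ R (pinfty_nbhs R) P _) h := cK.
have : \forall a \near +oo, K `<=` P a.
  apply: h => x Kx; have [a ha] := loc x Kx.
  near=> y b; rewrite /=; apply: (mono a).
    by near: b; exact: nbhs_pinfty_ge (num_real a).
  by near: y.
move=> hK; have : \forall a \near +oo, 0 < a /\ K `<=` P a.
  by apply: filterI => //; exact: nbhs_pinfty_gt.
by move=> /filter_ex[a [a0 aP]]; exists a.
Unshelve. all: by end_near. Qed.

Lemma posdef_unit r (M : 'M[R]_r) : posdef M -> M \in unitmx.
Proof.
move=> Mpos; rewrite -row_free_unit; apply: inj_row_free => v vM.
apply/eqP; apply: contraT => /Mpos.
by rewrite /quad vM mul0mx mxE ltxx.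
Qed.

(** Definite matrices are invertible and form a convex set, so along the segment
from the identity to [M] the determinant never vanishes and keeps its sign. *)
Lemma posdef_det_gt0 r (M : 'M[R]_r) : posdef M -> 0 < \det M.
Proof.
move=> Mpos; pose N (t : R) : 'M[R]_r := (1 - t) *: 1%:M + t *: M.
have quad1 u : quad (1%:M : 'M[R]_r) u = \sum_i u 0 i ^+ 2.
  by rewrite /quad mulmx1 mxE; apply: eq_bigr => i _; rewrite mxE expr2.
have quad1_gt0 (u : 'rV[R]_r) : u != 0 -> 0 < quad (1%:M : 'M[R]_r) u.
  move=> u0; rewrite quad1 lt0r sumr_ge0 => [|i _]; last exact: sqr_ge0.
  rewrite andbT; apply: contra u0; rewrite psumr_eq0 => [|i _]; last exact: sqr_ge0.
  move=> /allP h; apply/eqP/rowP => i; rewrite mxE; apply/eqP.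
  by have := h i (mem_index_enum _); rewrite sqrf_eq0.
have Npos t : 0 <= t <= 1 -> posdef (N t).
  move=> /andP[t0 t1] u u0.
  have -> : quad (N t) u = (1 - t) * quad 1%:M u + t * quad M u.
    rewrite /quad /N mulmxDr mulmxDl mxE; congr (_ + _).
      by rewrite -scalemxAr -scalemxAl mxE.
    by rewrite -scalemxAr -scalemxAl mxE.
  have := quad1_gt0 u u0; have := Mpos u u0.
  have [->|tn0] := eqVneq t 0; first by lra.
  move=> h1 h2; rewrite ltr_wpDl ?mulr_ge0 ?mulr_gt0 ?subr_ge0//; first exact: ltW.
  by rewrite lt0r tn0.
have cN : continuous (fun t => \det (N t)).
  have h : Cn_on 0 [set: R^o] (fun t : R^o => \det (N t) : R^o).
    rewrite /determinant; apply: Cn_sum; first exact: openT.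
    move=> s _; apply: CnM; [exact: openT|exact: Cn_cst|].
    apply: Cn_prod; first exact: openT.
    move=> i _; rewrite (_ : (fun t : R^o => _) = (fun t : R^o =>
      (1 - t) * (1%:M : 'M[R]_r) i (perm.fun_of_perm s i) + t * M i (perm.fun_of_perm s i))); last first.
      by apply/funext => t; rewrite !mxE.
    split => // t _.
    apply: cvgD; apply: cvgM; try exact: cvg_cst; try exact: cvg_id.
    by apply: cvgB; [exact: cvg_cst|exact: cvg_id].
  by move=> t; exact: (Cn_cont h).
have N0 : N 0 = 1%:M by rewrite /N subr0 scale1r scale0r addr0.
have N1 : N 1 = M by rewrite /N subrr scale0r scale1r add0r.
rewrite ltNge; apply/negP => dM.
have [||t t01 /eqP] := @IVT R (fun t => \det (N t)) 0 1 0 ler01.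
- exact: continuous_subspaceT.
- rewrite N0 N1 det1; apply/andP; split; first by rewrite ge_min dM orbT.
  by rewrite le_max ler01.
have /posdef_unit : posdef (N t) by apply: Npos; move: t01; rewrite in_itv.
by rewrite unitmxE unitfE => /negbTE ->.
Qed.

End quadratic_forms.

Section inner_products.
Variable R : realType.

Section ip.
Variables (V : lmodType R) (h : V -> V -> R).
Hypothesis hP : is_inner_product h.

Lemma ipDr v w w' : h v (w + w') = h v w + h v w'.
Proof. by have [h1 _ _] := hP; rewrite -[w]scale1r h1 mul1r scale1r. Qed.

Lemma ip0r v : h v 0 = 0.
Proof.
have := ipDr v 0 0; rewrite addr0 => /eqP; rewrite -subr_eq subrr => /eqP. exact.
Qed.

Lemma ipZr v k w : h v (k *: w) = k * h v w.
Proof. by have [h1 _ _] := hP; rewrite -[k *: w]addr0 h1 ip0r addr0. Qed.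

Lemma ipC v w : h v w = h w v.
Proof. by have [_ h2 _] := hP. Qed.

Lemma ipDl v w w' : h (w + w') v = h w v + h w' v.
Proof. by rewrite ipC ipDr !(ipC v). Qed.

Lemma ipZl v k w : h (k *: w) v = k * h w v.
Proof. by rewrite ipC ipZr ipC. Qed.

Lemma ip_ge0 v : 0 <= h v v.
Proof.
have [_ _ h3] := hP; have [->|/h3/ltW//] := eqVneq v 0.
by rewrite ip0r.
Qed.

Lemma ip_suml (I : finType) (a : I -> R) (b : I -> V) w :
  h (\sum_i a i *: b i) w = \sum_i a i * h (b i) w.
Proof.
elim/big_ind2: _ => [||i _]; last by rewrite ipZl.
  by rewrite ipC ip0r.
by move=> x1 x2 y1 y2 e1 e2; rewrite ipDl e1 e2.
Qed.

Lemma ip_sumr (I : finType) (a : I -> R) (b : I -> V) w :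
  h w (\sum_i a i *: b i) = \sum_i a i * h w (b i).
Proof. by rewrite ipC ip_suml; apply: eq_bigr => i _; rewrite ipC. Qed.

End ip.

(** [adjoint] is a choice among the maps with the defining property; in a
coordinate system the inverse Gram matrix shows that there is one. *)
Lemma adjointP (V W : lmodType R) (hV : V -> V -> R) (hW : W -> W -> R)
    (T : {linear V -> W}) r (f : {linear V -> 'rV[R]_r}) (g : 'rV[R]_r -> V) :
  is_inner_product hV -> is_inner_product hW -> cancel f g -> cancel g f ->
  forall v w, hW (T v) w = hV v (adjoint hV hW T w).
Proof.
move=> hVP hWP fK gK.
have g_lin : linear g := can2_linear fK gK.
pose gL : {linear 'rV[R]_r -> V} :=
  HB.pack g (GRing.isLinear.Build _ _ _ _ g g_lin).
pose b i := g 'e_i.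
have decomp v : v = \sum_i f v 0 i *: b i.
  have e : g (f v) = gL (\sum_i f v 0 i *: 'e_i) by rewrite -row_sum_delta.
  rewrite -[LHS]fK e linear_sum/=.
  apply: eq_bigr => i _.
  by rewrite -[_ *: 'e_i]addr0 g_lin -[X in _ + X]/(gL 0) linear0 addr0.
pose G : 'M[R]_r := \matrix_(i, j) hV (b i) (b j).
have Gpos : posdef G.
  move=> u u0; have -> : quad G u = hV (g u) (g u).
    rewrite [g u]decomp gK ip_suml// quadE; apply: eq_bigr => i _.
    rewrite ip_sumr// mulr_sumr; apply: eq_bigr => j _.
    by rewrite mxE mulrA.
  have [_ _] := hVP; apply; apply: contra u0 => /eqP gu0.
  by rewrite -(gK u) gu0 linear0.
rewrite /adjoint; case: xgetP => [S _ SP v w|/= nex]; first exact: SP.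
exfalso; apply: (nex (fun w => g ((\row_i hW (T (b i)) w) *m invmx G))) => v w.
set s := _ *m _.
rewrite [in LHS](decomp v) linear_sum/=; under eq_bigr do rewrite linearZ.
rewrite ip_suml// [in RHS](decomp v) ip_suml//; apply: eq_bigr => i _; congr (_ * _).
rewrite (decomp (g s)) gK ip_sumr//.
have -> : hW (T (b i)) w = (s *m G) 0 i.
  by rewrite /s mulmxKV ?posdef_unit// mxE.
by rewrite [LHS]mxE; apply: eq_bigr => j _; rewrite [G _ _]mxE (ipC hVP).
Qed.

End inner_products.

(** * Smooth functions on a closed manifold *)

Lemma derive_rV_lin (R : realType) m p (f : 'rV[R]_m -> 'rV[R]_p)
    (U : set 'rV[R]_m) x v : open U -> U x -> Cn_on 1 U f ->
  'D_v f x = \sum_i v 0 i *: 'D_('e_i) f x.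
Proof.
move=> oU Ux C1; have C1j j : Cn_on 1 U (fun y => f y 0 j : R^o) by have /Cn_mxP := C1; exact.
apply/rowP => j; rewrite derive_mx; last exact: (Cn_derivable C1).
rewrite [LHS]mxE deriveE; last exact: (C1_differentiable oU Ux (C1j j)).
rewrite (C1_diffE oU Ux (C1j j)) summxE.
apply: eq_bigr => i _; rewrite mxE derive_mx ?mxE//.
exact: (Cn_derivable C1).
Qed.

Section manifold.
Variables (R : realType) (n : nat) (X : closed_manifold R n).
Implicit Types (c : chart R n X) (x y : X) (U K : set X).

Lemma chart_img_inv c v : (c @` chart_dom c) v ->
  chart_dom c (chart_inv c v) /\ c (chart_inv c v) = v.
Proof. by move=> [x cx <-]; rewrite chart_funK. Qed.

Lemma chart_imgIE c U : c @` (chart_dom c `&` U) =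
  c @` chart_dom c `&` chart_inv c @^-1` U.
Proof.
apply/seteqP; split=> [_ [x [cx Ux] <-]|v [cv Uv]].
  by split; [exists x|rewrite /= chart_funK].
have [cy yE] := chart_img_inv cv.
by exists (chart_inv c v).
Qed.

Lemma open_chart_imgI c U : open U -> open (c @` (chart_dom c `&` U)).
Proof.
move=> oU; rewrite chart_imgIE; apply: openI_preimage => //.
  exact: chart_img_open.
exact: chart_inv_continuous.
Qed.

Section smooth_maps.
Variable W : normedModType R.
Implicit Types f g : X -> W.

Lemma smooth_mapP U f : smooth_map U f <->
  forall c, charts c -> forall k,
    Cn_on k (c @` (chart_dom c `&` U)) (f \o chart_inv c).
Proof. by split=> h c cc; apply/smooth_onP; exact: h. Qed.

Lemma smooth_map_sub U U' f : U' `<=` U -> smooth_map U f -> smooth_map U' f.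
Proof.
move=> UU' /smooth_mapP h; apply/smooth_mapP => c cc k.
by apply: Cn_sub (h c cc k); apply: image_subset; exact: setIS.
Qed.

Lemma smooth_map_eq U f g : open U -> (forall x, U x -> f x = g x) ->
  smooth_map U f -> smooth_map U g.
Proof.
move=> oU fg /smooth_mapP h; apply/smooth_mapP => c cc k.
apply: Cn_eq (h c cc k); first exact: open_chart_imgI.
by move=> _ [x [cx Ux] <-]; rewrite /= chart_funK// fg.
Qed.

Lemma smooth_map_cst U (a : W) : smooth_map U (fun=> a).
Proof. by apply/smooth_mapP => c cc k; exact: Cn_cst. Qed.

Lemma smooth_map_local U f :
  (forall x, U x -> exists2 U', open U' /\ U' x & smooth_map U' f) ->
  smooth_map U f.
Proof.
move=> h; apply/smooth_mapP => c cc k; apply: Cn_local => _ [x [cx Ux] <-].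
have [U' [_ U'x] /smooth_mapP h'] := h x Ux.
by exists (c @` (chart_dom c `&` U')); [exists x|exact: h'].
Qed.

(** The two open sets [U] and [~` K] cover the manifold, and on the second one the
function vanishes. *)
Lemma smooth_map_glue U0 U K f : open U0 -> open U -> closed K -> K `<=` U ->
  (forall x, ~ K x -> f x = 0) -> smooth_map (U0 `&` U) f -> smooth_map U0 f.
Proof.
move=> oU0 oU cK KU f0 h; apply: smooth_map_local => x U0x.
have [Kx|nKx] := pselect (K x).
  exists (U0 `&` U) => //; split; first exact: openI.
  by split => //; exact: KU.
exists (~` K); first by split => //; exact: closed_openC.
apply: (@smooth_map_eq _ (fun=> 0)); first exact: closed_openC.
  by move=> y /f0.
exact: smooth_map_cst.
Qed.

Lemma smooth_map_continuous U f x : open U -> U x -> smooth_map U f ->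
  {for x, continuous f}.
Proof.
move=> oU Ux /smooth_mapP h; pose c := chart_at x.
have cx : chart_dom c x by exact: chart_at_dom.
have hc : {for c x, continuous (f \o chart_inv c)}.
  by apply: (Cn_cont (h c (chart_at_charts x) 0)); exists x.
have := continuous_comp (chart_fun_continuous cx) hc.
rewrite /prop_for /continuous_at /= chart_funK//.
apply: cvg_trans; apply: near_eq_cvg.
near=> y; rewrite /= chart_funK//.
near: y; apply: open_nbhs_nbhs; split => //; exact: chart_dom_open.
Unshelve. all: by end_near. Qed.

End smooth_maps.

Lemma smooth_mapM U (f g : X -> R^o) : open U -> smooth_map U f -> smooth_map U g ->
  smooth_map U (fun x => f x * g x : R^o).
Proof.
move=> oU /smooth_mapP hf /smooth_mapP hg; apply/smooth_mapP => c cc k.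
by apply: CnM; [exact: open_chart_imgI|exact: hf|exact: hg].
Qed.

Lemma smooth_mapV U (f : X -> R^o) : open U -> (forall x, U x -> f x != 0) ->
  smooth_map U f -> smooth_map U (fun x => (f x)^-1 : R^o).
Proof.
move=> oU f0 /smooth_mapP hf; apply/smooth_mapP => c cc k.
apply: CnV; [exact: open_chart_imgI| |exact: hf].
by move=> _ [x [cx Ux] <-]; rewrite /= chart_funK// f0.
Qed.

Lemma smooth_map_sum (W : normedModType R) U (I : Type) (r : seq I) (f : I -> X -> W) :
  open U -> (forall i, smooth_map U (f i)) ->
  smooth_map U (fun x => \sum_(i <- r) f i x).
Proof.
move=> oU hf; apply/smooth_mapP => c cc k.
apply: Cn_sum => [|i _]; first exact: open_chart_imgI.
by have /smooth_mapP := hf i; exact.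
Qed.

Lemma smooth_map_mxP m p U (f : X -> 'M[R]_(m, p)) : open U ->
  smooth_map U f <-> forall i j, smooth_map U (fun x => f x i j : R^o).
Proof.
move=> oU; split=> [/smooth_mapP h i j|h].
  apply/smooth_mapP => c cc k.
  by have /(Cn_mxP _ _ (@open_chart_imgI c _ oU)) := h c cc k; exact.
apply/smooth_mapP => c cc k; apply/(Cn_mxP _ _ (@open_chart_imgI c _ oU)) => i j.
by have /smooth_mapP := h i j; exact.
Qed.

Lemma smooth_mapZ m p U (f : X -> R^o) (g : X -> 'M[R]_(m, p)) : open U ->
  smooth_map U f -> smooth_map U g -> smooth_map U (fun x => f x *: g x).
Proof.
move=> oU hf /(smooth_map_mxP _ oU) hg; apply/(smooth_map_mxP _ oU) => i j.
apply: (smooth_map_eq (f := fun x => f x * g x i j : R^o) oU).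
  by move=> x _; rewrite mxE.
exact: (smooth_mapM oU hf (hg i j)).
Qed.

Lemma smooth_mulmx m p q U (f : X -> 'M[R]_(m, p)) (g : X -> 'M[R]_(p, q)) : open U ->
  smooth_map U f -> smooth_map U g -> smooth_map U (fun x => f x *m g x).
Proof.
move=> oU /(smooth_map_mxP _ oU) hf /(smooth_map_mxP _ oU) hg.
apply/(smooth_map_mxP _ oU) => i j.
apply: (smooth_map_eq (f := fun x => \sum_k f x i k * g x k j : R^o) oU).
  by move=> x _; rewrite mxE.
by apply: smooth_map_sum => // k; exact: (smooth_mapM oU (hf i k) (hg k j)).
Qed.

Lemma smooth_trmx m p U (f : X -> 'M[R]_(m, p)) : open U ->
  smooth_map U f -> smooth_map U (fun x => (f x)^T).
Proof.
move=> oU /(smooth_map_mxP _ oU) hf; apply/(smooth_map_mxP _ oU) => i j.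
by apply: (smooth_map_eq (f := fun x => f x j i : R^o) oU) => // x _; rewrite mxE.
Qed.

Lemma smooth_chart_comp c (b : 'rV[R]_n -> R^o) : charts c ->
  (forall k, Cn_on k setT b) -> smooth_map (chart_dom c) (b \o c : X -> R^o).
Proof.
move=> cc hb; apply/smooth_mapP => c' cc' k.
have /smooth_onP := charts_compatible cc' cc => /(_ k) h.
apply: (Cn_comp _ _ _ h (hb k)) => //; last exact: openT.
by apply: open_chart_imgI; exact: chart_dom_open.
Qed.

(** Transport a bump of small radius by the chart. The closed ball is compact in
the chart, so its preimage is compact, hence closed in the Hausdorff manifold, and
the extension by zero is smooth. *)
Lemma chart_bump c x U : charts c -> chart_dom c x -> open U -> U x ->
  exists (chi : X -> R) (K : set X),
    [/\ closed K, K `<=` U, smooth_map setT (chi : X -> R^o) &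
     [/\ (forall y, 0 <= chi y), 0 < chi x & (forall y, ~ K y -> chi y = 0)]].
Proof.
move=> cc cx oU Ux; pose V := c @` (chart_dom c `&` U).
have oV : open V by exact: open_chart_imgI.
have : nbhs (c x) V by apply: open_nbhs_nbhs; split => //; exists x.
move=> /nbhs_ballP[e /= e0 eV]; pose r := e / 2.
have r0 : 0 < r by rewrite divr_gt0.
pose B : set 'rV[R]_n := [set v | `|v - c x| <= r].
have BV : B `<=` V.
  move=> v Bv; apply: eV; rewrite -ball_normE/= distrC (le_lt_trans Bv)//.
  by rewrite /r ltr_pdivrMr// ltr_pMr// ltr1n.
have cB : compact B.
  have -> : B = (fun v => v + c x) @` [set v : 'rV[R]_n | `|v| <= r].
    apply/seteqP; split=> [v Bv|_ [v vr <-]]; last by rewrite /B/= addrK.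
    by exists (v - c x); rewrite ?subrK.
  apply: continuous_compact; last exact: compact_closed_ball_rV.
  apply: continuous_subspaceT => v.
  by apply: (@continuousD _ _ _ (fun v => v) (cst (c x))); [exact: cvg_id|exact: cst_continuous].
have Vimg : V `<=` c @` chart_dom c by move=> _ [y [cy _] <-]; exists y.
pose K : set X := chart_inv c @` B.
have KU : K `<=` chart_dom c `&` U.
  by move=> _ [v /BV[y [cy Uy] <-] <-]; rewrite chart_funK.
have clK : closed K.
  apply: compact_closed; first exact: mhausdorff.
  apply: continuous_compact => //; apply: continuous_in_subspaceT => v.
  rewrite inE => /BV/Vimg; exact: chart_inv_continuous.
pose chi y := if pselect (chart_dom c y) then bump_rV (c x) r (c y) else 0.
have chiE y : chart_dom c y -> chi y = bump_rV (c x) r (c y).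
  by rewrite /chi; destruct (pselect _).
have chi0 y : ~ K y -> chi y = 0.
  rewrite /chi; destruct (pselect _) as [cy|ncy] => // nKy.
  apply: bump_rV_out => //; rewrite leNgt; apply/negP => h; apply: nKy.
  by exists (c y); [exact: ltW|rewrite chart_funK].
exists chi, K; split => //.
- by move=> y /KU[].
- apply: (@smooth_map_glue _ _ (chart_dom c) K) => //.
  + exact: openT.
  + exact: chart_dom_open.
  + by move=> y /KU[].
  rewrite setTI; apply: (smooth_map_eq (f := bump_rV (c x) r \o c)).
  + exact: chart_dom_open.
  + by move=> y cy; rewrite chiE.
  by apply: smooth_chart_comp => // k; exact: Cn_bump_rV.
split => //.
- by move=> y; rewrite /chi; destruct (pselect _) => //; exact: bump_rV_ge0.
- by rewrite chiE//; exact: bump_rV_gt0.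
Qed.

(** Finitely many of the open sets where the bumps are positive cover the compact
manifold; dividing by the sum normalizes. The index set of the family is [X]
itself, and [s] lists the finitely many indices that count. *)
Lemma partition_of_unity (U : X -> set X) : (forall x, open (U x)) ->
  (forall x, U x x) ->
  exists (s : seq X) (chi : X -> X -> R) (K : X -> set X),
    [/\ (forall i, closed (K i)), (forall i, K i `<=` U i),
     (forall i, smooth_map setT (chi i : X -> R^o)),
     (forall i y, ~ K i y -> chi i y = 0) &
     (forall y, \sum_(i <- s) chi i y = 1)].
Proof.
move=> oU Ux.
have bumpU x : exists p : (X -> R) * set X, [/\ closed p.2, p.2 `<=` U x,
    smooth_map setT (p.1 : X -> R^o) & [/\ (forall y, 0 <= p.1 y), 0 < p.1 x
    & (forall y, ~ p.2 y -> p.1 y = 0)]].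
  have [chi [K h]] := chart_bump (chart_at_charts x) (chart_at_dom x) (oU x) (Ux x).
  by exists (chi, K).
have [p pP] := choice bumpU.
pose V x := [set y : X | 0 < (p x).1 y].
have oV x : open (V x).
  rewrite (_ : V x = (p x).1 @^-1` [set t : R | 0 < t])//.
  apply: open_comp; last exact: open_gt.
  move=> y _; have [_ _ sm _] := pP x.
  exact: (smooth_map_continuous openT _ sm).
have := @mcompact _ _ X; rewrite compact_cover => /(_ _ setT V (fun x _ => oV x)).
move=> [x _|D _ Dcov]; first by exists x => //; have [_ _ _ []] := pP x.
pose s := finmap.enum_fset D.
pose tot y := \sum_(i <- s) (p i).1 y.
have tot_gt0 y : 0 < tot y.
  have [i Di Vi] := Dcov y Logic.I.
  rewrite /tot (big_rem i)//= ltr_wpDr//.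
  by apply: sumr_ge0 => j _; have [_ _ _ []] := pP j.
exists s, (fun i y => (p i).1 y * (tot y)^-1), (fun i => (p i).2); split.
- by move=> i; have [] := pP i.
- by move=> i; have [] := pP i.
- move=> i; have [_ _ sm _] := pP i.
  apply: smooth_mapM; [exact: openT|exact: sm|].
  apply: smooth_mapV; [exact: openT|by move=> y _; rewrite gt_eqF|].
  by apply: smooth_map_sum; [exact: openT|move=> j; have [] := pP j].
- by move=> i y nK; have [_ _ _ [_ _ h]] := pP i; rewrite h// mul0r.
- by move=> y; rewrite -mulr_suml -/(tot y) divff// gt_eqF.
Qed.

Lemma gram_quad g c x w : quad (gram g c x) w =
  g x (\sum_i w 0 i *: coord_vector c i x) (\sum_i w 0 i *: coord_vector c i x).
Proof.
have gP := rmetric_inner g x.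
rewrite quadE [RHS](ip_suml gP); apply: eq_bigr => i _.
rewrite (ip_sumr gP) mulr_sumr; apply: eq_bigr => j _.
by rewrite mxE mulrA.
Qed.

Section coord_vectors.
Variables (c : chart R n X) (x : X).
Hypotheses (cc : charts c) (cx : chart_dom c x).

Let tau : 'rV[R]_n -> 'rV[R]_n := chart_at x \o chart_inv c.

Let O := c @` (chart_dom c `&` chart_dom (chart_at x)).

Let oO : open O. Proof. by apply: open_chart_imgI; exact: chart_dom_open. Qed.

Let tau_C1 : Cn_on 1 O tau.
Proof. by apply: smooth_Cn; exact: (charts_compatible cc (chart_at_charts x)). Qed.

Let Ox : O (c x). Proof. by exists x => //; split => //; exact: chart_at_dom. Qed.

Lemma coord_vector_sum v :
  'D_v (chart_at x \o chart_inv c) (c x) = \sum_i v 0 i *: coord_vector c i x.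
Proof. exact: (derive_rV_lin v oO Ox tau_C1). Qed.

(** The derivative of the transition map is injective, since by the chain rule the
derivative of the inverse transition map is a left inverse of it. *)
Lemma coord_vector_free (v : 'rV[R]_n) : \sum_i v 0 i *: coord_vector c i x = 0 -> v = 0.
Proof.
rewrite -coord_vector_sum -/tau => Dtau0.
pose d := chart_at x; pose sg : 'rV[R]_n -> 'rV[R]_n := c \o chart_inv d.
pose O' := d @` (chart_dom d `&` chart_dom c).
have oO' : open O' by apply: open_chart_imgI; exact: chart_dom_open.
have dx : chart_dom d x by exact: chart_at_dom.
have taux : tau (c x) = d x by rewrite /tau /= chart_funK.
have O'x : O' (tau (c x)) by rewrite taux; exists x.
have sg_C1 : Cn_on 1 O' sg.
  by apply: smooth_Cn; exact: (charts_compatible (chart_at_charts x) cc).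
apply/rowP => j; rewrite mxE.
have sgj : Cn_on 1 O' (fun w => sg w 0 j : R^o) by have /(Cn_mxP _ _ oO') := sg_C1; exact.
have [_] := is_derive_comp_rV oO' O'x sgj (Cn_derivable tau_C1 (v := v) Ox).
rewrite big1 => [<-|i _]; last by rewrite Dtau0 mxE mul0r.
have -> : v 0 j = 'D_v (fun w : 'rV[R]_n => w 0 j : R^o) (c x).
  by rewrite -[in LHS](derive_id (c x) v) derive_mx ?mxE//; exact: derivable_id.
apply: near_eq_derive.
near=> w; have [y [cy dy] <-] : O w by near: w; exact: open_nbhs_nbhs.
by rewrite /= /tau /sg /= chart_funK// chart_funK.
Unshelve. all: by end_near. Qed.

Lemma gram_posdef g : posdef (gram g c x).
Proof.
move=> u u0; pose w := \sum_i u 0 i *: coord_vector c i x.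
rewrite gram_quad -/w; have [_ _] := rmetric_inner g x; apply; apply: contra u0 => /eqP w0.
by apply/eqP; exact: coord_vector_free.
Qed.

End coord_vectors.

End manifold.

(** * Vector bundles in local frames *)

Arguments triv_inv {R n X E} t x v.

Section derive_matrix.
Variables (R : realType) (V : normedModType R).

Lemma is_derive_mx m p (f : V -> 'M[R]_(m, p)) x v (d : 'M[R]_(m, p)) :
  (forall i j, is_derive x v (fun y => f y i j : R^o) (d i j)) ->
  is_derive x v f d.
Proof.
move=> h; have df : derivable f x v by apply/derivable_mxP => i j; have [] := h i j.
apply: DeriveDef => //; rewrite derive_mx//; apply/matrixP => i j; rewrite mxE.
by have [_ ->] := h i j.
Qed.

Lemma is_derive_coord m p (f : V -> 'M[R]_(m, p)) x v i j : derivable f x v ->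
  is_derive x v (fun y => f y i j : R^o) ('D_v f x i j).
Proof.
move=> df; apply: DeriveDef; first exact: (derivable_mxP _ _ _).1.
by rewrite derive_mx// mxE.
Qed.

Lemma is_derive_mulmx m p q (f : V -> 'M[R]_(m, p)) (g : V -> 'M[R]_(p, q)) x v :
  derivable f x v -> derivable g x v ->
  is_derive x v (fun y => f y *m g y) ('D_v f x *m g x + f x *m 'D_v g x).
Proof.
move=> df dg; apply: is_derive_mx => i j.
have -> : (fun y => (f y *m g y) i j : R^o) =
    \sum_(k < p) ((fun y => f y i k : R^o) * (fun y => g y k j : R^o)).
  by apply/funext => y; rewrite mxE fct_sumE.
apply: is_derive_eq.
  apply: is_derive_sum => k; apply: is_deriveM; exact: is_derive_coord.
rewrite !mxE -big_split/=; apply: eq_bigr => k _.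
by rewrite addrC; congr (_ + _); exact: mulrC.
Qed.

Lemma is_derive_trmx m p (f : V -> 'M[R]_(m, p)) x v : derivable f x v ->
  is_derive x v (fun y => (f y)^T) ('D_v f x)^T.
Proof.
move=> df; apply: is_derive_mx => i j.
rewrite (_ : (fun y => (f y)^T i j : R^o) = fun y => f y j i : R^o).
  by rewrite mxE; exact: is_derive_coord.
by apply/funext => y; rewrite mxE.
Qed.

Lemma is_derive_scalemx m p (f : V -> R^o) (g : V -> 'M[R]_(m, p)) x v :
  derivable f x v -> derivable g x v ->
  is_derive x v (fun y => f y *: g y) (f x *: 'D_v g x + ('D_v f x : R) *: g x).
Proof.
move=> df dg; apply: is_derive_mx => i j.
rewrite (_ : (fun y => (f y *: g y) i j : R^o) = f * (fun y => g y i j : R^o)).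
  apply: is_derive_eq.
    by apply: is_deriveM; [exact: derivableP|exact: is_derive_coord].
  by rewrite !mxE; congr (_ + _); exact: mulrC.
by apply/funext => y; rewrite mxE.
Qed.

(** The two terms where [w] is differentiated agree because [T x] is symmetric.
Read backwards, this expresses the pairing of [w] with its derivative through a
total derivative and a term without derivatives of [w]. *)
Lemma is_derive_quad r (T : V -> 'M[R]_r) (w : V -> 'rV[R]_r) x v :
  derivable T x v -> derivable w x v -> (T x)^T = T x ->
  is_derive x v (fun y => quad (T y) (w y) : R^o)
    (2 * ('D_v w x *m T x *m (w x)^T) 0 0 + quad ('D_v T x) (w x)).
Proof.
move=> dT dw Tsym; rewrite /quad.
have d1 := is_derive_mulmx dw dT.
have d2 := is_derive_trmx dw.
have d3 := is_derive_mulmx (@ex_derive _ _ _ _ _ _ _ d1) (@ex_derive _ _ _ _ _ _ _ d2).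
rewrite (@derive_val _ _ _ _ _ _ _ d1) (@derive_val _ _ _ _ _ _ _ d2) in d3.
apply: is_derive_eq; first exact: (is_derive_coord 0 0 (@ex_derive _ _ _ _ _ _ _ d3)).
rewrite (@derive_val _ _ _ _ _ _ _ d3) mulmxDl [LHS]mxE [X in X + _]mxE.
have -> : (w x *m T x *m ('D_v w x)^T) 0 0 = ('D_v w x *m T x *m (w x)^T) 0 0.
  by rewrite -[in LHS](trmxK (w x *m _ *m _)) mxE !trmx_mul trmxK Tsym mulmxA.
by ring.
Qed.

End derive_matrix.

Section bundles.
Variables (R : realType) (n : nat) (X : closed_manifold R n).
Implicit Types (c : chart R n X) (x y : X).

Section frames.
Variables (E : vector_bundle X) (t : trivialization E) (tt : trivs t).

Lemma triv_inv_linear y : triv_dom t y -> linear (triv_inv t y).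
Proof. by move=> ty; exact: can2_linear (triv_funK ty) (triv_invK ty). Qed.

Definition frame y (i : 'I_(triv_rank t)) : E y := triv_inv t y 'e_i.

Lemma triv_inv_sum y (w : 'rV[R]_(triv_rank t)) : triv_dom t y ->
  triv_inv t y w = \sum_i w 0 i *: frame y i.
Proof.
move=> ty; pose L : {linear 'rV[R]_(triv_rank t) -> E y} := HB.pack (triv_inv t y)
  (GRing.isLinear.Build _ _ _ _ (triv_inv t y) (triv_inv_linear ty)).
rewrite -[LHS]/(L w) {1}(row_sum_delta w) linear_sum/=.
apply: eq_bigr => i _; rewrite -[LHS]/(L (w 0 i *: 'e_i)) linearZ.
exact: erefl.
Qed.

Lemma frame_decomp y (e : E y) : triv_dom t y ->
  e = \sum_i t y e 0 i *: frame y i.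
Proof. by move=> ty; rewrite -triv_inv_sum// triv_funK. Qed.

Variable h : bundle_metric E.

Definition bundle_gram y : 'M[R]_(triv_rank t) :=
  \matrix_(i, j) h y (frame y i) (frame y j).

Lemma bundle_gramE y (e e' : E y) : triv_dom t y ->
  h y e e' = (t y e *m bundle_gram y *m (t y e')^T) 0 0.
Proof.
move=> ty; have hP := bmetric_inner h y.
rewrite {1}(frame_decomp e ty) {1}(frame_decomp e' ty) (ip_suml hP).
rewrite [RHS]mxE; under [RHS]eq_bigr do rewrite !mxE mulr_suml.
rewrite exchange_big/=; apply: eq_bigr => i _; rewrite (ip_sumr hP) mulr_sumr.
by apply: eq_bigr => j _; rewrite !mxE; ring.
Qed.

Lemma bundle_gram_quad y (e : E y) : triv_dom t y ->
  h y e e = quad (bundle_gram y) (t y e).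
Proof. exact: bundle_gramE. Qed.

Lemma bundle_gram_posdef y : triv_dom t y -> posdef (bundle_gram y).
Proof.
move=> ty u u0; rewrite -[u](triv_invK ty) -bundle_gram_quad//.
have [_ _] := bmetric_inner h y; apply; apply: contra u0 => /eqP e0.
by rewrite -(triv_invK ty u) e0 linear0.
Qed.

Lemma bundle_gram_smooth : smooth_map (triv_dom t) bundle_gram.
Proof.
apply/(smooth_map_mxP _ (triv_dom_open t)) => i j.
apply: (smooth_map_eq (f := fun x => h x (triv_inv t x 'e_i) (triv_inv t x 'e_j) : R^o)).
- exact: triv_dom_open.
- by move=> y _; rewrite mxE.
- exact: (bmetric_smooth h tt).
Qed.

(** Extend the vector with constant components in the trivialization and cut off
by a bump. *)
Lemma section_extension y (e : E y) : triv_dom t y ->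
  exists2 xi : section E, smooth_section xi & xi y = e.
Proof.
move=> ty.
have [chi [K [cK KU sm [chi0 chiy chiK]]]] :=
  chart_bump (chart_at_charts y) (chart_at_dom y) (triv_dom_open t) ty.
exists (fun z => (chi z / chi y) *: triv_inv t z (t y e)); last first.
  by rewrite divff ?gt_eqF// scale1r triv_funK.
move=> t' tt'; apply: (smooth_map_glue (triv_dom_open t') (triv_dom_open t) cK KU).
  by move=> z nK; rewrite chiK// mul0r scale0r linear0.
have oU : open (triv_dom t' `&` triv_dom t) by apply: openI; exact: triv_dom_open.
apply: (smooth_map_eq (f := fun z => (chi z * (chi y)^-1 : R^o) *: t' z (triv_inv t z (t y e))) oU).
  by move=> z _; rewrite linearZ.
apply: smooth_mapZ => //.
  apply: smooth_mapM => //; last exact: smooth_map_cst.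
  by apply: smooth_map_sub sm.
by rewrite setIC; exact: (trivs_compatible tt tt').
Qed.

End frames.

Arguments frame {E} t y i.

Lemma smooth_section_scale (E : vector_bundle X) (f : X -> R) (xi : section E) :
  smooth_map setT (f : X -> R^o) -> smooth_section xi ->
  smooth_section (fun x => f x *: xi x).
Proof.
move=> sf sxi t tt; have ot := triv_dom_open t.
apply: (smooth_map_eq (f := fun x => (f x : R^o) *: t x (xi x)) ot).
  by move=> x _; rewrite linearZ.
by apply: smooth_mapZ => //; [exact: smooth_map_sub sf|exact: sxi].
Qed.

Lemma smooth_metric (E : vector_bundle X) (h : bundle_metric E) (xi eta : section E) :
  smooth_section xi -> smooth_section eta ->
  smooth_map setT (fun x => h x (xi x) (eta x) : R^o).
Proof.
move=> sxi seta; apply: smooth_map_local => x _.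
have [t tt tx] := trivs_cover E x; have ot := triv_dom_open t.
exists (triv_dom t) => //.
apply: (smooth_map_eq (f := fun y => (t y (xi y) *m bundle_gram t h y *m (t y (eta y))^T) 0 0 : R^o) ot).
  by move=> y ty; rewrite -bundle_gramE.
have : smooth_map (triv_dom t) (fun y => t y (xi y) *m bundle_gram t h y *m (t y (eta y))^T).
  apply: smooth_mulmx => //; last by apply: smooth_trmx => //; exact: seta.
  by apply: smooth_mulmx => //; [exact: sxi|exact: bundle_gram_smooth].
by move=> /(smooth_map_mxP _ ot); exact.
Qed.

Section maps.
Variables (E F : vector_bundle X) (A : forall x, {linear E x -> F x}).
Hypothesis sA : smooth_bundle_map A.

Definition local_map (t : trivialization E) (t' : trivialization F) y :
    'M[R]_(triv_rank t, triv_rank t') :=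
  \matrix_(i, j) t' y (A y (frame t y i)) 0 j.

Lemma local_mapE (t : trivialization E) (t' : trivialization F) y (e : E y) :
  triv_dom t y -> t' y (A y e) = t y e *m local_map t t' y.
Proof.
move=> ty; rewrite {1}(frame_decomp e ty) !linear_sum/=; apply/rowP => j.
by rewrite mxE summxE; apply: eq_bigr => i _; rewrite !linearZ !mxE.
Qed.

Lemma local_map_smooth (t : trivialization E) (t' : trivialization F) :
  trivs t -> trivs t' -> smooth_map (triv_dom t `&` triv_dom t') (local_map t t').
Proof.
move=> tt tt'; have oU : open (triv_dom t `&` triv_dom t') by apply: openI; exact: triv_dom_open.
apply/(smooth_map_mxP _ oU) => i j.
have /(smooth_map_mxP _ oU) /(_ 0 j) := sA tt tt' 'e_i.
by apply: smooth_map_eq => // y _; rewrite mxE.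
Qed.

Lemma smooth_section_map (xi : section E) :
  smooth_section xi -> smooth_section (fun x => A x (xi x)).
Proof.
move=> sxi t' tt'; apply: smooth_map_local => x t'x.
have [t tt tx] := trivs_cover E x.
have oU : open (triv_dom t `&` triv_dom t') by apply: openI; exact: triv_dom_open.
exists (triv_dom t `&` triv_dom t') => //.
apply: (smooth_map_eq (f := fun y => t y (xi y) *m local_map t t' y) oU).
  by move=> y [ty _]; rewrite (local_mapE _ _ ty).
apply: smooth_mulmx => //; last exact: local_map_smooth.
by apply: smooth_map_sub (sxi t tt); exact: subIsetl.
Qed.

(** Unfolding the adjoints, the condition on a concentrating pair says that the
bilinear form pairing [sigma u] with [A] is symmetric. *)
Lemma concentrating_sym (hE : bundle_metric E) (hF : bundle_metric F)
    (sigma : forall x, 'rV[R]_n -> {linear E x -> F x}) x u (e e' : E x) :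
  concentrating_pair hE hF sigma A ->
  hF x (sigma x u e) (A x e') = hF x (sigma x u e') (A x e).
Proof.
move=> conc; have [t tt tx] := trivs_cover E x.
have hEP := bmetric_inner hE x; have hFP := bmetric_inner hF x.
have adjA := @adjointP _ _ _ (hE x) (hF x) (A x) _ (t x) _ hEP hFP (triv_funK tx) (triv_invK tx).
have adjS := @adjointP _ _ _ (hE x) (hF x) (sigma x u) _ (t x) _ hEP hFP (triv_funK tx) (triv_invK tx).
rewrite (ipC hFP) adjA adjS; congr (hE x e' _).
by have := conc x u => /(congr1 (fun f => f e)).
Qed.

End maps.

(** The [k]-th coordinate centred at [x], times a bump, divided by the value of
the bump at [x]: since the coordinate vanishes at [x], the bump is not
differentiated there. *)
Lemma coordinate_function c x (k : 'I_n) : charts c -> chart_dom c x ->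
  exists f : X -> R, [/\ smooth_map setT (f : X -> R^o), f x = 0 &
    forall j, 'D_('e_j) ((f : X -> R^o) \o chart_inv c) (c x) = (j == k)%:R].
Proof.
move=> cc cx.
have [chi [K [cK KU sm [chi0 chix chiK]]]] :=
  chart_bump cc cx (chart_dom_open c) cx.
pose b (v : 'rV[R]_n) : R^o := (v 0 k - c x 0 k) * (chi x)^-1.
have bs m : Cn_on m setT b.
  apply: CnM; [exact: openT| |exact: Cn_cst].
  by apply: CnD; [exact: openT|exact: Cn_coord|exact: Cn_cst].
exists (fun y => chi y * b (c y)); split.
- apply: (smooth_map_glue openT (chart_dom_open c) cK KU).
    by move=> y nK; rewrite chiK// mul0r.
  rewrite setTI; apply: smooth_mapM; first exact: chart_dom_open.
    exact: smooth_map_sub sm.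
  exact: smooth_chart_comp.
- by rewrite /b subrr mul0r mulr0.
move=> j; pose chi' (v : 'rV[R]_n) : R^o := chi (chart_inv c v).
have oO : open (c @` chart_dom c) by exact: chart_img_open.
have Ox : (c @` chart_dom c) (c x) by exists x.
have dchi : derivable chi' (c x) 'e_j.
  have /smooth_mapP/(_ c cc 1) := sm; rewrite setIT => h.
  exact: (Cn_derivable h).
have db : derivable b (c x) 'e_j by exact: (Cn_derivable (bs 1)).
have -> : 'D_('e_j) ((fun y => chi y * b (c y) : R^o) \o chart_inv c) (c x) =
    'D_('e_j) (chi' * b) (c x).
  apply: near_eq_derive; near=> v.
  have [y cy <-] : (c @` chart_dom c) v by near: v; exact: open_nbhs_nbhs.
  by rewrite /= chart_funK// /chi' -[RHS]/(chi _ * b _) chart_funK.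
rewrite deriveM// [X in _ + X](_ : _ = 0); last first.
  by rewrite /b subrr mul0r scale0r.
rewrite addr0 /chi' chart_funK//.
have -> : 'D_('e_j) b (c x) = (j == k)%:R * (chi x)^-1.
  have d1 : is_derive (c x) 'e_j (fun v : 'rV[R]_n => v 0 k : R^o) (j == k)%:R.
    apply: is_derive_eq; first exact: (is_derive_coord 0 k (@derivable_id _ _ (c x) 'e_j)).
    by rewrite derive_id mxE eqxx/= eq_sym.
  have d2 := is_deriveB d1 (is_derive_cst (c x 0 k : R^o) (c x) 'e_j).
  have d3 := is_deriveM d2 (is_derive_cst ((chi x)^-1 : R^o) (c x) 'e_j).
  have [_ ->] : is_derive (c x) 'e_j b _ := d3.
  by rewrite scaler0 add0r subr0 [LHS]mulrC.
by rewrite -[LHS]/(_ * _) mulrCA divff ?mulr1// gt_eqF.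
Unshelve. all: by end_near. Qed.

Section symbol.
Variables (E F : vector_bundle X) (D : section E -> section F).
Variable sigma : forall x, 'rV[R]_n -> {linear E x -> F x}.
Hypotheses (Ds : is_symbol D sigma).
Variables (c : chart R n X) (t : trivialization E) (t' : trivialization F).
Hypotheses (cc : charts c) (tt : trivs t) (tt' : trivs t').
Variables (a : 'I_n -> X -> 'M[R]_(triv_rank t, triv_rank t'))
  (b : X -> 'M[R]_(triv_rank t, triv_rank t')).
Let U := chart_dom c `&` triv_dom t `&` triv_dom t'.
Hypothesis DE : forall xi, smooth_section xi -> forall x, U x ->
  t' x (D xi x) = \sum_(k < n) 'D_('e_k) (fun v : 'rV[R]_n =>
     t (chart_inv c v) (xi (chart_inv c v))) (c x) *m a k x + t x (xi x) *m b x.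

Lemma local_section_Cn (xi : section E) m : smooth_section xi ->
  Cn_on m (c @` (chart_dom c `&` triv_dom t))
    (fun v : 'rV[R]_n => t (chart_inv c v) (xi (chart_inv c v))).
Proof. by move=> sxi; apply: smooth_Cn; exact: sxi. Qed.

(** Each matrix coefficient of [D] is the symbol at some covector: apply [D] to
[f *: xi], where [xi] extends [e] and [f] is the cut-off [k]-th coordinate, so that
only the [k]-th derivative term survives at [x]. *)
Lemma symbol_coefficient x (k : 'I_n) : U x ->
  exists u, forall e : E x, t' x (sigma x u e) = t x e *m a k x.
Proof.
move=> Ux; have [[cx tx] t'x] := Ux.
have [f [sf fx Df]] := coordinate_function k cc cx.
exists (differential_at f x) => e.
have [xi sxi xix] := section_extension tt e tx.
have [_ /(_ f xi sf sxi) DfE] := Ds.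
have := DE (smooth_section_scale sf sxi) Ux.
rewrite DfE fx xix scale0r addr0 => ->.
rewrite scale0r linear0 mul0mx addr0.
have oO : open (c @` (chart_dom c `&` triv_dom t)).
  by apply: open_chart_imgI; exact: triv_dom_open.
have Ox : (c @` (chart_dom c `&` triv_dom t)) (c x) by exists x.
have dxi j : derivable (fun v : 'rV[R]_n => t (chart_inv c v) (xi (chart_inv c v))) (c x) 'e_j.
  exact: (Cn_derivable (local_section_Cn 1 sxi)).
have df j : derivable ((f : X -> R^o) \o chart_inv c) (c x) 'e_j.
  have /smooth_mapP/(_ c cc 1) := sf; rewrite setIT => h.
  by apply: (Cn_derivable h); exists x.
have Dj j : 'D_('e_j) (fun v : 'rV[R]_n => t (chart_inv c v)
    (f (chart_inv c v) *: xi (chart_inv c v))) (c x) = (j == k)%:R *: t x e.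
  have -> : (fun v : 'rV[R]_n => t (chart_inv c v)
      (f (chart_inv c v) *: xi (chart_inv c v))) = (fun v =>
      ((f : X -> R^o) \o chart_inv c) v *: t (chart_inv c v) (xi (chart_inv c v))).
    by apply/funext => v; rewrite linearZ.
  have [_ ->] := is_derive_scalemx (df j) (dxi j).
  by rewrite Df /= chart_funK// fx scale0r add0r xix.
under eq_bigr do rewrite Dj.
rewrite (bigD1 k)//= eqxx scale1r big1 ?addr0// => j /negbTE ->.
by rewrite scale0r mul0mx.
Qed.

End symbol.

End bundles.

(** * Local integration by parts *)

Section local_integration_by_parts.
Variables (R : realType) (n : nat) (X : closed_manifold R n).
Variable g : riemannian_metric X.
Variable mu : {measure set (g_sigma_algebraType (@open X)) -> \bar R}.
Hypothesis muP : is_riemannian_volume g mu.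
Variable nu : {sigma_finite_measure set (borel 'rV[R]_n) -> \bar R}.
Hypothesis nuP : is_lebesgue_rV nu.
Variables (E F : vector_bundle X) (hE : bundle_metric E) (hF : bundle_metric F).
Variables (D : section E -> section F).
Variable sigma : forall x, 'rV[R]_n -> {linear E x -> F x}.
Variable A : forall x, {linear E x -> F x}.
Hypotheses (Dfirst : first_order_operator D) (Dsymb : is_symbol D sigma).
Hypotheses (sA : smooth_bundle_map A) (conc : concentrating_pair hE hF sigma A).

Section chart.
Variable c : chart R n X.
Hypothesis cc : charts c.

Definition volume_density (v : 'rV[R]_n) : R :=
  Num.sqrt (\det (gram g c (chart_inv c v))).

Lemma det_gram_gt0 v : (c @` chart_dom c) v -> 0 < \det (gram g c (chart_inv c v)).
Proof.
by move=> Ov; apply: posdef_det_gt0; apply: gram_posdef => //; have [] := chart_img_inv Ov.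
Qed.

Lemma volume_density_gt0 v : (c @` chart_dom c) v -> 0 < volume_density v.
Proof. by move=> Ov; rewrite sqrtr_gt0; exact: det_gram_gt0. Qed.

Lemma volume_density_Cn k : Cn_on k (c @` chart_dom c) (volume_density : 'rV[R]_n -> R^o).
Proof.
have oO : open (c @` chart_dom c) by exact: chart_img_open.
apply: Cn_sqrt => //; first by move=> v; exact: det_gram_gt0.
rewrite /determinant; apply: Cn_sum => // s _; apply: CnM => //; first exact: Cn_cst.
apply: Cn_prod => // i _.
have /smooth_mapP/(_ c cc k) := rmetric_smooth g i (perm.fun_of_perm s i) cc.
rewrite setIid; apply: Cn_eq => // v _.
by rewrite /= mxE.
Qed.

Variable U : set X.
Hypotheses (oU : open U) (Uc : U `<=` chart_dom c).

Let O : set (borel 'rV[R]_n) := c @` (chart_dom c `&` U).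
Let oO : open (O : set 'rV[R]_n). Proof. exact: open_chart_imgI. Qed.
Let Oc : O `<=` c @` chart_dom c. Proof. by move=> _ [x [cx _] <-]; exists x. Qed.
Let OU v : O v -> U (chart_inv c v).
Proof. by move=> [x [cx Ux] <-]; rewrite chart_funK. Qed.
Let mO : measurable O. Proof. exact: open_borel. Qed.
Let mU : measurable (U : set (borel X)). Proof. exact: open_borel. Qed.

Let mrho : measurable_fun O (volume_density : borel 'rV[R]_n -> R).
Proof.
apply: continuous_borelR => // v Ov.
by apply: (Cn_cont (volume_density_Cn 0)); exact: Oc.
Qed.

Let minv : measurable_fun O (chart_inv c : borel 'rV[R]_n -> borel X).
Proof.
by apply: continuous_borel => // v Ov; apply: chart_inv_continuous; exact: Oc.
Qed.

Let volE (B : set (borel X)) : measurable B -> B `<=` U ->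
  (mu B = \int[nu]_(v in O) (volume_density v * \1_B (chart_inv c v))%:E)%E.
Proof.
move=> mB BU; have Bc : B `<=` chart_dom c by move=> x /BU/Uc.
rewrite (muP cc mB Bc).
have BE : [set c x | x in B] = O `&` chart_inv c @^-1` B.
  apply/seteqP; split=> [_ [x Bx <-]|v [[x [cx Ux] <-] /=]].
    by split; [exists x => //; split; [exact: Bc|exact: BU]|rewrite /= chart_funK//; exact: Bc].
  by rewrite chart_funK// => Bx; exists x.
have mcB : measurable ([set c x | x in B] : set (borel 'rV[R]_n)).
  by rewrite BE; exact: minv.
rewrite -nuP.2.
- rewrite [RHS]integral_mkcond; apply: eq_integral => v _.
  rewrite !patchE BE in_setI.
  case: (v \in O) => //=; rewrite indicE -[_ \in chart_inv c @^-1` B]/(chart_inv c v \in B).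
  by case: (_ \in B); rewrite ?mulr1 ?mulr0.
- pose rho (v : borel 'rV[R]_n) : \bar R := (volume_density v)%:E.
  have mrho' : measurable_fun ([set c x | x in B] : set (borel 'rV[R]_n)) rho.
    apply/measurable_EFinP.
    by apply: measurable_funS mrho => //; rewrite BE; exact: subIsetl.
  exact: ((measurable_restrictT rho mcB).1 mrho').
- by move=> v; rewrite patchE; case: ifP => // _; rewrite lee_fin sqrtr_ge0.
Qed.

(** The defining property of the Riemannian volume concerns sets; it is the case of
indicator functions of the integration against a density. *)
Lemma chart_integral (f : X -> R) : (forall x, U x -> {for x, continuous f}) ->
  (\int[mu]_(x in U) (f x)%:E =
   \int[nu]_(v in O) (f (chart_inv c v) * volume_density v)%:E)%E.
Proof.
move=> cf; apply: (@integral_density _ _ (borel X) (borel 'rV[R]_n) R mu nu U O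
  (chart_inv c) volume_density) => //.
- by move=> v _; exact: sqrtr_ge0.
by apply: continuous_borelR.
Qed.

End chart.

Section trivialized.
Variables (c : chart R n X) (t : trivialization E) (t' : trivialization F).
Hypotheses (cc : charts c) (tt : trivs t) (tt' : trivs t').

Let U := chart_dom c `&` triv_dom t `&` triv_dom t'.
Let O : set 'rV[R]_n := c @` (chart_dom c `&` U).
Let r := triv_rank t.
Let rho := volume_density c.

Let oU : open U.
Proof. by apply: openI; [apply: openI; [exact: chart_dom_open|]|]; exact: triv_dom_open. Qed.
Let oO : open O. Proof. exact: open_chart_imgI. Qed.
Let Uc : U `<=` chart_dom c. Proof. by move=> x [[]]. Qed.
Let Ut : U `<=` triv_dom t. Proof. by move=> x [[]]. Qed.
Let Ut' : U `<=` triv_dom t'. Proof. by move=> x []. Qed.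
Let OU v : O v -> U (chart_inv c v).
Proof. by move=> [x [cx Ux] <-]; rewrite chart_funK. Qed.
Let Oc : O `<=` c @` chart_dom c. Proof. by move=> _ [x [cx _] <-]; exists x. Qed.
Let OcK v : O v -> c (chart_inv c v) = v.
Proof. by move=> [x [cx Ux] <-]; rewrite chart_funK. Qed.

Let H' := bundle_gram t' hF.
Let Ah := local_map A t t'.
Let Q := bundle_gram t hE.

Let sH' : smooth_map U H'.
Proof. by apply: smooth_map_sub (bundle_gram_smooth tt' hF); exact: Ut'. Qed.
Let sAh : smooth_map U Ah.
Proof. by apply: smooth_map_sub (local_map_smooth sA tt tt') => x [[]]. Qed.
Let sQ : smooth_map U Q.
Proof. by apply: smooth_map_sub (bundle_gram_smooth tt hE); exact: Ut. Qed.

Variables (chi : X -> R) (K : set X).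
Hypotheses (schi : smooth_map setT (chi : X -> R^o)) (clK : closed K) (KU : K `<=` U).
Hypothesis chiK : forall x, ~ K x -> chi x = 0.

Let xih (xi : section E) (v : 'rV[R]_n) : 'rV[R]_r :=
  t (chart_inv c v) (xi (chart_inv c v)).

Let xih_Cn xi k : smooth_section xi -> Cn_on k O (xih xi).
Proof.
move=> sxi; apply: Cn_sub (local_section_Cn cc tt k sxi).
by move=> _ [x [cx [[_ tx] _]] <-]; exists x.
Qed.

Lemma local_pairing xi x : U x ->
  hF x (D xi x) (A x (xi x)) =
  (t' x (D xi x) *m (H' x *m (Ah x)^T) *m (t x (xi x))^T) 0 0.
Proof.
move=> Ux; rewrite (bundle_gramE hF _ _ (Ut' Ux)) (local_mapE _ _ _ (Ut Ux)).
by rewrite trmx_mul !mulmxA.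
Qed.

Let cK : set 'rV[R]_n := c @` K.

Let compact_cK : compact cK.
Proof.
apply: continuous_compact.
  apply: continuous_in_subspaceT => x /[!inE] /KU/Uc.
  exact: chart_fun_continuous.
by apply: (subclosed_compact clK (@mcompact _ _ X)).
Qed.

Let closed_cK : closed cK.
Proof. by apply: compact_closed compact_cK; exact: norm_hausdorff. Qed.

Let cKO : cK `<=` O.
Proof. by move=> _ [x Kx <-]; exists x => //; split; [exact/Uc/KU|exact: KU]. Qed.

Let notK v : O v -> ~ cK v -> ~ K (chart_inv c v).
Proof. by move=> Ov ncK Kv; apply: ncK; exists (chart_inv c v) => //; exact: OcK. Qed.

(** In coordinates the integrand is a sum of terms [w * (d_k xi S_k xi^T)] with
[S_k = a_k H' Ah^T] and a term [w * (xi S0 xi^T)] without derivatives, where [w] is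
the cut-off times the volume density. By [symbol_coefficient] and
[concentrating_sym] the matrices [S_k] are symmetric. Hence
[2 * (d_k xi T_k xi^T) = d_k (xi T_k xi^T) - xi (d_k T_k) xi^T] with
[T_k = w *: S_k]: the total derivative integrates to zero, and what is left is a
quadratic form [W] in [xi] whose coefficients are continuous, compactly supported
and independent of [xi]. The metric dominates it. *)
Lemma local_bound : exists2 beta : R, 0 < beta &
  forall xi, smooth_section xi ->
    (`| \int[mu]_x (chi x * hF x (D xi x) (A x (xi x)))%:E | <=
     beta%:E * \int[mu]_x (hE x (xi x) (xi x))%:E)%E.
Proof.
have [Dsm _ /(_ c t t' cc tt tt')[a [b [sa sb DE]]]] := Dfirst.
pose S k x := a k x *m (H' x *m (Ah x)^T).
pose S0 x := b x *m (H' x *m (Ah x)^T).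
have sHA : smooth_map U (fun x => H' x *m (Ah x)^T).
  exact: (smooth_mulmx oU sH' (smooth_trmx oU sAh)).
have sS k : smooth_map U (S k) by exact: (smooth_mulmx oU (sa k) sHA).
have sS0 : smooth_map U S0 by exact: (smooth_mulmx oU sb sHA).
(* The symmetry that makes the integration by parts work. *)
have S_sym k x : U x -> (S k x)^T = S k x.
  move=> Ux; have [u uE] := symbol_coefficient Dsymb cc tt DE k Ux.
  have SE (e e' : E x) : (t x e *m S k x *m (t x e')^T) 0 0 = hF x (sigma x u e) (A x e').
    rewrite (bundle_gramE hF _ _ (Ut' Ux)) (local_mapE _ _ _ (Ut Ux)) uE.
    by rewrite /S trmx_mul !mulmxA.
  apply/matrixP => i j; rewrite mxE.
  have entry i' j' : S k x i' j' = (('e_i' : 'rV[R]_r) *m S k x *m ('e_j' : 'rV[R]_r)^T) 0 0.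
    exact: mx_entryE.
  rewrite !entry -[in LHS](triv_invK (Ut Ux) 'e_i) -[in LHS](triv_invK (Ut Ux) 'e_j).
  rewrite SE (@concentrating_sym R n X E F A hE hF sigma x u _ _ conc) -SE.
  by rewrite !(triv_invK (Ut Ux)).
pose w v : R := chi (chart_inv c v) * rho v.
have w_C k : Cn_on k O (w : 'rV[R]_n -> R^o).
  apply: CnM => //; last by apply: Cn_sub (volume_density_Cn cc k); exact: Oc.
  have /smooth_mapP/(_ c cc k) := schi; rewrite setIT.
  by apply: Cn_sub; exact: Oc.
have w0 v : O v -> ~ cK v -> w v = 0.
  by move=> Ov nv; rewrite /w chiK ?mul0r//; exact: notK.
pose T k v : 'M[R]_r := w v *: S k (chart_inv c v).
have toO (m p k : nat) (f : X -> 'M[R]_(m, p)) : smooth_map U f -> Cn_on k O (f \o chart_inv c).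
  by move=> /smooth_mapP; exact.
have scaleC m p k (w' : 'rV[R]_n -> R) (f : X -> 'M[R]_(m, p)) :
    Cn_on k O (w' : 'rV[R]_n -> R^o) -> smooth_map U f ->
    Cn_on k O (fun v => w' v *: f (chart_inv c v)).
  move=> w'C sf; apply/(Cn_mxP _ _ oO) => i j.
  apply: (@Cn_eq _ _ _ _ _ (fun v => w' v * f (chart_inv c v) i j : R^o)) => //.
    by move=> v _; rewrite mxE.
  have /(Cn_mxP _ _ oO) fC := toO _ _ k f sf.
  by apply: CnM => //; exact: fC.
have T_C k l : Cn_on l O (T k) by exact: (scaleC _ _ l w (S k) (w_C l) (sS k)).
(* W collects what remains after the total derivatives are split off. *)
pose W v : 'M[R]_r := w v *: S0 (chart_inv c v) - 2^-1 *: \sum_k 'D_('e_k) (T k) v.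
have W0 v : O v -> ~ cK v -> W v = 0.
  move=> Ov nv; rewrite /W w0// scale0r add0r big1 ?scaler0 ?oppr0// => k _.
  rewrite -(derive_cst (0 : 'M[R]_r) v 'e_k); apply: near_eq_derive.
  near=> y; rewrite /T /cst w0 ?scale0r//; near: y.
    exact: open_nbhs_nbhs.
  by apply: open_nbhs_nbhs; split => //; exact: closed_openC.
have W_C : Cn_on 0 O W.
  have sumC : Cn_on 0 O (fun v => \sum_k 'D_('e_k) (T k) v).
    apply: (@Cn_sum R _ _ 0 O _ _ _ (fun k => 'D_('e_k) (T k)) oO) => k _.
    exact: (Cn_derive _ (T_C k 1%N)).
  split=> // v Ov; apply: continuousB.
    exact: (Cn_cont (scaleC _ _ 0 w _ (w_C 0) sS0)).
  apply: (@continuousZr _ _ _ (fun v => \sum_k 'D_('e_k) (T k) v)).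
  exact: (Cn_cont sumC Ov).
have Q_cont v : O v -> {for v, continuous (fun v => rho v *: Q (chart_inv c v))}.
  move=> Ov; apply: (Cn_cont (scaleC _ _ 0 rho _ _ sQ)) => //.
  exact: (Cn_sub Oc (volume_density_Cn cc 0)).
have rho_gt0 v : O v -> 0 < rho v by move=> /Oc; exact: volume_density_gt0.
have Q_pos v : O v -> posdef (rho v *: Q (chart_inv c v)).
  move=> Ov u u0; rewrite /quad -scalemxAr -scalemxAl mxE mulr_gt0 ?rho_gt0//.
  by apply: bundle_gram_posdef => //; exact/Ut/OU.
have [beta beta0 hbeta] : exists2 beta, 0 < beta & forall v, cK v -> forall u,
    `|quad (W v) u| <= beta * `|quad (rho v *: Q (chart_inv c v)) u|.
  apply: (compact_uniform compact_cK).
    move=> b1 b2 v b12 h u; apply: le_trans (h u) _; exact: ler_wpM2r.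
  move=> v /cKO Ov.
  have [b1 b10 hb1] := quad_dominated (Cn_cont W_C Ov) (Q_cont v Ov) (Q_pos v Ov).
  exists b1; apply: filterS hb1 => y h u; apply: le_trans (h u) _.
  by apply: ler_wpM2l; [exact: ltW|exact: ler_norm].
exists beta => // xi sxi.
pose e x := hE x (xi x) (xi x).
have e_ge0 x : 0 <= e x by exact: (ip_ge0 (bmetric_inner hE x)).
have e_cont x : {for x, continuous e}.
  exact: (smooth_map_continuous openT _ (smooth_metric hE sxi sxi)).
pose f x := chi x * hF x (D xi x) (A x (xi x)).
have f_cont x : {for x, continuous f}.
  have sf : smooth_map setT (f : X -> R^o).
    apply: (smooth_mapM openT schi).
    by apply: smooth_metric; [exact: Dsm|exact: smooth_section_map].
  exact: (smooth_map_continuous openT _ sf).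
pose q v := quad (W v) (xih xi v).
have h_ge0 v : O v -> 0 <= beta * (e (chart_inv c v) * rho v).
  by move=> Ov; rewrite mulr_ge0 ?(ltW beta0)// mulr_ge0 ?e_ge0 ?(ltW (rho_gt0 v Ov)).
have q_le v : O v -> `|q v| <= beta * (e (chart_inv c v) * rho v).
  move=> Ov; have [Kv|nKv] := pselect (cK v); last first.
    by rewrite /q W0// /quad mulmx0 mul0mx mxE normr0; exact: h_ge0.
  apply: le_trans (hbeta v Kv _) _; rewrite quadZl -bundle_gram_quad; last exact/Ut/OU.
  by rewrite ler_pM2l// mulrC ger0_norm// mulr_ge0 ?e_ge0 ?(ltW (rho_gt0 v Ov)).
(* Extended by zero, phi k is of class C^1 on the whole space. *)
pose phi k (v : 'rV[R]_n) : R^o := if pselect (O v) then quad (T k v) (xih xi v) else 0.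
have phiE k v : O v -> phi k v = quad (T k v) (xih xi v).
  by rewrite /phi; destruct (pselect _).
have phi0 k v : ~ cK v -> phi k v = 0.
  move=> nKv; rewrite /phi; destruct (pselect _) as [Ov|] => //.
  by rewrite /T w0// scale0r /quad mulmx0 mul0mx mxE.
have phi_C1 k : Cn_on 1 setT (phi k).
  apply: Cn_local => v _; have [Kv|nKv] := pselect (cK v).
    exists O; first exact: cKO.
    apply: (@Cn_eq R _ R^o 1 O _ _ oO _ (Cn_quad oO (T_C k 1%N) (xih_Cn 1 sxi))).
    by move=> v' Ov'; rewrite phiE.
  exists (~` cK) => //; apply: (@Cn_eq _ _ _ _ _ (cst 0)).
  - exact: closed_openC.
  - by move=> v' /phi0.
  - exact: Cn_cst.
have [r0 r00 hr0] : exists2 r0 : R, 0 < r0 & forall v, r0 <= `|v| -> ~ cK v.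
  have [M [_ hM]] := compact_bounded compact_cK.
  exists (`|M| + 2); first by rewrite ltr_wpDl.
  move=> v vM Kv; have := hM (`|M| + 1) _ v Kv.
  have -> : M < `|M| + 1 by rewrite (le_lt_trans (ler_norm _))// ltrDl.
  by move=> /(_ isT) /= vM'; have := le_trans vM vM'; rewrite lerD2l; lra.
have Dphi_out k v : ~ O v -> 'D_('e_k) (phi k) v = 0.
  move=> nOv; rewrite -(derive_cst (0 : R^o) v 'e_k); apply: near_eq_derive.
  have nKv : ~ cK v by move=> /cKO.
  near=> y; rewrite phi0//; near: y.
  by apply: open_nbhs_nbhs; split => //; exact: closed_openC.
have T_sym k v : O v -> (T k v)^T = T k v.
  by move=> Ov; rewrite /T linearZ/= S_sym//; exact: OU.
have Dphi_in k v : O v -> 'D_('e_k) (phi k) v =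
    2 * ('D_('e_k) (xih xi) v *m T k v *m (xih xi v)^T) 0 0
    + quad ('D_('e_k) (T k) v) (xih xi v).
  move=> Ov; have dT : derivable (T k) v 'e_k by exact: (Cn_derivable (T_C k 1%N)).
  have dx : derivable (xih xi) v 'e_k by exact: (Cn_derivable (xih_Cn 1 sxi)).
  have [_ <-] := is_derive_quad dT dx (T_sym k v Ov).
  apply: near_eq_derive; near=> y; rewrite phiE//; near: y.
  exact: open_nbhs_nbhs.
have key v : O v -> f (chart_inv c v) * rho v =
    2^-1 * (\sum_k 'D_('e_k) (phi k) v) + q v.
  move=> Ov; have Ux := OU Ov; set x := chart_inv c v in Ux *.
  have -> : f x * rho v = w v * hF x (D xi x) (A x (xi x)).
    by rewrite /f /w mulrAC.
  rewrite (local_pairing _ Ux) DE// OcK//.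
  pose z := xih xi v; pose d k := 'D_('e_k) (xih xi) v.
  pose B k := (d k *m S k x *m z^T) 0 0.
  have -> : ((\sum_(k < n) 'D_('e_k) (fun v0 : 'rV[R]_n =>
      t (chart_inv c v0) (xi (chart_inv c v0))) v *m a k x + t x (xi x) *m b x) *m
      (H' x *m (Ah x)^T) *m (t x (xi x))^T) 0 0 = \sum_k B k + quad (S0 x) z.
    rewrite mulmxDl mulmx_suml mulmxDl mulmx_suml mxE summxE; congr (_ + _).
      by apply: eq_bigr => k _; rewrite /B /S /d !mulmxA.
    by rewrite /quad /S0 !mulmxA.
  rewrite (eq_bigr _ (fun k _ => Dphi_in k v Ov)) big_split /= -mulr_sumr.
  rewrite /q /W quad_sub !quadZl quad_suml -/x -/z.
  have -> : \sum_k ('D_('e_k) (xih xi) v *m T k v *m z^T) 0 0 = w v * \sum_k B k.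
    rewrite mulr_sumr; apply: eq_bigr => k _.
    by rewrite /T -scalemxAr -scalemxAl mxE.
  by field.
have if_U : (\int[mu]_x (f x)%:E = \int[mu]_(x in U) (f x)%:E)%E.
  rewrite [RHS]integral_mkcond; apply: eq_integral => x _; rewrite patchE.
  case: ifPn => //; rewrite notin_setE => nUx.
  by rewrite /f chiK ?mul0r// => /KU.
(* If the integral of the metric term is infinite, so is the bound. *)
have [einf|efin] := eqVneq (\int[mu]_x (e x)%:E)%E +oo%E.
  by rewrite einf mulry gtr0_sg// mul1e leey.
have me : measurable_fun (O : set (borel 'rV[R]_n))
    (fun v => e (chart_inv c v) * rho v).
  apply: continuous_borelR => // v Ov; apply: continuousM.
    apply: continuous_comp; last exact: e_cont.
    by apply: chart_inv_continuous; exact: Oc.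
  exact: (Cn_cont (volume_density_Cn cc 0) (Oc Ov)).
have eO : (\int[nu]_(v in (O : set (borel 'rV[R]_n))) (beta * (e (chart_inv c v) * rho v))%:E <=
    beta%:E * \int[mu]_x (e x)%:E)%E.
  have -> : (\int[nu]_(v in (O : set (borel 'rV[R]_n))) (beta * (e (chart_inv c v) * rho v))%:E =
      beta%:E * \int[mu]_(x in U) (e x)%:E)%E.
    rewrite (chart_integral cc oU Uc) => [|x _]; last exact: e_cont.
    under eq_integral do rewrite EFinM.
    rewrite ge0_integralZl//; last by rewrite lee_fin ltW.
    - exact: open_borel.
    - apply/measurable_EFinP; exact: me.
    - by move=> v Ov; rewrite lee_fin mulr_ge0 ?e_ge0 ?(ltW (rho_gt0 v Ov)).
  apply: lee_wpmul2l; first by rewrite lee_fin ltW.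
  apply: ge0_subset_integral => //.
  - exact: open_borel.
  - apply/measurable_EFinP; apply: (@continuous_borelR R X setT e openT) => x _.
    exact: e_cont.
  - by move=> x _; rewrite lee_fin.
rewrite [X in `|X|%E]if_U (chart_integral cc oU Uc) => [|x _]; last exact: f_cont.
rewrite (_ : (\int[nu]_(v in _) _ = \int[nu]_(v in (O : set (borel 'rV[R]_n)))
   (2^-1 * (\sum_k 'D_('e_k) (phi k) v) + q v)%:E)%E); last first.
  by apply: eq_integral => v; rewrite inE => Ov; rewrite -key.
apply: le_trans (eO); apply: abse_integral_null_part.
- exact: open_borel.
- move=> k; exact: (integral_partial0 nuP 'e_k r00 (phi_C1 k)
    (fun v rv => phi0 k v (hr0 v rv))).
- by move=> k v; exact: Dphi_out.
- apply: continuous_borelR => // v Ov.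
  exact: (Cn_cont (Cn_quad oO W_C (xih_Cn 0 sxi))).
- by apply: measurable_funM => //; exact: me.
- exact: q_le.
- apply: le_lt_trans eO _; rewrite lte_mul_pinfty ?lee_fin ?(ltW beta0)//.
  by rewrite ltey.
Unshelve. all: by end_near. Qed.

End trivialized.

(** This is the heart of the matter: although [D xi] contains derivatives of [xi],
its pairing with [A xi] is bounded, after integration, by the L^2 norm of [xi]
alone. A partition of unity reduces it to the local estimate. *)
Lemma pairing_bound : exists2 beta : R, 0 < beta &
  forall xi, smooth_section xi ->
    mu.-integrable setT (fun x => (hF x (D xi x) (A x (xi x)))%:E) ->
    (`| \int[mu]_x (hF x (D xi x) (A x (xi x)))%:E | <=
     beta%:E * \int[mu]_x (hE x (xi x) (xi x))%:E)%E.
Proof.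
have covE x : exists t : trivialization E, trivs t /\ triv_dom t x.
  by have [t] := trivs_cover E x; exists t.
have [tE tEP] := choice covE.
have covF x : exists t : trivialization F, trivs t /\ triv_dom t x.
  by have [t] := trivs_cover F x; exists t.
have [tF tFP] := choice covF.
pose U x := chart_dom (chart_at x) `&` triv_dom (tE x) `&` triv_dom (tF x).
have oU x : open (U x).
  by apply: openI; [apply: openI; [exact: chart_dom_open|]|]; exact: triv_dom_open.
have Ux x : U x x by split; [split; [exact: chart_at_dom|exact: (tEP x).2]|exact: (tFP x).2].
have [s [chi [K [clK KU schi chiK chi1]]]] := partition_of_unity oU Ux.
have bex i : exists b, 0 < b /\ forall xi, smooth_section xi ->
    (`| \int[mu]_x (chi i x * hF x (D xi x) (A x (xi x)))%:E | <=
     b%:E * \int[mu]_x (hE x (xi x) (xi x))%:E)%E.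
  have [b b0 h] := local_bound (chart_at_charts i) (tEP i).1 (tFP i).1
    (schi i) (clK i) (@KU i) (chiK i).
  by exists b.
have [b bP] := choice bex.
exists (1 + \sum_(i <- s) b i).
  by rewrite ltr_wpDr// sumr_ge0// => i _; exact: ltW (proj1 (bP i)).
move=> xi sxi fint; set f := fun x : X => hF x (D xi x) (A x (xi x)).
have chi_c i x : {for x, continuous (chi i)}.
  exact: (smooth_map_continuous openT _ (schi i)).
have chif i : mu.-integrable setT (fun x => (chi i x * f x)%:E).
  have [|M M0 hM] := @compact_bound R _ (chi i) setT (@mcompact _ _ X).
    by move=> x _; exact: chi_c.
  apply: (@le_integrable _ _ _ mu setT _ _ (fun x => (M%:E * (f x)%:E)%E)) => //.
  - apply/measurable_EFinP; apply: measurable_funM.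
      by apply: continuous_borelR => //; exact: openT.
    by apply/measurable_EFinP; case/integrableP: fint.
  - move=> x _; rewrite -EFinM !abse_EFin lee_fin !normrM ler_wpM2r// (gtr0_norm M0).
    exact: hM.
  - exact: integrableZl.
have e0 : (0 <= \int[mu]_x (hE x (xi x) (xi x))%:E)%E.
  by apply: integral_ge0 => x _; rewrite lee_fin; exact: (ip_ge0 (bmetric_inner hE x)).
have -> : (\int[mu]_x (f x)%:E = \sum_(i <- s) \int[mu]_x (chi i x * f x)%:E)%E.
  rewrite -(integral_sum measurableT chif); apply: eq_integral => x _.
  by rewrite sumEFin -mulr_suml chi1 mul1r.
apply: le_trans (lee_abs_sum _ _ _) _.
apply: (@le_trans _ _ (\sum_(i <- s) (b i)%:E * \int[mu]_x (hE x (xi x) (xi x))%:E)%E).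
  by apply: lee_sum => i _; exact: (bP i).2.
rewrite -ge0_sume_distrl; last by move=> i _; rewrite lee_fin ltW ?(bP i).1.
by rewrite sumEFin; apply: lee_wpmul2r => //; rewrite lee_fin lerDr.
Qed.

End local_integration_by_parts.

(** * Neighbourhoods for the Riemannian distance *)

Section distance.
Variables (R : realType) (n : nat) (X : closed_manifold R n).
Variable g : riemannian_metric X.

Lemma gram_continuous (c : chart R n X) v : charts c -> (c @` chart_dom c) v ->
  {for v, continuous (gram g c \o chart_inv c)}.
Proof.
move=> cc cv; apply/continuous_mxP => i j.
have /smooth_mapP/(_ c cc 0) := rmetric_smooth g i j cc; rewrite setIid => h.
rewrite (_ : (fun y => _) = (fun x => g x (coord_vector c i x) (coord_vector c j x)) \o chart_inv c).
  exact: (Cn_cont h cv).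
by apply/funext => y; rewrite /= mxE.
Qed.

Lemma Cn_affine m k (a w : 'rV[R]_m) (U : set R^o) :
  Cn_on k U (fun t : R^o => t *: w + a).
Proof.
apply: (@Cn_sub R _ _ k setT) => //; have oT : open [set: R^o] by exact: openT.
apply/(Cn_mxP _ _ oT) => i j.
apply: (@Cn_eq R _ R^o k setT (fun t : R^o => t * w i j + a i j : R^o) _ oT).
  by move=> t _; rewrite !mxE.
apply: (CnD oT); last exact: Cn_cst.
apply: (CnM oT); last exact: Cn_cst.
by apply: Cn_lin => // t _; exact: cvg_id.
Qed.

Section segment.
Variables (c : chart R n X) (a w : 'rV[R]_n) (r : R).
Hypotheses (cc : charts c) (wr : `|w| < r).
Hypothesis ball_c : forall v : 'rV[R]_n, `|v - a| < r -> (c @` chart_dom c) v.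

Let gamma (t : R) : X := chart_inv c (t *: w + a).
Let U : set R := [set t | `|t *: w| < r].

Let Uc t : U t -> (c @` chart_dom c) (t *: w + a).
Proof. by move=> Ut; apply: ball_c; rewrite addrK. Qed.

Let line_cont : continuous (fun t : R => t *: w + a).
Proof. by move=> t; exact: (Cn_cont (Cn_affine 0 a w [set: R^o])). Qed.

Lemma segment_open : open U.
Proof.
have -> : U = (fun t : R => `|t *: w|) @^-1` [set y | y < r] by [].
apply: open_comp; last exact: open_lt.
move=> t _; apply: continuous_comp; last exact: norm_continuous.
exact: (@continuousZl _ _ _ _ w t).
Qed.

Lemma segment_unit_itv : `[0, 1] `<=` U.
Proof.
move=> t /=; rewrite in_itv/= => /andP[t0 t1]; rewrite /U/= normrZ ger0_norm//.
by rewrite (le_lt_trans _ wr)// ler_piMl.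
Qed.

Lemma segment_smooth : smooth_curve U gamma.
Proof.
split=> [t Ut|c' cc'].
  apply: (@continuous_comp _ _ _ (fun t : R => t *: w + a) (chart_inv c)).
    exact: line_cont.
  by apply: chart_inv_continuous; exact: Uc.
apply/smooth_onP => k.
pose O := c @` (chart_dom c `&` chart_dom c').
have oO : open O by apply: open_chart_imgI; exact: chart_dom_open.
have UO t : (U `&` gamma @^-1` chart_dom c') t -> O (t *: w + a).
  move=> [Ut c't]; have [cx xE] := chart_img_inv (Uc Ut).
  by exists (gamma t).
have oU' : open (U `&` gamma @^-1` chart_dom c').
  apply: openI_preimage; [exact: segment_open| |exact: chart_dom_open].
  move=> t Ut; apply: (@continuous_comp _ _ _ (fun t : R => t *: w + a) (chart_inv c)).
    exact: line_cont.
  by apply: chart_inv_continuous; exact: Uc.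
have hC : Cn_on k O (c' \o chart_inv c) by apply: smooth_Cn; exact: charts_compatible.
apply/(Cn_mxP _ _ oU') => i j.
have /(Cn_mxP _ _ oO)/(_ i j) hij := hC.
exact: (Cn_comp oU' oO UO (Cn_affine k a w _) hij).
Qed.

(** A chart segment has constant components [w] in the moving frame of coordinate
vectors. *)
Lemma segment_velocity t : U t ->
  velocity gamma t = \sum_i w 0 i *: coord_vector c i (gamma t).
Proof.
move=> Ut; have [cx xE] := chart_img_inv (Uc Ut).
rewrite -coord_vector_sum// /gamma xE /velocity derive1E.
exact: (derive_line (chart_at (gamma t) \o chart_inv c) a w t).
Qed.

Lemma segment_length (L : R) : 0 <= L ->
  (forall v, `|v - a| < r -> forall u, quad (gram g c (chart_inv c v)) u <= L ^+ 2 * `|u| ^+ 2) ->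
  (curve_length g gamma 0 1 <= (L * `|w|)%:E)%E.
Proof.
move=> L0 hL; have -> : (L * `|w|)%:E = (\int[@lebesgue_measure R]_(t in `[0%R, 1%R]) (L * `|w|)%:E)%E.
  have := integral_cst (@lebesgue_measure R) (measurable_itv `[0, 1]) (L * `|w|)%:E.
  have m01 : @lebesgue_measure R [set` `[0, 1]] = 1%E.
    by rewrite lebesgue_measure_itv/= lte01 oppr0 adde0.
  by move=> h; apply/esym; apply: etrans h _; rewrite -[RHS]mule1; congr (_ * _)%E.
apply: ge0_le_integral_any => // t.
  by rewrite lee_fin mulr_ge0.
move=> t01; have Ut := segment_unit_itv t01; rewrite lee_fin segment_velocity// -gram_quad.
rewrite -[leRHS]ger0_norm ?mulr_ge0// -sqrtr_sqr ler_sqrt ?sqr_ge0// exprMn.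
by apply: hL; rewrite addrK.
Qed.

End segment.

(** Near [z] the metric is bounded in a chart by a multiple [L ^+ 2] of the squared
norm, so straight segments of the chart have length at most [L] times the distance
of the coordinates; they are short enough for points close to [z]. *)
Lemma dist_nbhd_nbhs (Z : set X) (delta : R) z : 0 < delta -> Z z ->
  nbhs z (dist_nbhd g Z delta).
Proof.
move=> d0 Zz; pose c := chart_at z; pose a := c z.
have cc : charts c by exact: chart_at_charts.
have cz : chart_dom c z by exact: chart_at_dom.
have ca : (c @` chart_dom c) a by exists z.
pose M := `|gram g c (chart_inv c a)| + 1.
pose L := n.+1%:R * M.
have M1 : 1 <= M by rewrite lerDr.
have L0 : 0 < L by rewrite mulr_gt0// (lt_le_trans ltr01).
have : \forall v \near a, (c @` chart_dom c) v /\ `|gram g c (chart_inv c v)| <= M.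
  apply: filterI; first by apply: open_nbhs_nbhs; split => //; exact: chart_img_open.
  have /cvgrPdist_le/(_ 1 ltr01) := gram_continuous cc ca.
  apply: filterS => v hv; rewrite -(subrK (gram g c (chart_inv c a)) (gram g c (chart_inv c v))).
  by rewrite (le_trans (ler_normD _ _))// addrC lerD2l distrC.
move=> /nbhs_normP[r /= r0 hr].
have hr' v : `|v - a| < r -> (c @` chart_dom c) v /\ `|gram g c (chart_inv c v)| <= M.
  by move=> h; apply: hr; rewrite /= distrC.
have hL v : `|v - a| < r -> forall u, quad (gram g c (chart_inv c v)) u <= L ^+ 2 * `|u| ^+ 2.
  move=> /hr'[_ vM] u; apply: le_trans (ler_norm _) _; apply: le_trans (quad_le _ _) _.
  apply: ler_wpM2r; first exact: sqr_ge0.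
  rewrite exprMn ler_pM ?sqr_ge0//.
    by rewrite ler_sqr ?nnegrE// ler_nat.
  by rewrite (le_trans vM)// expr2 ler_peMl// (le_trans ler01).
have : \forall x \near z, chart_dom c x /\ (`|c x - a| < r /\ `|c x - a| < delta / L).
  apply: filterI; first by apply: open_nbhs_nbhs; split => //; exact: chart_dom_open.
  have cont := chart_fun_continuous cz.
  apply: filterI; have /cvgrPdist_lt := cont.
    by move=> /(_ r r0); apply: filterS => x; rewrite distrC.
  by move=> /(_ _ (divr_gt0 d0 L0)); apply: filterS => x; rewrite distrC.
apply: filterS => x [cx [xr xd]]; exists z => //.
pose w := c x - a; pose gamma t := chart_inv c (t *: w + a).
apply: (@le_lt_trans _ _ (curve_length g gamma 0 1)).
  apply: ereal_inf_lbound; exists gamma, 0, 1; split => //.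
  - apply: (@piecewise_smooth_arc _ _ _ _ 0 1 [set t | `|t *: w| < r] gamma) => //.
    + exact: segment_open.
    + exact: segment_unit_itv xr.
    + have := @segment_smooth c a w r cc (fun v h => (hr' v h).1); exact.
  - by rewrite /gamma scale0r add0r chart_funK.
  - by rewrite /gamma scale1r subrK chart_funK.
apply: (@le_lt_trans _ _ (L * `|w|)%:E).
  exact: (segment_length cc xr (fun v h => (hr' v h).1) (ltW L0) hL).
by rewrite lte_fin mulrC -ltr_pdivlMr.
Qed.

End distance.

(** * The concentration estimate *)

Section pointwise_bounds.
Variables (R : realType) (n : nat) (X : closed_manifold R n).
Variables (E F : vector_bundle X) (hE : bundle_metric E) (hF : bundle_metric F).
Variable A : forall x, {linear E x -> F x}.
Hypothesis sA : smooth_bundle_map A.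

Let form_AA (t : trivialization E) (t' : trivialization F) x :=
  local_map A t t' x *m bundle_gram t' hF x *m (local_map A t t' x)^T.

Let form_AAE t t' x (e : E x) : triv_dom t x -> triv_dom t' x ->
  hF x (A x e) (A x e) = quad (form_AA t t' x) (t x e).
Proof.
move=> tx t'x; rewrite (bundle_gram_quad hF _ t'x) (local_mapE _ _ _ tx) /quad /form_AA.
by rewrite trmx_mul !mulmxA.
Qed.

Let local_continuity x : exists t t' (U : set X),
  [/\ open U /\ U x, U `<=` triv_dom t, U `<=` triv_dom t',
    {for x, continuous (form_AA t t')} & {for x, continuous (bundle_gram t hE)}].
Proof.
have [t tt tx] := trivs_cover E x; have [t' tt' t'x] := trivs_cover F x.
pose U := triv_dom t `&` triv_dom t'.
have oU : open U by apply: openI; exact: triv_dom_open.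
have Ux : U x by [].
have sL : smooth_map U (local_map A t t') by exact: local_map_smooth.
have sH : smooth_map U (bundle_gram t' hF).
  by apply: smooth_map_sub (bundle_gram_smooth tt' hF) => y [].
exists t, t', U; split.
- by split.
- by move=> y [].
- by move=> y [].
- apply: (smooth_map_continuous oU Ux).
  exact: (smooth_mulmx oU (smooth_mulmx oU sL sH) (smooth_trmx oU sL)).
- exact: (smooth_map_continuous (triv_dom_open t) tx (bundle_gram_smooth tt hE)).
Qed.

(** The metric of [E] is definite, hence dominates the pull-back of that of [F]
locally; the manifold is compact. *)
Lemma bundle_map_bounded : exists2 M : R, 0 < M &
  forall x (e : E x), hF x (A x e) (A x e) <= M * hE x e e.
Proof.
have e0 x (e : E x) : 0 <= hE x e e by exact: (ip_ge0 (bmetric_inner hE x)).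
have [M M0 hM] : exists2 M : R, 0 < M & forall x, [set: X] x ->
    forall e : E x, hF x (A x e) (A x e) <= M * hE x e e.
  apply: (compact_uniform (@mcompact _ _ X)).
    by move=> a b x ab h e; apply: le_trans (h e) _; exact: ler_wpM2r.
  move=> x _; have [t [t' [U [[oU Ux] Ut Ut' cA cE]]]] := local_continuity x.
  have [b _ hb] := quad_dominated cA cE (bundle_gram_posdef hE (Ut x Ux)).
  exists b; near=> y => e; have Uy : U y by near: y; exact: open_nbhs_nbhs.
  rewrite (form_AAE _ (Ut y Uy) (Ut' y Uy)) (bundle_gram_quad hE e (Ut y Uy)).
  apply: le_trans (ler_norm _) _; move: (t y e).
  by near: y.
by exists M => // x e; exact: hM.
Unshelve. all: by end_near. Qed.

(** Where [A x] is injective, the metric of [F] pulls back to a definite form, which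
dominates the metric of [E] nearby; compactness makes the constant uniform. *)
Lemma bundle_map_coercive (K : set X) : compact K -> K `<=` ~` singular_set A ->
  exists2 k : R, 0 < k &
    forall x (e : E x), K x -> hE x e e <= k * hF x (A x e) (A x e).
Proof.
move=> cK KZ.
have e0 x (f : F x) : 0 <= hF x f f by exact: (ip_ge0 (bmetric_inner hF x)).
have [M M0 hM] : exists2 M : R, 0 < M & forall x, K x ->
    forall e : E x, hE x e e <= M * hF x (A x e) (A x e).
  apply: (compact_uniform cK).
    by move=> a b x ab h e; apply: le_trans (h e) _; exact: ler_wpM2r.
  move=> x Kx; have [t [t' [U [[oU Ux] Ut Ut' cA cE]]]] := local_continuity x.
  have posA : posdef (form_AA t t' x).
    move=> u u0; rewrite -[u](triv_invK (Ut x Ux)) -(form_AAE _ (Ut x Ux) (Ut' x Ux)).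
    have [_ _ hpos] := bmetric_inner hF x; apply: hpos; apply/eqP => A0.
    apply: (KZ x Kx); exists (triv_inv t x u) => //.
    apply: contra u0 => /eqP i0.
    by rewrite -(triv_invK (Ut x Ux) u) i0 linear0.
  have [b _ hb] := quad_dominated cE cA posA.
  exists b; near=> y => e; have Uy : U y by near: y; exact: open_nbhs_nbhs.
  rewrite (form_AAE _ (Ut y Uy) (Ut' y Uy)) (bundle_gram_quad hE e (Ut y Uy)).
  apply: le_trans (ler_norm _) _; move: (t y e).
  by near: y.
by exists M => // x e Kx; exact: hM.
Unshelve. all: by end_near. Qed.

End pointwise_bounds.

Lemma L2norm_sqr (R : realType) (n : nat) (X : closed_manifold R n)
    (mu : {measure set (borel X) -> \bar R}) (E : vector_bundle X)
    (h : bundle_metric E) (xi : section E) :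
  (L2norm mu h xi ^+ 2 = \int[mu]_x (h x (xi x) (xi x))%:E)%E.
Proof.
rewrite /L2norm expe2; set N := ('N[_]_ _ [_])%E.
have N0 : (0 <= N)%E by exact: Lnorm_ge0.
have -> : (N * N = N `^ 2)%E.
  have -> : 2%R = (1 + 1)%R :> R by ring.
  rewrite poweRD ?poweRe1//; apply: add_neq0_poweRD_def.
  by rewrite -mulr2n pnatr_eq0.
rewrite powR_Lnorm//; apply: eq_integral => x _.
rewrite abse_EFin poweR_EFin powR_mulrn// ger0_norm ?sqrtr_ge0// sqr_sqrtr//.
exact: (ip_ge0 (bmetric_inner h x)).
Qed.

Section inner_product_bounds.
Variables (R : realType) (V : lmodType R) (h : V -> V -> R).
Hypothesis hP : is_inner_product h.

Lemma ip_le_mean v w : `|h v w| <= (h v v + h w w) / 2.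
Proof.
have := ip_ge0 hP (v + w); have := ip_ge0 hP (v + (-1) *: w).
rewrite !(ipDl hP) !(ipDr hP) !(ipZl hP) !(ipZr hP) (ipC hP w v) => h1 h2.
by rewrite ler_norml; apply/andP; split; lra.
Qed.

Lemma ip_sqrD v w s : h (v + s *: w) (v + s *: w) =
  h v v + s ^+ 2 * h w w + 2 * s * h v w.
Proof.
by rewrite !(ipDl hP) !(ipDr hP) !(ipZl hP) !(ipZr hP) (ipC hP w v); ring.
Qed.

End inner_product_bounds.

Theorem proposition2p4 (R : realType) (n : nat) (X : closed_manifold R n)
    (g : riemannian_metric X)
    (mu : {measure set (g_sigma_algebraType (@open X)) -> \bar R})
    (E F : vector_bundle X) (hE : bundle_metric E) (hF : bundle_metric F)
    (D : section E -> section F)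
    (sigma : forall x, 'rV[R]_n -> {linear E x -> F x})
    (A : forall x, {linear E x -> F x}) :
  is_riemannian_volume g mu ->
  first_order_operator D ->
  is_symbol D sigma ->
  elliptic_symbol sigma ->
  smooth_bundle_map A ->
  concentrating_pair hE hF sigma A ->
  forall (delta : R), 0 < delta -> forall (C : R), 0 <= C ->
  exists2 C' : R, 0 < C' &
    forall s : R, s != 0 -> forall xi : section E, smooth_section xi ->
      L2norm mu hE xi = 1%E ->
      (L2norm mu hF (deformation D A s xi) ^+ 2 <= (C * `|s|)%:E)%E ->
      (\int[mu]_(x in ~` dist_nbhd g (singular_set A) delta)
         (hE x (xi x) (xi x))%:E < (C' / `|s|)%:E)%E.
Proof.
move=> muP Dfirst Dsymb _ sA conc delta delta0 C C0.
have [nu nuP] := lebesgue_rV_exists R n.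
have [beta beta0 hbeta] := pairing_bound muP nuP Dfirst Dsymb sA conc.
(* The interior still contains Z, and its complement is compact. *)
pose Z := singular_set A; pose K := ~` interior (dist_nbhd g Z delta).
have cK : compact K.
  apply: (subclosed_compact _ (@mcompact _ _ X)) => //.
  by apply: open_closedC; exact: open_interior.
have KZ : K `<=` ~` Z by move=> x Kx Zx; apply: Kx; exact: dist_nbhd_nbhs.
have [k k0 hk] := bundle_map_coercive hE hF sA cK KZ.
have [M M0 hM] := bundle_map_bounded hE hF sA.
exists (k * (C + 2 * beta) + 1).
  by rewrite ltr_wpDl// mulr_ge0 ?(ltW k0)// addr_ge0// mulr_ge0 ?(ltW beta0).
move=> s s0 xi sxi norm1 normD.
have [sD _ _] := Dfirst.
have sDxi := sD _ sxi; have sAxi := smooth_section_map sA sxi.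
pose e x := hE x (xi x) (xi x).
pose a x := hF x (A x (xi x)) (A x (xi x)).
pose d x := hF x (D xi x) (D xi x).
pose p x := hF x (D xi x) (A x (xi x)).
pose q x := hF x (deformation D A s xi x) (deformation D A s xi x).
have hFP x := bmetric_inner hF x.
have e0 x : 0 <= e x by exact: (ip_ge0 (bmetric_inner hE x)).
have a0 x : 0 <= a x by exact: ip_ge0.
have d0 x : 0 <= d x by exact: ip_ge0.
have q0 x : 0 <= q x by exact: ip_ge0.
have qE x : q x = d x + s ^+ 2 * a x + 2 * s * p x by exact: ip_sqrD.
have meas (G : vector_bundle X) (h : bundle_metric G) (f f' : section G) :
    smooth_section f -> smooth_section f' ->
    measurable_fun [set: borel X] (fun x => h x (f x) (f' x)).
  move=> sf sf'; apply: (@continuous_borelR R X setT _ openT) => x _.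
  exact: (smooth_map_continuous openT _ (smooth_metric h sf sf')).
have me : measurable_fun [set: borel X] e by exact: meas.
have ma : measurable_fun [set: borel X] a by exact: meas.
have md : measurable_fun [set: borel X] d by exact: meas.
have mp : measurable_fun [set: borel X] p by exact: meas.
have mq : measurable_fun [set: borel X] q.
  rewrite (_ : q = fun x => d x + s ^+ 2 * a x + 2 * s * p x); last exact/funext.
  by apply: measurable_funD; [apply: measurable_funD => //|]; exact: measurable_funM.
have inte : (\int[mu]_x (e x)%:E = 1)%E by rewrite -L2norm_sqr norm1 expe2 mule1.
have intq : (\int[mu]_x (q x)%:E <= (C * `|s|)%:E)%E by rewrite -L2norm_sqr.
have ge0_integrable (f : X -> R) : measurable_fun [set: borel X] f ->
    (forall x, 0 <= f x) -> (\int[mu]_x (f x)%:E < +oo)%E ->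
    mu.-integrable setT (EFin \o f).
  move=> mf f0 fint; apply/integrableP; split; first exact/measurable_EFinP.
  by under eq_integral do rewrite /= ger0_norm//.
have dominated (f f' : X -> R) : measurable_fun [set: borel X] f ->
    (forall x, `|f x| <= f' x) -> mu.-integrable setT (EFin \o f') ->
    mu.-integrable setT (EFin \o f).
  move=> mf ff' int'; apply: le_integrable int' => //; first exact/measurable_EFinP.
  by move=> x _; rewrite /= lee_fin; apply: le_trans (ff' x) _; exact: ler_norm.
have ie : mu.-integrable setT (EFin \o e).
  by apply: ge0_integrable => //; rewrite inte ltry.
have iq : mu.-integrable setT (EFin \o q).
  by apply: ge0_integrable => //; exact: le_lt_trans intq (ltry _).
have ia : mu.-integrable setT (EFin \o a).
  apply: (@dominated _ (fun x => M * e x)) => //; last exact: (integrableZl measurableT M ie).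
  by move=> x; rewrite ger0_norm//; exact: hM.
(* |v|^2 <= 2 |v + s w|^2 + 2 s^2 |w|^2, as the difference is |v + 2 s w|^2. *)
have id : mu.-integrable setT (EFin \o d).
  apply: (@dominated _ (fun x => 2 * q x + (2 * s ^+ 2) * a x)) => //.
    move=> x; rewrite ger0_norm// qE.
    have := ip_sqrD (hFP x) (D xi x) (A x (xi x)) (2 * s).
    have := ip_ge0 (hFP x) (D xi x + (2 * s) *: A x (xi x)).
    move=> + h; rewrite h -/(d x) -/(a x) -/(p x); lra.
  exact: (integrableD measurableT (integrableZl measurableT 2 iq)
    (integrableZl measurableT (2 * s ^+ 2) ia)).
have ip : mu.-integrable setT (EFin \o p).
  apply: (@dominated _ (fun x => 2^-1 * d x + 2^-1 * a x)) => //.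
    move=> x; apply: le_trans (ip_le_mean (hFP x) _ _) _.
    by rewrite mulrC mulrDr.
  exact: (integrableD measurableT (integrableZl measurableT 2^-1 id)
    (integrableZl measurableT 2^-1 ia)).
have hp : (`| \int[mu]_x (p x)%:E | <= beta%:E)%E.
  by have := hbeta xi sxi ip; rewrite inte mule1.
have fin f : mu.-integrable setT (EFin \o f) -> exists r : R, (\int[mu]_x (f x)%:E)%E = r%:E.
  by move=> /integrable_fin_num h; exists (fine (\int[mu]_x (f x)%:E)); rewrite fineK// h.
have [a' aE] := fin a ia; have [p' pE] := fin p ip; have [q' qE'] := fin q iq.
(* Drop the nonnegative term |D xi|^2 from the expansion of |D_s xi|^2. *)
have key : s ^+ 2 * a' <= q' - 2 * s * p'.
  rewrite -lee_fin EFinB !EFinM -aE -pE -qE'.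
  rewrite -integralZl// -integralZl// -integralB//; last exact: integrableZl.
  apply: le_integral => //.
  - exact: integrableZl.
  - by apply: integrableB => //; exact: integrableZl.
  - by move=> x _; rewrite -!EFinM -EFinB lee_fin qE; have := d0 x; lra.
have ns : 0 < `|s| by rewrite normr_gt0.
have a'_le : a' * `|s| <= C + 2 * beta.
  move: intq hp; rewrite qE' pE !lee_fin => hq hp.
  rewrite -(ler_pM2r ns) -mulrA -expr2 real_normK ?num_real//.
  apply: (@le_trans _ _ (q' - 2 * s * p')); first by rewrite mulrC.
  rewrite [leRHS]mulrDl; apply: lerD => //.
  apply: le_trans (ler_norm _) _; rewrite normrN !normrM (ger0_norm (_ : 0 <= 2))//.
  by rewrite -!mulrA ler_pM2l// mulrC ler_pM2r.
apply: (@le_lt_trans _ _ (\int[mu]_x (k * a x)%:E)%E).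
  have sub : ~` dist_nbhd g Z delta `<=` K.
    by apply: subsetC; exact: interior_subset.
  apply: ge0_le_integral_any => //.
  - by move=> x _; rewrite lee_fin; exact: e0.
  - by move=> x _; rewrite lee_fin mulr_ge0// ltW.
  - by move=> x nx; rewrite lee_fin; apply: hk; exact: sub.
under eq_integral do rewrite EFinM.
rewrite integralZl// aE -EFinM lte_fin ltr_pdivlMr// -mulrA.
by apply: le_lt_trans (ler_wpM2l (ltW k0) a'_le) _; rewrite ltrDl.
Qed.
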